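(* Let $E$ be a locally compact and separable Banach space over $\mathbb{R}$ with norm $\|\cdot\|$, let $\mathcal{S}_{\|\cdot\|}=\{z\in E:\|z\|=1\}$, and fix $\alpha>0$. (1) Let $(\xi_t,\Xi_t)_{t\ge 0}$ be an $\mathbb{R}\times\mathcal{S}_{\|\cdot\|}$-valued Markov additive process (MAP) with cemetery state $(-\infty,\partial)$ and lifetime $\zeta$. Set $\phi(t)=\inf\{s>0:\int_0^s e^{\alpha\xi_r}\,dr>t\}$, $t\ge 0$. Then the $E$-valued process whose $\|\cdot\|$-polar decomposition is $(e^{\xi_{\phi(t)}},\Xi_{\phi(t)})_{t\ge 0}$ (with $e^{-\infty}=0$) is a self-similar Markov process (ssMp) with index of self-similarity $\alpha$, cemetery state $0\in E$ and lifetime $K=\int_0^{\zeta}e^{\alpha\xi_s}\,ds$. (2) Conversely, let $(Z_t)_{t\ge 0}$ be an $E$-valued ssMp with index of self-similarity $\alpha$, cemetery state $0$ and lifetime $K=\inf\{t>0:\|Z_t\|=0\}$. Put $I_t=\inf\{s>0:\int_0^s\|Z_r\|^{-\alpha}\,dr>t\}$, $t\ge0$, and $\zeta=\int_0^{K}\|Z_r\|^{-\alpha}\,dr$. Then the process $(\xi,\Xi)$ defined by $$(\xi_t,\Xi_t)=\begin{cases}\big(\log\|Z_{I_t}\|,\ \tfrac{1}{\|Z_{I_t}\|}Z_{I_t}\big), & t<\zeta,\\ (-\infty,\partial), & t\ge\zeta,\end{cases}$$ is an $\mathbb{R}\times\mathcal{S}_{\|\cdot\|}$-valued MAP with cemetery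 state $(-\infty,\partial)$ and lifetime $\zeta$.
   Context: Polar decomposition: $x\in E\setminus\{0\}$ is identified with $(\|x\|,\arg(x))$, where $\arg(x)=x/\|x\|\in\mathcal{S}_{\|\cdot\|}$; the vector $0\in E$ is identified with $(0,\partial)$, where $\partial\notin E$ is an isolated cemetery point. Functions on a state space are extended by $0$ to the cemetery state. If $\phi(t)=\infty$ or $\phi(t)\ge\zeta$, then $(\xi_{\phi(t)},\Xi_{\phi(t)})$ is understood as $(-\infty,\partial)$. (Regular) strong Markov process: a Markov family (one law for each starting point) which is càdlàg and quasi-left-continuous on $[0,\text{lifetime})$, has the strong Markov property at stopping times, and is absorbed at its cemetery state at its lifetime. Self-similar Markov process (ssMp) with index $\alpha>0$: an $E$-valued strong Markov process $Z$ with laws $(\mathbb{P}_x,x\in E)$ such that for every $c>0$ and $x\in E$, the law of $(cZ_{c^{-\alpha}t})_{t\ge 0}$ under $\mathbb{P}_x$ equals the law of $(Z_t)_{t\ge 0}$ under $\mathbb{P}_{cx}$. Markov additive process (MAP) on $\mathbb{R}\times S$ (here $S=\mathcal{S}_{\|\cdot\|}$): a regular strong Markov process $(\xi,\Xi)$ on $\mathbb{R}\times S$ with filtration $(\mathcal{G}_t)$, laws $\mathbb{P}_{(x,\theta)}$, $(x,\theta)\in\mathbb{R}\times S$, and cemetery state $(-\infty,\partial)$, such that $\Xi$ is a regular strong Markov process on $S$ with cemetery state $\partial$ and, with $\zeta=\inf\{t>0:\Xi_t=\partial\}$ the lifetime, for every bounded measurable $f:\mathbb{R}\times S\to[0,\infty)$,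 all $t,s\ge0$ and $(y,\theta)\in\mathbb{R}\times S$, $\mathbb{P}_{(y,\theta)}$-a.s., $$\mathbb{E}_{(y,\theta)}\big[f(\xi_{t+s}-\xi_t,\Xi_{t+s})\mathbf{1}_{\{t+s<\zeta\}}\,\big|\,\mathcal{G}_t\big]=\mathbb{E}_{(0,\theta')}\big[f(\xi_s,\Xi_s)\mathbf{1}_{\{s<\zeta\}}\big]\Big|_{\theta'=\Xi_t},$$ where the right-hand side is $0$ when $\Xi_t=\partial$. Laws under the transformations: in (1) the law of the ssMp started from $z\ne0$ is the image of $\mathbb{P}_{(\log\|z\|,\arg(z))}$ (and it stays at $0$ if started from $0$); in (2) the law of $(\xi,\Xi)$ started from $(x,\theta)$ is the image of the law of $Z$ started from $e^{x}\theta$. *)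

(* Defs.v *)
From HB Require Import structures.
From mathcomp Require Import all_boot all_order all_algebra.
From mathcomp Require Import all_classical all_reals all_analysis.
From mathcomp Require Import measurable_realfun.

Set Implicit Arguments.
Unset Strict Implicit.
Unset Printing Implicit Defensive.

Import Order.TTheory GRing.Theory Num.Theory.
Import numFieldNormedType.Exports.

Local Open Scope classical_set_scope.
Local Open Scope ring_scope.

Definition separable (T : topologicalType) : Prop :=
  exists2 D : set T, countable D & dense D.

(* Sets rather than [g_sigma_algebraType]: the latter needs a pointed type, and
   the unit sphere of the trivial space is empty. *)
Definition borel (T : topologicalType) : set (set T) := <<s @open T >>.
Arguments borel : clear implicits.

Definition borel_fun (T : topologicalType) d (V : sigmaRingType d) (f : T -> V)
  : Prop := forall B, measurable B -> borel T (f @^-1` B).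

(* A state space with an added isolated cemetery point, [None]. *)
Definition cemetery (T : Type) : Type := option T.

Definition grave {T : Type} : cemetery T := None.

Section cemetery_topology.
Context {T : topologicalType}.

HB.instance Definition _ := Choice.on (cemetery T).

Definition cemetery_open : set_system (cemetery T) :=
  [set U | open (Some @^-1` U)].

Let cemetery_openT : cemetery_open setT.
Proof. exact: openT. Qed.

Let cemetery_openI : setI_closed cemetery_open.
Proof. by move=> A B oA oB; exact: openI. Qed.

Let cemetery_open_bigU (I : Type) (f : I -> set (cemetery T)) :
  (forall i, cemetery_open (f i)) -> cemetery_open (\bigcup_i f i).
Proof. move=> of_; rewrite /cemetery_open /= preimage_bigcup.
by apply: bigcup_open => i _; exact: of_.
Qed.

HB.instance Definition _ := isOpenTopological.Build (cemetery T)
  cemetery_openT cemetery_openI cemetery_open_bigU.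

End cemetery_topology.

(* Functions on a state space are extended by 0 to the cemetery. *)
Definition ext0 (R : realType) (T : Type) (f : T -> R) (y : cemetery T) : R :=
  if y is Some x then f x else 0.

Section strong_markov.
Context {R : realType} {d : measure_display} {Omega : measurableType d}.

(* Time is [0, +oo[, written as t : R with 0 <= t; values at negative times are
   never used. *)

Definition sub_sigma_algebra (F : set_system Omega) : Prop :=
  sigma_algebra setT F /\ F `<=` measurable.

Definition filtration (G : R -> set_system Omega) : Prop :=
  [/\ forall t : R, 0 <= t -> sub_sigma_algebra (G t),
      forall s t : R, 0 <= s -> s <= t -> G s `<=` G t &
      forall (t : R) A, 0 <= t -> (forall u : R, t < u -> G u A) -> G t A].

Definition stopping_time (G : R -> set_system Omega) (tau : Omega -> \bar R)
  : Prop :=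
  (forall w, 0 <= tau w)%E /\
  (forall t : R, 0 <= t -> G t [set w | (tau w <= t%:E)%E]).

Definition stopped_algebra (G : R -> set_system Omega) (tau : Omega -> \bar R)
  : set_system Omega :=
  [set A | measurable A /\
           forall t : R, 0 <= t -> G t (A `&` [set w | (tau w <= t%:E)%E])].

(* V is a version of the conditional expectation of U given F. *)
Definition is_condexp (P : probability Omega R) (F : set_system Omega)
    (U V : Omega -> \bar R) : Prop :=
  [/\ P.-integrable setT U, P.-integrable setT V,
      forall B : set (\bar R), measurable B -> F (V @^-1` B) &
      forall A, F A -> \int[P]_(w in A) U w = \int[P]_(w in A) V w]%E.

Definition lifetime (T : Type) (del : T) (X : R -> Omega -> T) (w : Omega)
  : \bar R :=
  ereal_inf [set t%:E | t in [set t : R | 0 < t /\ X t w = del]].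

(* Strong Markov process on the state space T with cemetery del : the same maps
   X under a family of laws, one for each starting point, del included.
   Following the usual definition of a standard process, the filtration is
   right-continuous, right-continuity and absorption hold for all w, and left
   limits and quasi-left-continuity almost surely.  The left limits are taken in
   T, so that they may equal del when del is not isolated. *)
Record strong_markov (T : topologicalType) (del : T)
    (G : R -> set_system Omega) (P : T -> probability Omega R)
    (X : R -> Omega -> T) : Prop := StrongMarkov {
  sm_filtration : filtration G ;
  sm_adapted : forall t : R, 0 <= t -> forall B, borel T B -> G t (X t @^-1` B) ;
  sm_kernel : forall t : R, 0 <= t -> forall B, borel T B ->
    borel_fun (fun x => P x (X t @^-1` B)) ;
  sm_start : forall x, {ae P x, forall w, X 0 w = x} ;
  sm_trap : forall w (s t : R), 0 <= s -> s <= t -> X s w = del -> X t w = del ;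
  sm_dead : forall w (t : R), 0 <= t -> (lifetime del X w <= t%:E)%E -> X t w = del ;
  sm_right_continuous : forall w (t : R), 0 <= t -> (t%:E < lifetime del X w)%E ->
    X s w @[s --> t^'+] --> X t w ;
  sm_left_limits : forall x, {ae P x, forall w, forall t : R, 0 < t ->
    (t%:E < lifetime del X w)%E -> exists l : T, X s w @[s --> t^'-] --> l} ;
  sm_quasi_left_continuous : forall (tau_ : nat -> Omega -> \bar R),
    (forall n, stopping_time G (tau_ n)) ->
    (forall n w, tau_ n w <= tau_ n.+1 w)%E ->
    let tau w := ereal_sup [set tau_ n w | n in [set: nat]] in
    forall x, {ae P x, forall w, (tau w < lifetime del X w)%E ->
      X (fine (tau_ n w)) w @[n --> \oo] --> X (fine (tau w)) w} ;
  sm_markov : forall tau, stopping_time G tau ->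
    forall (f : T -> R), borel_fun f -> (exists M : R, forall x, `|f x| <= M) ->
    forall s : R, 0 <= s -> forall x,
    is_condexp (P x) (stopped_algebra G tau)
      (fun w => if tau w is t%:E then (f (X (t + s) w))%:E else 0%E)
      (fun w => if tau w is t%:E then 'E_(P (X t w))[fun v => f (X s v)]%E
                else 0%E)
}.

End strong_markov.

(* Law on the path space with its product sigma-algebra. *)
Definition path_events (R : realType) (T : topologicalType)
  : set_system (R -> T) :=
  <<s [set C | exists (t : R) B, [/\ 0 <= t, borel T B & C = [set p | B (p t)]] ] >>.

Definition same_law (R : realType) (T : topologicalType)
    d (Omega : measurableType d) (P Q : probability Omega R)
    (X Y : R -> Omega -> T) : Prop :=
  forall C, path_events C ->
    P [set w | C (X ^~ w)] = Q [set w | C (Y ^~ w)].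

Section self_similar.
Context {R : realType} {E : completeNormedModType R}.
Context {d : measure_display} {Omega : measurableType d}.

Record ssMp (alpha : R) (G : R -> set_system Omega)
    (P : E -> probability Omega R) (Z : R -> Omega -> E) : Prop := SsMp {
  ssMp_strong_markov : strong_markov 0 G P Z ;
  ssMp_scaling : forall c : R, 0 < c -> forall x,
    same_law (P x) (P (c *: x))
      (fun t w => c *: Z (c `^ (- alpha) * t) w) Z
}.

End self_similar.

Section markov_additive.
Context {R : realType} {S : topologicalType}.
Context {d : measure_display} {Omega : measurableType d}.

(* The cemetery point of R * S stands for (-oo, cemetery of S). *)
Definition ordinate (y : cemetery (R * S)) : \bar R :=
  if y is Some (x, _) then x%:E else -oo%E.

Definition modulator (y : cemetery (R * S)) : cemetery S := omap snd y.

Definition state (x : R) (th : cemetery S) : cemetery (R * S) :=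
  omap (pair x) th.

(* (xi_{t+s} - xi_t, Xi_{t+s}) from the states at times t and t + s. *)
Definition increment (y y' : cemetery (R * S)) : cemetery (R * S) :=
  match y, y' with
  | Some (x, _), Some (x', th') => Some (x' - x, th')
  | _, _ => None
  end.

(* Y is the pair (xi, Xi). The modulator Xi is a strong Markov process on S
   under (P_{(x, th)}, th in S), whatever the starting ordinate x. *)
Record MAP (G : R -> set_system Omega)
    (P : cemetery (R * S) -> probability Omega R)
    (Y : R -> Omega -> cemetery (R * S)) : Prop := Map {
  MAP_strong_markov : strong_markov grave G P Y ;
  MAP_modulator : forall x,
    strong_markov grave G (fun th => P (state x th))
      (fun t w => modulator (Y t w)) ;
  MAP_additive :
    let Xi t w := modulator (Y t w) in
    let zeta := lifetime grave Xi in
    forall f : R * S -> R, borel_fun f ->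
    (forall u, 0 <= f u) -> (exists M : R, forall u, f u <= M) ->
    forall t s : R, 0 <= t -> 0 <= s -> forall y th,
    is_condexp (P (Some (y, th))) (G t)
      (fun w => if ((t + s)%:E < zeta w)%E
                then (ext0 f (increment (Y t w) (Y (t + s) w)))%:E else 0%E)
      (fun w => if Xi t w is Some th'
                then 'E_(P (Some (0%R, th')))[fun v =>
                       if (s%:E < zeta v)%E then ext0 f (Y s v) else 0%R]%E
                else 0%E)
}.

End markov_additive.

Section polar.
Context {R : realType} {E : completeNormedModType R}.

Definition unit_sphere : set E := [set z | `|z| = 1].

(* (log of the norm, argument); at 0 the normalized vector is 0, which is not on
   the sphere, and [polar 0 = None]. *)
Definition polar (z : E) : cemetery (R * unit_sphere) :=
  omap (pair (ln `|z|)) (insub (`|z|^-1 *: z)).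

Definition of_polar (y : cemetery (R * unit_sphere)) : E :=
  if y is Some (x, th) then expR x *: set_val th else 0.

(* |z|^(-alpha), infinite at 0 *)
Definition norm_powN (alpha : R) (z : E) : \bar R :=
  if z == 0 then +oo%E else (`|z| `^ (- alpha))%:E.

End polar.
Arguments unit_sphere {R} E.

Section time_change.
Context {R : realType}.

Definition clock (g : R -> \bar R) (s : \bar R) : \bar R :=
  (\int[lebesgue_measure]_(r in [set r : R | (0 <= r)%R /\ (r%:E < s)%E]) g r)%E.

Definition clock_inverse (g : R -> \bar R) (t : R) : \bar R :=
  ereal_inf [set s%:E | s in [set s : R | 0 < s /\ (t%:E < clock g s%:E)%E]].

End time_change.

Section lamperti_kiu.
Context {R : realType} {E : completeNormedModType R}.
Context {d : measure_display} {Omega : measurableType d}.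

Section from_MAP.
Variables (alpha : R) (Y : R -> Omega -> cemetery (R * unit_sphere E)).

Definition MAP_lifetime (w : Omega) : \bar R :=
  lifetime grave (fun t w => modulator (Y t w)) w.

Definition exp_clock (w : Omega) (r : R) : \bar R :=
  expeR (alpha%:E * ordinate (Y r w))%E.

Definition ssMp_of_MAP (t : R) (w : Omega) : E :=
  let phi := clock_inverse (exp_clock w) t in
  of_polar (if (phi < MAP_lifetime w)%E then Y (fine phi) w else grave).

Definition ssMp_of_MAP_lifetime (w : Omega) : \bar R :=
  clock (exp_clock w) (MAP_lifetime w).

End from_MAP.

Section from_ssMp.
Variables (alpha : R) (Z : R -> Omega -> E).

Definition norm_clock (w : Omega) (r : R) : \bar R := norm_powN alpha (Z r w).

Definition MAP_of_ssMp_lifetime (w : Omega) : \bar R :=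
  clock (norm_clock w) (lifetime 0 Z w).

(* For t below the lifetime, I_t < K, so that Z does not vanish at I_t. *)
Definition MAP_of_ssMp (t : R) (w : Omega) : cemetery (R * unit_sphere E) :=
  if (t%:E < MAP_of_ssMp_lifetime w)%E
  then polar (Z (fine (clock_inverse (norm_clock w) t)) w) else grave.

End from_ssMp.
End lamperti_kiu.

(* Main.v *)
(* Let [A_s = \int_0^s g(X_r) dr] for a strong Markov process [X] and a rate [g]
   that is continuous and positive off the cemetery.  The inverse [phi] of [A]
   consists of stopping times, the filtration [G_phi(t)] is right-continuous, and
   its stopping times [tau] are those for which [phi(tau)] is a [G]-stopping time
   with the same stopped sigma-algebra.  Since [A] is additive, the path of
   [X \o phi] after [tau] is the time change of the path of [X] after
   [phi(tau)], and the strong Markov property of [X] on path space passes to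
   [X \o phi].  Both parts combine such a time change, with rates
   [e^(alpha xi)] and [|z|^(-alpha)], and the polar homeomorphism.

   Self-similarity and additivity are the same symmetry: translating [xi] by [a]
   corresponds to [z |-> e^a z], and multiplies the clock by [e^(alpha a)].  A
   symmetry of the one-dimensional laws is one of the law of the path, by the
   Markov property.

   In the second part 0 is not isolated, and quasi-left-continuity at the hitting
   times of small balls shows that [Z] has no left limit 0 before its lifetime, so
   that left limits survive in polar coordinates.  The law of the modulator does
   not depend on the starting ordinate, by the symmetry, hence it is Markov. *)
From HB Require Import structures.
Require Import Defs.
From mathcomp Require Import all_boot all_order all_algebra.
From mathcomp Require Import all_classical all_reals all_analysis.
From mathcomp Require Import measurable_realfun giry ring lra.

Set Implicit Arguments.
Unset Strict Implicit.
Unset Printing Implicit Defensive.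

Import Order.TTheory GRing.Theory Num.Theory.
Import numFieldNormedType.Exports.

Local Open Scope classical_set_scope.
Local Open Scope ring_scope.

(** Three obstacles shape the argument. The strong Markov property is given at one future time,
    whereas [X \o phi] at a single time reads the path of [X] up to [phi]; hence the extension to
    path events, and the use of self-similarity as an identity of path laws. A time-changed path
    depends measurably on the path only among absorbed paths, so events are represented up to
    agreement there. Finally, states lie in a general topological space, and measurability at a
    random time is reduced to real functions by writing every open set as the set where a continuous
    function is positive.

    Everything about [phi] is pathwise and rests on two facts: [phi(t) < v] iff [t < A_v], which
    yields measurability and stopping times, and [phi(t) = s] iff the path is alive at [s] and
    [A_s = t], which yields the identities between paths.

    Additivity translates the future by the random amount [- xi_t], while the symmetry concerns a
    fixed amount; it is applied after a disintegration of the pair [(xi_t, Y_(t+s))]. *)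

(** * Joint measurability *)

(* Equips [T] with an arbitrary sigma-algebra, such as one member of a
   filtration, so that library lemmas on measurable functions apply to it. *)
Definition salg (T : Type) (x0 : T) (F : set_system T)
  (HF : sigma_algebra setT F) : Type := T.

Section salg_instance.
Context (T : Type) (x0 : T) (F : set_system T) (HF : sigma_algebra setT F).

HB.instance Definition _ := gen_eqMixin (salg x0 HF).
HB.instance Definition _ := gen_choiceMixin (salg x0 HF).
HB.instance Definition _ := isPointed.Build (salg x0 HF) x0.

Let salg0 : F set0. Proof. by case: HF. Qed.
Let salgC A : F A -> F (~` A).
Proof. by case: HF => _ + _ => /[apply]; rewrite setTD. Qed.
Let salgU (A : (set T)^nat) : (forall n, F (A n)) -> F (\bigcup_k A k).
Proof. by case: HF => _ _; exact. Qed.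

Fact salg_display : measure_display. Proof. exact: default_measure_display. Qed.

HB.instance Definition _ :=
  @isMeasurable.Build salg_display (salg x0 HF) F salg0 salgC salgU.

End salg_instance.

Section joint_measurability.
Context {R : realType} {d : measure_display} {W : measurableType d}.

(* Right-continuity makes [q] the limit of its values at the right endpoints of
   the cells of the grid of mesh 1/(n+1). *)
Lemma measurable_right_continuous (q : R -> W -> R) :
  (forall r, measurable_fun setT (q r)) ->
  (forall r w, q x w @[x --> r^'+] --> q r w) ->
  measurable_fun setT (fun p : measurableTypeR R * W => q p.1 p.2).
Proof.
move=> mq rcq.
(* Adding 1 to the floor makes [g n x] strictly larger than [x], as a limit along [x^'+]
   requires. *)
pose g (n : nat) (x : R) : R := (Num.floor (x * n.+1%:R) + 1)%:~R / n.+1%:R.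
apply: (@measurable_fun_cvg _ _ _ setT
  (fun n (p : measurableTypeR R * W) => q (g n p.1) p.2)) => [n|[x w] _]/=.
  move=> _ B mB; rewrite setTI.
  rewrite (_ : _ @^-1` B = \bigcup_(z : int)
    ((fst @^-1` [set x : measurableTypeR R | z%:~R / n.+1%:R <= x < (z + 1)%:~R / n.+1%:R])
     `&` (snd @^-1` (q ((z + 1)%:~R / n.+1%:R) @^-1` B)))); last first.
    apply/seteqP; split => [[x w]/= Bq|[x w] [z _ []]]/=.
      exists (Num.floor (x * n.+1%:R)) => //; split => //=.
      by rewrite ler_pdivrMr// ltr_pdivlMr// floor_itv.
    rewrite ler_pdivrMr// ltr_pdivlMr// => /floor_def h.
    by rewrite /g h.
  apply: countable_bigcupT_measurable => // z; apply: measurableI.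
  - rewrite -[X in measurable X]setTI; apply: measurable_fst => //.
    rewrite (_ : [set x | _] = `[z%:~R / n.+1%:R, (z + 1)%:~R / n.+1%:R[%classic).
      exact: measurable_itv.
    by apply/seteqP; split => y /=; rewrite in_itv.
  - rewrite -[X in measurable X]setTI; apply: measurable_snd => //.
    by rewrite -[X in measurable X]setTI; exact: mq.
move/cvg_at_rightP : (rcq x w); apply; split => [n|].
  by rewrite /g ltr_pdivlMr// floorD1_gt.
apply: (@squeeze_cvgr _ _ _ _ (fun=> x) (fun n => x + n.+1%:R^-1)).
- near=> n; apply/andP; split.
    by rewrite /g ler_pdivlMr// ltW// floorD1_gt.
  rewrite /g intrD mulrDl div1r lerD2r ler_pdivrMr//.
  exact: floor_le.
- exact: cvg_cst.
- rewrite -[X in _ --> X]addr0; apply: cvgD; first exact: cvg_cst.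
  exact: cvg_harmonic.
Unshelve. all: by end_near. Qed.

(** Tonelli, for the jointly measurable integrand multiplied by the indicator of [D]. *)
Lemma measurable_integral_right_continuous (q : R -> W -> R) (D : set R) :
  measurable (D : set (measurableTypeR R)) ->
  (forall r w, 0 <= q r w) ->
  (forall r, measurable_fun setT (q r)) ->
  (forall r w, q x w @[x --> r^'+] --> q r w) ->
  measurable_fun setT (fun w => \int[lebesgue_measure]_(r in D) (q r w)%:E)%E.
Proof.
move=> mD q0 mq rcq.
pose f (p : measurableTypeR R * W) := ((q p.1 p.2) * \1_D p.1)%:E.
have mf : measurable_fun setT f.
  apply/measurable_EFinP/measurable_funM.
    exact: measurable_right_continuous.
  apply: (@measurableT_comp _ _ _ _ _ _ (\1_D : measurableTypeR R -> R)) => //.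
have f0 p : (0 <= f p)%E by rewrite lee_fin mulr_ge0.
have := measurable_fun_fubini_tonelli_G (m1 := @lebesgue_measure R) f mf f0.
apply: eq_measurable_fun => w _; rewrite /fubini_G [RHS]integral_mkcond.
apply: eq_integral => r _; rewrite /f /= patchE indicE.
by case: ifPn => rD; rewrite ?(mulr1,mulr0).
Qed.

End joint_measurability.

(** Lebesgue measure equals [a] times its image under [r |-> a r + b], since both agree on half-open
    intervals; the rest is integration against an image measure. *)
Lemma lebesgue_affine (R : realType) (a b : R) (D : set R) (f : R -> \bar R) :
  0 < a -> measurable (D : set (measurableTypeR R)) ->
  measurable_fun (setT : set (measurableTypeR R)) f -> (forall x, 0 <= f x)%E ->
  (\int[lebesgue_measure]_(x in D) f x =
   a%:E * \int[lebesgue_measure]_(r in [set r | D (a * r + b)%R]) f (a * r + b)%R)%E.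
Proof.
move=> a0 mD mf f0.
pose phi (r : measurableTypeR R) : measurableTypeR R := a * r + b.
have mphi : measurable_fun setT phi.
  by apply: measurable_funD => //; apply: measurable_funM.
have a0' := ltW a0.
pose m := mscale (NngNum a0')
  (measure_function_pushforward__canonical__measure_function_Measure
    (@lebesgue_measure R) mphi).
have E A : measurable A -> lebesgue_measure A = m A.
  move=> mA; apply: lebesgue_measure_unique => //= _ [[x y]] _ <-.
  rewrite /m /mscale /= /pushforward.
  rewrite (_ : phi @^-1` _ = `](x - b) / a, (y - b) / a]%classic); last first.
    apply/seteqP; split => r /=; rewrite !in_itv/= /phi ltr_pdivrMr// ler_pdivlMr//;
     by rewrite ltrBlDr lerBrDr (mulrC r).
  rewrite !lebesgue_measure_itv/= !lte_fin ltr_pM2r ?invr_gt0// ltrD2r.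
  case: ifPn => _; last by rewrite mule0.
  rewrite -!EFinD -EFinM; congr EFin.
  by rewrite -mulrBl mulrCA divff ?gt_eqF// mulr1; ring.
transitivity (\int[m]_(x in D) f x)%E.
  by apply: eq_measure_integral => A mA _; exact: E.
rewrite ge0_integral_mscale//=; last exact: measurable_funS mf.
congr (_ * _)%E.
by rewrite ge0_integral_pushforward//=; exact: measurable_funS mf.
Qed.

(** * Clocks of absorbed paths *)

(** The last clause says that the death time is attained. Right-continuity would yield it for a
    closed point [del], but [T] carries no separation axiom here. *)
Definition absorbed_path (R : realType) (T : topologicalType) (del : T)
    (p : R -> T) : Prop :=
  [/\ forall s t : R, 0 <= s -> s <= t -> p s = del -> p t = del,
      forall t : R, 0 <= t -> p x @[x --> t^'+] --> p t &
      forall t : R, 0 <= t -> (forall s : R, t < s -> p s = del) -> p t = del].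

(** Continuity is asked only off [del] because [|z|^(-alpha)] explodes at 0. The value 0 at [del]
    stops the clock at death, so that its inverse is infinite from the total clock on. *)
Definition rate_function (R : realType) (T : topologicalType) (del : T)
    (g : T -> R) : Prop :=
  [/\ g del = 0, forall x, x <> del -> 0 < g x,
      forall x, x <> del -> {for x, continuous g} & borel_fun g].

Section path_clock.
Context {R : realType} {T : topologicalType} {del : T} {g : T -> R}.
Hypothesis rate_g : rate_function del g.

Let g_del : g del = 0. Proof. by case: rate_g. Qed.
Let g_gt0 x : x <> del -> 0 < g x. Proof. by case: rate_g => _ + _ _; exact. Qed.
Let g_ge0 x : 0 <= g x.
Proof. by have [->|/eqP/g_gt0/ltW//] := eqVneq x del; rewrite g_del. Qed.
Let g_cont x : x <> del -> {for x, continuous g}.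
Proof. by case: rate_g => _ _ + _; exact. Qed.

Definition path_clock (p : R -> T) (s : \bar R) : \bar R :=
  clock (fun r => (g (p r))%:E) s.

Definition path_inverse (p : R -> T) (t : R) : \bar R :=
  clock_inverse (fun r => (g (p r))%:E) t.

Lemma absorbed_shift (p : R -> T) (s : R) : 0 <= s -> absorbed_path del p ->
  absorbed_path del (fun r => p (s + r)).
Proof.
move=> s0 [trap rc dead]; split => [u v u0 uv|t t0|t t0 h].
- by apply: trap; [exact: addr_ge0|rewrite lerD2l].
- have st0 : 0 <= s + t by exact: addr_ge0.
  move=> U /(rc _ st0); rewrite /= !nbhs_simpl/= => -[e e0 h].
  exists e => //= x /= xt tx; apply: h => /=; last by rewrite ltrD2l.
  by rewrite opprD addrACA subrr add0r.
- apply: dead; first exact: addr_ge0.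
  move=> u su; rewrite -[u](addrNK s) addrC; apply: h.
  by rewrite ltrBrDr addrC.
Qed.

Lemma rate_right_continuous (p : R -> T) (t : R) : absorbed_path del p ->
  0 <= t -> g (p x) @[x --> t^'+] --> g (p t).
Proof.
move=> [trap rc _] t0; have [ptd|/eqP ptd] := eqVneq (p t) del.
  apply: cvg_near_cst; near=> x.
  by rewrite ptd (trap t x)//; near: x; exact: nbhs_right_ge.
apply: (@cvg_comp _ _ _ p g) (g_cont ptd); exact: rc.
Unshelve. all: by end_near. Qed.

(** Freezing the path at its value at 0 for negative times gives right-continuity on the whole line,
    as [measurable_right_continuous] demands. *)
Lemma rate_right_continuous0 (p : R -> T) (t : R) : absorbed_path del p ->
  g (p (Num.max 0 x)) @[x --> t^'+] --> g (p (Num.max 0 t)).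
Proof.
move=> ap; have [t0|t0] := leP 0 t.
  have := rate_right_continuous ap t0; apply: cvg_trans.
  apply: near_eq_cvg; near=> x.
  by rewrite max_r// (le_trans t0)// ltW.
apply: cvg_near_cst; near=> x.
rewrite max_l//; apply: ltW; near: x; exact: nbhs_right_lt.
Unshelve. all: by end_near. Qed.

Lemma measurable_rate (p : R -> T) : absorbed_path del p ->
  measurable_fun (setT : set (measurableTypeR R)) (fun r => g (p (Num.max 0 r))).
Proof.
move=> ap.
(* A single path is a process on the one-point space. *)
have /= := @measurable_right_continuous R _ unit (fun r _ => g (p (Num.max 0 r)))
  (fun r => measurable_cst _) (fun r _ => rate_right_continuous0 (t := r) ap).
move=> mf; have mtt : measurable_fun setT (fun r : measurableTypeR R => (r, tt)).
  exact: measurable_fun_pair.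
exact: (measurableT_comp mf mtt).
Qed.

Local Notation before s := [set r : R | 0 <= r /\ (r%:E < s)%E].

Lemma measurable_before (s : \bar R) :
  measurable (before s : set (measurableTypeR R)).
Proof.
case: s => [s| |].
- rewrite (_ : before _ = `[0, s[%classic); first exact: measurable_itv.
  by apply/seteqP; split => x /=; rewrite in_itv/= lte_fin => /andP.
- rewrite (_ : before _ = `[0, +oo[%classic); first exact: measurable_itv.
  by apply/seteqP; split => x /=; rewrite in_itv/= andbT ?ltry// => -[].
- by rewrite (_ : before _ = set0)// -subset0 => x [].
Qed.

Lemma path_clockE (p : R -> T) (s : \bar R) : path_clock p s =
  (\int[lebesgue_measure]_(r in before s) (g (p (Num.max 0 r)))%:E)%E.
Proof. by apply: eq_integral => r; rewrite inE => -[r0 _]; rewrite max_r. Qed.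

Let measurable_rateE (p : R -> T) (D : set (measurableTypeR R)) :
  absorbed_path del p -> measurable_fun D (fun r => (g (p (Num.max 0 r)))%:E).
Proof.
by move=> ap; apply/measurable_EFinP; apply: measurable_funTS; exact: measurable_rate.
Qed.

Lemma path_clock_ge0 (p : R -> T) (s : \bar R) : (0 <= path_clock p s)%E.
Proof. by apply: integral_ge0 => r _; rewrite lee_fin. Qed.

Lemma path_clock_le0 (p : R -> T) (s : \bar R) : (s <= 0)%E -> path_clock p s = 0%E.
Proof.
move=> s0; rewrite /path_clock /clock (_ : before s = set0) ?integral_set0//.
rewrite -subset0 => x [x0] /lt_le_trans/(_ s0).
by rewrite lte_fin ltNge x0.
Qed.

Lemma le_path_clock (p : R -> T) (s s' : \bar R) : absorbed_path del p ->
  (s <= s')%E -> (path_clock p s <= path_clock p s')%E.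
Proof.
move=> ap ss'; rewrite !path_clockE; apply: ge0_subset_integral.
- exact: measurable_before.
- exact: measurable_before.
- by apply: measurable_rateE; exact: ap.
- by move=> r _; rewrite lee_fin.
- by move=> r [r0 rs]; split => //; exact: lt_le_trans ss'.
Qed.

(** Left-continuity of the clock, by monotone convergence along times [u n] that increase to [s]
    from strictly below; [s = +oo] is included. *)
Lemma path_clock_left (p : R -> T) (s : \bar R) (t : R) : absorbed_path del p ->
  0 <= t -> (t%:E < path_clock p s)%E ->
  exists v : R, (v%:E < s)%E /\ (t%:E < path_clock p v%:E)%E.
Proof.
move=> ap t0 ts.
have [u [us ndu covu]] : exists u : R^nat,
    [/\ forall n, ((u n)%:E < s)%E, {homo u : m n / (m <= n)%N >-> m <= n} &
        forall r : R, (r%:E < s)%E -> exists n, r < u n].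
  case: s ts => [s| |] ts.
  - exists (fun n => s - n.+1%:R^-1); split => [n|m n mn|r].
    + by rewrite lte_fin ltrBlDr ltrDl invr_gt0.
    + by rewrite lerB// lef_pV2 ?posrE// ler_nat.
    + rewrite lte_fin -subr_gt0 => rs; have [n hn] := ltr_add_invr rs.
      by exists n; rewrite ltrBrDr addrC -ltrBrDr -[ltLHS]add0r.
  - exists (fun n => n%:R); split => [n|m n mn|r _]; rewrite ?ltry ?ler_nat//.
    by exists (Num.bound `|r|); exact: le_lt_trans (ler_norm _) (archi_boundP (normr_ge0 r)).
  - by move: ts; rewrite path_clock_le0// lte_fin ltNge t0.
pose F n := before (u n)%:E.
have FE : \bigcup_n F n = before s.
  apply/seteqP; split => [r [n _ [r0 rn]]|r [r0 /covu[n rn]]].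
    by split => //; exact: lt_trans (us n).
  by exists n.
have ndF : nondecreasing_seq F.
  move=> m n mn; apply/subsetPset => r [r0 rm]; split => //.
  by apply: lt_le_trans rm _; rewrite lee_fin ndu.
have := @ge0_nondecreasing_set_cvg_integral _ (measurableTypeR R) R F
  (fun r => (g (p (Num.max 0 r)))%:E) lebesgue_measure ndF.
rewrite FE -path_clockE => /(_ (fun n => measurable_before _)
  (fun n => measurable_rateE ap) (fun n r _ => ltac:(by rewrite lee_fin)))/= h.
apply: contrapT => /forallNP nv; move: ts; apply/negP; rewrite -leNgt.
apply: (cvge_to_le h); apply: nearW => n.
rewrite leNgt; apply/negP => tn; apply: (nv (u n)); split; first exact: us.
by rewrite path_clockE.
Qed.

Lemma path_clockD (p : R -> T) (s u : R) : absorbed_path del p ->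
  0 <= s -> 0 <= u ->
  path_clock p (s + u)%:E =
  (path_clock p s%:E + path_clock (fun r => p (s + r)%R) u%:E)%E.
Proof.
move=> ap s0 u0.
rewrite [in LHS]path_clockE (_ : before _ = before s%:E `|` `[s, s + u[%classic); last first.
  apply/seteqP; split => r /=; rewrite in_itv/= !lte_fin.
    by move=> [r0 ->]; case: (ltP r s) => rs; [left|right].
  move=> [[r0 rs]|/andP[sr ->]]; last by rewrite (le_trans s0).
  by split => //; rewrite (lt_le_trans rs)// lerDl.
rewrite ge0_integral_setU//=; first last.
- apply/disj_setPS => r [[_ +]]; rewrite /= in_itv/= lte_fin => rs /andP[].
  by rewrite leNgt rs.
- by move=> r _; rewrite lee_fin.
- by apply: measurable_rateE; exact: ap.
- exact: measurable_before.
congr (_ + _)%E; first by rewrite -path_clockE.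
rewrite (@lebesgue_affine _ 1 s)//=; first last.
- by move=> r; rewrite lee_fin.
- by apply/measurable_EFinP; exact: measurable_rate.
rewrite mul1e (_ : mkset _ = before u%:E); last first.
  apply/seteqP; split => r /=; rewrite in_itv/= lte_fin mul1r addrC.
    by rewrite lerDl ltrD2l => /andP.
  by rewrite lerDl ltrD2l => -[-> ->].
apply: eq_integral => r; rewrite inE/= => -[r0 _].
by rewrite mul1r max_r 1?addrC// addr_ge0.
Qed.

Lemma path_clock_del (p : R -> T) (s : \bar R) : absorbed_path del p ->
  p 0 = del -> path_clock p s = 0%E.
Proof.
move=> [trap _ _] p0; apply: integral0_eq => r [r0 _].
by rewrite (trap 0 r)// g_del.
Qed.

(** On a short interval, right-continuity keeps the rate within half of its positive initial value.
    The lower bound makes the clock grow strictly at a live time; the upper bound makes it finite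
    and right-continuous there. *)
Lemma path_clock_near0 (p : R -> T) : absorbed_path del p -> p 0 <> del ->
  exists e c C : R, [/\ 0 < e, 0 < c, 0 < C & forall u : R, 0 <= u -> u <= e ->
    ((c * u)%:E <= path_clock p u%:E <= (C * u)%:E)%E].
Proof.
move=> ap p0; have gp0 := g_gt0 p0.
have /cvgrPdist_lt/(_ (g (p 0) / 2))/(_ (divr_gt0 gp0 (ltr0n _ 2))) :=
  rate_right_continuous ap (lexx 0).
move=> -[e /= e0 he].
exists e, (g (p 0) / 2), (g (p 0) + g (p 0) / 2); split => //.
- exact: divr_gt0.
- by rewrite addr_gt0// divr_gt0.
have bnd r : 0 <= r -> r < e ->
    g (p 0) / 2 <= g (p r) <= g (p 0) + g (p 0) / 2.
  rewrite le_eqVlt => /predU1P[<- _|r0 re].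
    by apply/andP; split; lra.
  have rb : `|0 - r| < e by rewrite sub0r normrN gtr0_norm.
  have := he r rb r0.
  rewrite ltr_norml => /andP[]; set a := g (p 0); set b := g (p r); lra.
move=> u u0 ue.
have lenu : lebesgue_measure (before u%:E) = u%:E.
  rewrite (_ : before _ = `[0, u[%classic).
    rewrite lebesgue_measure_itv/= lte_fin.
    by move: u0; rewrite le_eqVlt => /predU1P[<-|->]; rewrite ?ltxx// oppr0 addr0.
  by apply/seteqP; split => x /=; rewrite in_itv/= lte_fin => /andP.
rewrite path_clockE; apply/andP; split.
- rewrite EFinM -[X in (_ * X)%E]lenu -integral_cst//; last exact: measurable_before.
  apply: ge0_le_integral => //.
  + exact: measurable_before.
  + by move=> r _; rewrite lee_fin divr_ge0// ltW.
  + by apply: measurable_rateE; exact: ap.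
  + move=> r [r0]; rewrite lte_fin lee_fin max_r// => ru.
    by have /andP[] := bnd _ r0 (lt_le_trans ru ue).
- rewrite EFinM -[X in (_ <= _ * X)%E]lenu -integral_cst//; last exact: measurable_before.
  apply: ge0_le_integral => //.
  + exact: measurable_before.
  + by move=> r _; rewrite lee_fin.
  + by apply: measurable_rateE; exact: ap.
  + move=> r [r0]; rewrite lte_fin lee_fin max_r// => ru.
    by have /andP[] := bnd _ r0 (lt_le_trans ru ue).
Qed.

Lemma path_clock_gt0 (p : R -> T) (u : R) : absorbed_path del p ->
  p 0 <> del -> 0 < u -> (0 < path_clock p u%:E)%E.
Proof.
move=> ap p0 u0; have [e [c [C [e0 c0 C0 h]]]] := path_clock_near0 ap p0.
have v0 : 0 < Num.min u e by rewrite lt_min u0.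
apply: (@lt_le_trans _ _ (path_clock p (Num.min u e)%:E)); last first.
  by apply: le_path_clock => //; rewrite lee_fin ge_min lexx.
have /andP[] := h _ (ltW v0) ltac:(by rewrite ge_min lexx orbT).
by move=> + _; apply: lt_le_trans; rewrite lte_fin mulr_gt0.
Qed.

(** Left-continuity turns [t < A_v] into a time strictly before [v] at which the clock already
    exceeds [t]. Measurability and stopping-time properties of the inverse are read off this
    equivalence. *)
Lemma path_inverse_ltP (p : R -> T) (t : R) (v : \bar R) : absorbed_path del p ->
  0 <= t -> (path_inverse p t < v)%E = (t%:E < path_clock p v)%E.
Proof.
move=> ap t0; apply/idP/idP => [/ereal_inf_lt[_ [s /= [s0 ts] <-] sv]|].
  by apply: lt_le_trans ts _; exact/le_path_clock/ltW.
move=> /(path_clock_left ap t0)[s [sv ts]]; apply: le_lt_trans sv.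
apply: ereal_inf_lbound; exists s => //=; split => //.
rewrite ltNge; apply/negP => s0; move: ts.
by rewrite path_clock_le0 ?lee_fin// lte_fin ltNge t0.
Qed.

Lemma path_inverse_ge0 (p : R -> T) (t : R) : (0 <= path_inverse p t)%E.
Proof. by apply: le_ereal_inf_tmp => _ [s /= [/ltW s0 _] <-]; rewrite lee_fin. Qed.

Lemma path_clock_small (p : R -> T) (s e : R) : absorbed_path del p ->
  0 <= s -> p s <> del -> 0 < e ->
  exists v : R, s < v /\ (path_clock p v%:E <= path_clock p s%:E + e%:E)%E.
Proof.
move=> ap s0 ps e0; have aps := absorbed_shift s0 ap.
have [|d [c [C [d0 c0 C0 h]]]] := path_clock_near0 aps; first by rewrite addr0.
have w0 : 0 < Num.min d (e / C) by rewrite lt_min d0 divr_gt0.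
exists (s + Num.min d (e / C)); split; first by rewrite ltrDl.
rewrite path_clockD ?(ltW w0)// leeD2l//.
have /andP[_] := h _ (ltW w0) ltac:(by rewrite ge_min lexx).
move=> /le_trans; apply; rewrite lee_fin.
by rewrite mulrC -ler_pdivlMr// ge_min lexx orbT.
Qed.

(** The inverse is never a finite dead time, because the clock is flat after death and could not
    exceed [t] just later. At a live time the clock is right-continuous, which gives the value [t]
    exactly, and it increases strictly at once, which gives the converse. *)
Lemma path_inverseP (p : R -> T) (t s : R) : absorbed_path del p -> 0 <= t ->
  path_inverse p t = s%:E <->
  [/\ 0 <= s, p s <> del & path_clock p s%:E = t%:E].
Proof.
move=> ap t0; split=> [ts|[s0 ps As]].
  have s0 : 0 <= s by rewrite -lee_fin -ts path_inverse_ge0.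
  have Ale : (path_clock p s%:E <= t%:E)%E.
    by rewrite leNgt -path_inverse_ltP// ts ltxx.
  have Agt v : s < v -> (t%:E < path_clock p v%:E)%E.
    by rewrite -path_inverse_ltP// ts lte_fin.
  have ps : p s <> del.
    move=> ps; have := Agt _ (ltr_pwDr ltr01 (lexx s)).
    rewrite path_clockD// [X in (_ + X)%E]path_clock_del ?adde0.
    - by rewrite ltNge Ale.
    - exact: absorbed_shift.
    - by rewrite addr0.
  split => //; apply/le_anti/andP; split => //.
  apply/lee_addgt0Pr => e e0; have [v [sv]] := path_clock_small ap s0 ps e0.
  by apply: le_trans; apply/ltW/Agt.
apply/le_anti/andP; split; last first.
  rewrite leNgt path_inverse_ltP//; first by rewrite As ltxx.
apply/lee_addgt0Pr => e e0; apply/ltW; rewrite -EFinD path_inverse_ltP//.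
rewrite path_clockD ?(ltW e0)// As lteDl//; apply: path_clock_gt0 => //.
  exact: absorbed_shift.
by rewrite addr0.
Qed.

Definition path_time_change (p : R -> T) (t : R) : T :=
  if path_inverse p t is s%:E then p s else del.

End path_clock.

Arguments path_clock {R T} g p s.
Arguments path_inverse {R T} g p t.
Arguments path_time_change {R T} del g p t.

Definition path_lifetime (R : realType) (T : Type) (del : T) (p : R -> T) : \bar R :=
  lifetime del (fun t (_ : unit) => p t) tt.

Lemma ge0_eq_ltP (R : realType) (a b : \bar R) : (0 <= a)%E -> (0 <= b)%E ->
  (forall t : R, 0 <= t -> (t%:E < a)%E = (t%:E < b)%E) -> a = b.
Proof.
wlog ab : a b / (a <= b)%E.
  move=> h a0 b0 ab; have [|/ltW] := leP a b; first by move/h; exact.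
  by move/h => ->// t t0; rewrite ab.
move=> a0 b0 h; apply/le_anti; rewrite ab/= leNgt; apply/negP.
case: a a0 h {ab} => [r| |]//= r0 h; last by rewrite ltNge leey.
by rewrite -h ?ltxx// -lee_fin.
Qed.

Lemma near_at_right_lte (R : realType) (t : R) (a : \bar R) : (t%:E < a)%E ->
  \forall x \near t^'+, (x%:E < a)%E.
Proof.
case: a => [a| |]//; last by move=> _; apply: nearW => x; rewrite ltry.
by rewrite lte_fin => ta; near=> x; rewrite lte_fin; near: x; exact: nbhs_right_lt.
Unshelve. all: by end_near. Qed.

Section lifetime.
Context {R : realType} {T : topologicalType} {del : T}.
Implicit Type p : R -> T.

Lemma path_lifetime_ge0 p : (0 <= path_lifetime del p)%E.
Proof.
by apply: le_ereal_inf_tmp => _ [s /= [/ltW s0 _] <-]; rewrite lee_fin.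
Qed.

(** By the last clause of [absorbed_path], a path alive at [t] is still alive at some [s > t]; by
    the trap clause all dead times come after [s]. *)
Lemma path_lifetime_gtP p (t : R) : absorbed_path del p -> 0 <= t ->
  (t%:E < path_lifetime del p)%E <-> p t <> del.
Proof.
move=> [trap rc dead] t0; split=> [+ pt|pt].
  apply/negP; rewrite -leNgt; apply/lee_addgt0Pr => e e0.
  apply: ereal_inf_lbound; exists (t + e) => //; split.
    by rewrite ltr_wpDl.
  by apply: (trap t) => //; rewrite lerDl ltW.
have [s /not_implyP[ts ps]] : exists s, ~ (t < s -> p s = del).
  by apply/existsNP => h; apply: pt; exact: dead.
apply: (@lt_le_trans _ _ s%:E); first by rewrite lte_fin.
apply: le_ereal_inf_tmp => _ [v [v0 pv] <-]; rewrite lee_fin leNgt.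
by apply/negP => /ltW vs; apply: ps; apply: trap pv => //; exact: ltW.
Qed.

End lifetime.

Section path_time_change.
Context {R : realType} {T : topologicalType} {del : T} {g : T -> R}.
Hypothesis rate_g : rate_function del g.
Implicit Type p : R -> T.

Local Notation A := (path_clock g).
Local Notation I := (path_inverse g).
Local Notation tc := (path_time_change del g).

Lemma path_time_change_delP p (t : R) : absorbed_path del p -> 0 <= t ->
  tc p t = del <-> I p t = +oo%E.
Proof.
move=> ap t0; rewrite /path_time_change.
have := @path_inverse_ge0 _ _ g p t.
case E : (I p t) => [s| |]//= s0; split => // ps; exfalso.
by have [] := (path_inverseP rate_g s ap t0).1 E.
Qed.

Lemma path_time_change_fin p (t s : R) : I p t = s%:E -> tc p t = p s.
Proof. by rewrite /path_time_change => ->. Qed.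

Lemma path_inverse_fin p (t : R) : absorbed_path del p -> 0 <= t ->
  tc p t <> del -> exists s : R, I p t = s%:E.
Proof.
move=> ap t0 /(contra_not (path_time_change_delP ap t0).2).
by have := @path_inverse_ge0 _ _ g p t; case: (I p t) => // s _ _; exists s.
Qed.

Lemma le_path_inverse p (s t : R) : absorbed_path del p -> 0 <= s -> s <= t ->
  (I p s <= I p t)%E.
Proof.
move=> ap s0 st; rewrite leNgt (path_inverse_ltP rate_g)//; last exact: le_trans st.
apply/negP => /(le_lt_trans (_ : (s%:E <= t%:E)%E)); rewrite lee_fin => /(_ st).
by rewrite -(path_inverse_ltP rate_g)// ltxx.
Qed.

(** The path is alive at [s], hence at [v], so the clock grows strictly from [v] to [s]; its value
    at [v] is finite, being at most [t]. *)
Lemma path_clock_lt p (t s v : R) : absorbed_path del p -> 0 <= t ->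
  I p t = s%:E -> 0 <= v -> v < s -> (A p v%:E < t%:E)%E.
Proof.
move=> ap t0 Its v0 vs; have [s0 ps As] := (path_inverseP rate_g s ap t0).1 Its.
have sv : 0 < s - v by rewrite subr_gt0.
have := path_clockD rate_g ap v0 (ltW sv); rewrite addrC subrK As => ->.
have vf : A p v%:E \is a fin_num.
  rewrite ge0_fin_numE ?(path_clock_ge0 rate_g)//.
  apply: le_lt_trans (ltry t); rewrite -As; apply: (le_path_clock rate_g ap).
  by rewrite lee_fin ltW.
rewrite lteDl//; apply: (path_clock_gt0 rate_g) => //.
  exact: absorbed_shift.
rewrite addr0 => pv; apply: ps; case: ap => trap _ _.
by apply: trap pv => //; exact: ltW.
Qed.

Lemma absorbed_time_change p : absorbed_path del p -> absorbed_path del (tc p).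
Proof.
move=> ap; have [trap rc dead] := ap; split=> [s t s0 st|t t0|t t0 tcd].
- move/(path_time_change_delP ap s0) => Is.
  apply/path_time_change_delP => //; first exact: le_trans st.
  by apply/eqP; rewrite -leye_eq -Is; exact: le_path_inverse.
- have [/(path_time_change_delP ap t0) It|/(path_inverse_fin ap t0)[s Is]] :=
    pselect (tc p t = del).
    apply: cvg_near_cst; near=> x.
    have tx : t < x by near: x; exact: nbhs_right_gt.
    have x0 : 0 <= x by apply: le_trans (ltW tx).
    transitivity del; last by apply/esym/path_time_change_delP.
    apply/path_time_change_delP => //.
    by apply/eqP; rewrite -leye_eq -It; apply: le_path_inverse => //; exact: ltW.
  have [s0 ps As] := (path_inverseP rate_g s ap t0).1 Is.
  rewrite (path_time_change_fin Is) => U nU.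
  have /= [e /= e0 he] := rc s s0 U nU.
  (* The inverse at [t] is below [s + e], so the clock exceeds [t] by time [s + e], and therefore
     also exceeds every [x] slightly above [t]: the inverse is right-continuous at [t]. *)
  have : \forall x \near t^'+, (x%:E < A p (s + e)%:E)%E.
    apply: near_at_right_lte; rewrite -(path_inverse_ltP rate_g)// Is.
    by rewrite lte_fin ltrDl.
  apply: filterS2 (nbhs_right_ge t) => x tx.
  have x0 : 0 <= x by exact: le_trans tx.
  rewrite -(path_inverse_ltP rate_g)//= => xe.
  have := le_path_inverse ap t0 tx; rewrite Is.
  move: xe; case E : (I p x) => [v| |]//; rewrite lte_fin lee_fin => vs.
  rewrite (path_time_change_fin E) le_eqVlt => /predU1P[<-|sv].
    exact: nbhs_singleton.
  by apply: he => //=; rewrite distrC gtr0_norm ?subr_gt0// ltrBlDl.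
(* Being alive at [t] means that the total clock exceeds [t], and then it also exceeds some
   [x > t]. *)
- apply/path_time_change_delP => //; apply: contrapT => It.
  have /(path_inverse_fin ap t0)[s Is] : tc p t <> del.
    by move/(path_time_change_delP ap t0).
  have : (I p t < +oo)%E by rewrite Is ltry.
  rewrite (path_inverse_ltP rate_g)// => /near_at_right_lte h.
  near (t^'+) => x.
  have tx : t < x by near: x; exact: nbhs_right_gt.
  have x0 : 0 <= x by apply: le_trans (ltW tx).
  have : (x%:E < A p +oo)%E by near: x; exact: h.
  rewrite -(path_inverse_ltP rate_g)//.
  by rewrite (path_time_change_delP ap x0).1 ?ltxx//; exact: tcd.
Unshelve. all: by end_near. Qed.

Lemma path_time_change0 p : absorbed_path del p -> tc p 0 = p 0.
Proof.
move=> ap; have [p0|/eqP p0] := eqVneq (p 0) del.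
  rewrite p0; apply/path_time_change_delP => //.
  apply/eqP; rewrite -leye_eq leNgt (path_inverse_ltP rate_g)//.
  by rewrite (path_clock_del rate_g)// ltxx.
apply: path_time_change_fin; apply/(path_inverseP rate_g) => //; split => //.
exact: path_clock_le0.
Qed.

(** The inverse tends to [s] as its argument increases to [t], since the clock is strictly below [t]
    before [s]; and it stays strictly below [s], so that it runs through punctured left
    neighbourhoods of [s]. *)
Lemma path_time_change_left_limit p (t s : R) (l : T) : absorbed_path del p ->
  0 < t -> I p t = s%:E -> p x @[x --> s^'-] --> l ->
  0 < s /\ tc p x @[x --> t^'-] --> l.
Proof.
move=> ap t0 Is psl.
have [s0 ps As] := (path_inverseP rate_g s ap (ltW t0)).1 Is.
have {}s0 : 0 < s.
  move: s0; rewrite le_eqVlt => /predU1P[s0|//]; exfalso.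
  by move: As; rewrite -s0 path_clock_le0// => -[t0']; move: t0; rewrite -t0' ltxx.
split => // U /psl[e /= e0 he].
pose v := Num.max 0 (s - e / 2).
have v0 : 0 <= v by rewrite le_max lexx.
have vs : v < s by rewrite gt_max s0/= ltrBlDr ltrDl divr_gt0.
have := path_clock_lt ap (ltW t0) Is v0 vs.
have := path_clock_ge0 rate_g p v%:E.
case Ev : (A p v%:E) => [a| |]//; rewrite lee_fin lte_fin => a0 aet.
rewrite /= nbhs_simpl/=; near=> x.
have ax : a < x by near: x; exact: nbhs_left_gt.
have x0 : 0 <= x by apply: le_trans a0 (ltW ax).
have : (I p x < s%:E)%E by rewrite (path_inverse_ltP rate_g)// As lte_fin.
have : (v%:E <= I p x)%E.
  by rewrite leNgt (path_inverse_ltP rate_g)// Ev lte_fin -leNgt ltW.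
case E : (I p x) => [u| |]//; rewrite lee_fin lte_fin => vu us /=.
rewrite (path_time_change_fin E); apply: he => //=.
rewrite gtr0_norm ?subr_gt0// ltrBlDl -ltrBlDr.
apply: lt_le_trans vu; rewrite /v lt_max; apply/orP; right.
by rewrite ltrD2l ltrN2 ltr_pdivrMr// ltr_pMr// ltr1n.
Unshelve. all: by end_near. Qed.

(** Left-continuity of the inverse, in the form used for quasi-left-continuity. *)
Lemma path_inverse_sup p (t s : R) (tau : nat -> \bar R) : absorbed_path del p ->
  (forall n, 0 <= tau n)%E ->
  ereal_sup [set tau n | n in [set: nat]] = t%:E -> I p t = s%:E ->
  ereal_sup [set I p (fine (tau n)) | n in [set: nat]] = s%:E.
Proof.
move=> ap tau0 supt Is.
have taut n : (tau n <= t%:E)%E by rewrite -supt; apply: ereal_sup_ubound; exists n.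
have fin n : exists2 u : R, tau n = u%:E & 0 <= u /\ u <= t.
  have := tau0 n; have := taut n; case: (tau n) => [u| |]// h1 h2.
  by exists u => //; split.
have t0 : 0 <= t by have [u _ [u0 /(le_trans u0)]] := fin 0%N.
apply/le_anti/andP; split.
  apply: ge_ereal_sup => _ [n _ <-]; have [u -> [u0 ut]] := fin n.
  by rewrite -Is; exact: le_path_inverse.
rewrite leNgt; apply/negP => lts.
set S := ereal_sup _ in lts.
have S0 : (0 <= S)%E.
  apply: (le_trans (@path_inverse_ge0 _ _ g p (fine (tau 0%N)))).
  by apply: ereal_sup_ubound; exists 0%N.
case ES : S S0 lts => [r| |]//; rewrite lee_fin lte_fin => r0 rs.
(* At a time [v] strictly between the supremum [r] and [s] the clock is below [t], so some [tau n]
   exceeds it; its inverse is then at least [v], a contradiction. *)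
pose v := (r + s) / 2.
have rv : r < v by rewrite /v; lra.
have vs : v < s by rewrite /v; lra.
have := path_clock_lt ap t0 Is (le_trans r0 (ltW rv)) vs.
rewrite -supt => /ereal_sup_gt[_ [n _ <-]] Av.
have : (I p (fine (tau n)) <= r%:E)%E by rewrite -ES; apply: ereal_sup_ubound; exists n.
apply/negP; rewrite -ltNge; apply: (@lt_le_trans _ _ v%:E); first by rewrite lte_fin.
move: Av; have [u -> [u0 _]] := fin n => /= Av.
by rewrite leNgt (path_inverse_ltP rate_g)// -leNgt ltW.
Qed.

Lemma path_time_change_shift p (t s u : R) : absorbed_path del p ->
  0 <= t -> 0 <= u -> I p t = s%:E ->
  tc p (t + u) = tc (fun r => p (s + r)) u.
Proof.
move=> ap t0 u0 Is; have [s0 ps As] := (path_inverseP rate_g s ap t0).1 Is.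
have aps := absorbed_shift s0 ap; have tu0 : 0 <= t + u by exact: addr_ge0.
have := @path_inverse_ge0 _ _ g (fun r => p (s + r)) u.
case E : (I (fun r => p (s + r)) u) => [w| |]// _.
  have [w0 pw Aw] := (path_inverseP rate_g w aps u0).1 E.
  rewrite (path_time_change_fin E); apply: path_time_change_fin.
  apply/(path_inverseP rate_g) => //; split => //; first exact: addr_ge0.
  by rewrite (path_clockD rate_g)// As Aw.
rewrite [RHS](path_time_change_delP aps u0).2//.
apply/path_time_change_delP => //; have := @path_inverse_ge0 _ _ g p (t + u).
case E' : (I p (t + u)) => [v| |]// _; exfalso.
have [v0 pv Av] := (path_inverseP rate_g v ap tu0).1 E'.
have sv : s <= v.
  by rewrite -lee_fin -Is -E'; apply: le_path_inverse => //; rewrite lerDl.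
have vs0 : 0 <= v - s by rewrite subr_ge0.
suff : I (fun r => p (s + r)) u = (v - s)%:E by rewrite E.
apply/(path_inverseP rate_g) => //; split => //; first by rewrite addrC subrK.
have := path_clockD rate_g ap s0 vs0.
rewrite [in LHS]addrC subrK Av As EFinD.
case: (path_clock _ _) => [a| |]//= [] /addrI ->//.
Qed.

(** Either side exceeds [t >= 0] exactly when the inverse at [t] is a live time. This is the formula
    for the lifetime in both parts of the theorem. *)
Lemma path_lifetime_time_change p : absorbed_path del p ->
  path_lifetime del (tc p) = A p (path_lifetime del p).
Proof.
move=> ap; apply: ge0_eq_ltP => [||t t0].
- exact: path_lifetime_ge0.
- exact: (path_clock_ge0 rate_g).
rewrite -(path_inverse_ltP rate_g)//; apply/idP/idP.
  move=> /(path_lifetime_gtP (absorbed_time_change ap) t0).1.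
  move=> /(path_inverse_fin ap t0)[s Is]; rewrite Is.
  have [s0 ps As] := (path_inverseP rate_g s ap t0).1 Is.
  exact/path_lifetime_gtP.
move=> Ilt; apply/path_lifetime_gtP => //; first exact: absorbed_time_change.
move=> /(path_time_change_delP ap t0) It.
by move: Ilt; rewrite It ltNge leey.
Qed.

End path_time_change.

(** * Borel sets and stopped processes *)

Lemma sigma_algebra_borel (T : topologicalType) : sigma_algebra setT (borel T).
Proof. exact: smallest_sigma_algebra. Qed.

Notation borelType x0 := (salg x0 (sigma_algebra_borel _)).

Lemma borel_preimage (T : topologicalType) d (W : measurableType d) (f : W -> T) :
  (forall U, open U -> measurable (f @^-1` U)) ->
  forall B, borel T B -> measurable (f @^-1` B).
Proof.
move=> fo; apply: smallest_sub => //; split => [|A /= mA|A /= mA].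
- by rewrite /= preimage_set0.
- by rewrite /= setTD preimage_setC; exact: measurableC.
- by rewrite /= preimage_bigcup; exact: bigcupT_measurable.
Qed.

Lemma borel_borel_preimage (S T : topologicalType) (x0 : S) (f : S -> T) :
  (forall U, open U -> borel S (f @^-1` U)) ->
  forall B, borel T B -> borel S (f @^-1` B).
Proof. exact: (@borel_preimage T _ (borelType x0)). Qed.

Lemma borel_continuous (S T : topologicalType) (x0 : S) (f : S -> T) :
  continuous f -> forall B, borel T B -> borel S (f @^-1` B).
Proof.
move=> /continuousP cf; apply: (borel_borel_preimage x0) => U /cf oU.
exact: sub_sigma_algebra.
Qed.

Lemma open_preimage_off (S T : topologicalType) (del : S) (f : S -> T) (U : set T) :
  closed [set del] -> (forall x, x <> del -> {for x, continuous f}) ->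
  open U -> open (f @^-1` U `\ del).
Proof.
move=> cdel cf oU; rewrite openE => x [/= Ufx xd].
apply: filterI; first by apply: cf => //; exact: open_nbhs_nbhs.
by apply: open_nbhs_nbhs; split => //; exact: closed_openC.
Qed.

(** The preimage of an open set differs from an open set by at most the closed point [del]. *)
Lemma borel_continuous_off (S T : topologicalType) (del : S) (f : S -> T) :
  closed [set del] -> (forall x, x <> del -> {for x, continuous f}) ->
  forall B, borel T B -> borel S (f @^-1` B).
Proof.
move=> cdel cf; apply: (borel_borel_preimage del) => U oU.
have mo (V : set S) : open V -> @measurable _ (borelType del) V.
  by move=> oV; apply: sub_sigma_algebra.
have mV := mo _ (open_preimage_off cdel cf oU).
have mdel : @measurable _ (borelType del) [set del].
  by rewrite -[X in measurable X]setCK; apply: measurableC; apply: mo; exact: closed_openC.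
have [Ud|Ud] := pselect (U (f del)).
  rewrite (_ : f @^-1` U = (f @^-1` U `\ del) `|` [set del]).
    exact: (measurableU _ _ mV mdel).
  apply/seteqP; split => [x Ux|x [[]//|-> //]].
  by have [xd|xd] := pselect (x = del); [right|left].
rewrite (_ : f @^-1` U = f @^-1` U `\ del)//.
by apply/seteqP; split => [x Ux|x []//]; split => // xd; apply: Ud; rewrite -xd.
Qed.

Lemma borel_funP (R : realType) (T : topologicalType) (x0 : T) (f : T -> R) :
  (forall B, borel R B -> borel T (f @^-1` B)) -> borel_fun f.
Proof.
move=> fb; have mf : measurable_fun setT (f : borelType x0 -> R).
  apply: (measurability _ (RGenOpens.measurableE R)) => _ [_ [a [b ->] <-]].
  by rewrite setTI; apply: fb; apply: sub_sigma_algebra; exact: interval_open.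
by move=> B mB; have := mf measurableT B mB; rewrite setTI.
Qed.

Lemma borel_fun_measurable (T : topologicalType) (x0 : T) d (V : measurableType d)
  (f : T -> V) : borel_fun f <-> measurable_fun setT (f : borelType x0 -> V).
Proof.
split=> [bf _ B mB|mf B mB]; first by rewrite setTI; exact: bf.
by have := mf measurableT B mB; rewrite setTI.
Qed.

(* Perfect normality, in the form in which limits of measurable maps are
   measurable. *)
Definition cozero_space (R : realType) (T : topologicalType) : Prop :=
  forall U : set T, open U ->
    exists2 k : T -> R, continuous k & U = [set x | 0 < k x].

Section process_measurability.
Context {R : realType} {T : topologicalType} {del : T}.
Context {d : measure_display} {W : measurableType d}.
Variables (X : R -> W -> T) (s : R).
Hypotheses (s0 : 0 <= s) (aX : forall w, absorbed_path del (X ^~ w)).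
Hypothesis mX : forall r, 0 <= r -> r <= s -> forall B, borel T B ->
  measurable (X r @^-1` B).

(** Confining times to [[0, s]] makes all maps below depend on the path up to [s] only. With [G s]
    as the sigma-algebra of [W], joint measurability becomes progressive measurability. *)
Let clamp (r : R) : R := Num.max 0 (Num.min r s).

Let clamp_ge0 r : 0 <= clamp r. Proof. by rewrite le_max lexx. Qed.

Let clamp_le r : clamp r <= s. Proof. by rewrite ge_max s0 ge_min lexx orbT. Qed.

Let clampE r : 0 <= r -> r <= s -> clamp r = r.
Proof. by move=> r0 rs; rewrite /clamp min_l// max_r. Qed.

Let clamp_right_continuous (k : T -> R) :
  (forall p (r : R), absorbed_path del p -> 0 <= r -> k (p x) @[x --> r^'+] --> k (p r)) ->
  forall r w, k (X (clamp x) w) @[x --> r^'+] --> k (X (clamp r) w).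
Proof.
move=> hk r w.
have [r0|r0] := ltP r 0.
  apply: cvg_near_cst; near=> x; rewrite /clamp.
  have x0 : x <= 0 by apply: ltW; near: x; exact: nbhs_right_lt.
  by rewrite !max_l// ?ge_min ?x0// (ltW r0).
have [sr|rs] := leP s r.
  apply: cvg_near_cst; near=> x; rewrite /clamp.
  have rx : r <= x by near: x; exact: nbhs_right_ge.
  by rewrite !min_r// (le_trans sr).
rewrite (clampE r0 (ltW rs)).
have := hk _ _ (aX w) r0; apply: cvg_trans; apply: near_eq_cvg; near=> x.
have rx : r <= x by near: x; exact: nbhs_right_ge.
rewrite clampE//; first exact: le_trans rx.
by apply: ltW; near: x; exact: nbhs_right_lt.
Unshelve. all: by end_near. Qed.

(** For an open set [U = [set x | 0 < k x]], the real process [k (X r w)] is jointly measurable by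
    right-continuity, and it is composed with [w |-> (tau' w, w)], where [tau'] is [tau] capped at
    [s]. *)
Lemma measurable_process_at (tau : W -> \bar R) : cozero_space R T ->
  (forall w, 0 <= tau w)%E ->
  (forall v : R, 0 <= v -> v <= s -> measurable [set w | (tau w <= v%:E)%E]) ->
  forall B, borel T B ->
  measurable [set w | (tau w <= s%:E)%E /\ B (X (fine (tau w)) w)].
Proof.
move=> coz tau0 mtau.
pose tau' (w : W) : R := fine (mine (tau w) s%:E).
have tau'E w : (tau w <= s%:E)%E -> tau' w = fine (tau w).
  by move=> h; rewrite /tau' min_l.
have tau'_ge0 w : 0 <= tau' w.
  by rewrite fine_ge0// le_min tau0 lee_fin.
have tau'_le w : tau' w <= s.
  rewrite /tau'; have := tau0 w; case: (leP (tau w) s%:E) => //.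
  by case: (tau w) => [r| |]//; rewrite lee_fin.
have mtau' : measurable_fun setT tau'.
  apply: (measurability _ (RGenOInfty.measurableE R)) => _ [_ [v ->] <-].
  rewrite setTI (_ : _ @^-1` _ = ~` [set w | tau' w <= v]); last first.
    by apply/seteqP; split => w /=; rewrite in_itv/= andbT ltNge => /negP.
  apply: measurableC.
  have [v0|v0] := ltP v 0.
    rewrite (_ : [set _ | _] = set0)// -subset0 => w /=.
    by rewrite leNgt (lt_le_trans v0).
  have [sv|vs] := leP s v.
    rewrite (_ : [set _ | _] = setT)//; apply/seteqP; split => w //= _.
    exact: le_trans sv.
  rewrite (_ : [set _ | _] = [set w | (tau w <= v%:E)%E]); first by apply: mtau => //; exact: ltW.
  apply/seteqP; split => w /=; rewrite /tau'; have := tau0 w; last first.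
    move=> _ tv; rewrite min_l; last by apply: le_trans tv _; rewrite lee_fin ltW.
    by move: tv; have := tau0 w; case: (tau w).
  case: (leP (tau w) s%:E) => [|_ _ /=]; last by move=> sv; move: vs; rewrite ltNge sv.
  by case: (tau w) => [r| |]//=; rewrite ?lee_fin.
suff h U : open U -> measurable [set w | U (X (tau' w) w)].
  move=> B bB.
  rewrite (_ : [set _ | _] = [set w | (tau w <= s%:E)%E] `&` [set w | B (X (tau' w) w)]).
    apply: measurableI; first exact: mtau.
    exact: (@borel_preimage T _ W (fun w => X (tau' w) w)).
  by apply/seteqP; split => w [/= ts]; rewrite tau'E.
move=> /coz[k ck ->].
have := @measurable_right_continuous R _ W (fun r w => k (X (clamp r) w)).
move=> /(_ _ _)/=.
have mk r : measurable_fun setT (fun w => k (X (clamp r) w)).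
  apply: (measurability _ (RGenOpens.measurableE R)) => _ [_ [a [b ->] <-]].
  rewrite setTI -[X in measurable X]/(X (clamp r) @^-1` (k @^-1` _)).
  apply: mX => //; apply: sub_sigma_algebra.
  by move/continuousP : ck; apply; exact: interval_open.
have rk : forall r w, k (X (clamp x) w) @[x --> r^'+] --> k (X (clamp r) w).
  apply: clamp_right_continuous => p r [_ rc _] r0.
  by apply: (@cvg_comp _ _ _ p k) (ck _); exact: rc.
move=> /(_ mk rk) mkX.
have mt : measurable_fun setT (fun w : W => (tau' w : measurableTypeR R, w)).
  exact: measurable_fun_pair.
have := measurableT_comp mkX mt => /(_ measurableT `]0, +oo[%classic (measurable_itv _)).
rewrite setTI; congr measurable; apply/seteqP; split => w /=;
  by rewrite in_itv/= andbT clampE.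
Qed.

Lemma measurable_path_clock (g : T -> R) : rate_function del g ->
  measurable_fun setT (fun w => path_clock g (X ^~ w) s%:E).
Proof.
move=> rate_g; have [g_del g_gt0 g_cont g_borel] := rate_g.
have mg r : measurable_fun setT (fun w => g (X (clamp r) w)).
  move=> _ B mB; rewrite setTI -[X in measurable X]/(X (clamp r) @^-1` (g @^-1` _)).
  by apply: mX => //; exact: g_borel.
have rg := clamp_right_continuous (fun p r => rate_right_continuous rate_g (p := p) (t := r)).
have gg r w : 0 <= g (X (clamp r) w).
  by have [->|/eqP/g_gt0/ltW//] := eqVneq (X (clamp r) w) del; rewrite g_del.
have := measurable_integral_right_continuous (measurable_before s%:E) gg mg rg.
apply: eq_measurable_fun => w _; apply: eq_integral => r.
by rewrite inE => -[r0]; rewrite lte_fin => rs; rewrite clampE// ltW.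
Qed.

Lemma measurable_path_inverse_lt (g : T -> R) (t : R) : rate_function del g ->
  0 <= t -> measurable [set w | (path_inverse g (X ^~ w) t < s%:E)%E].
Proof.
move=> rate_g t0.
have := measurable_path_clock rate_g measurableT (emeasurable_itv `]t%:E, +oo[).
rewrite setTI; congr measurable; apply/seteqP; split => w /=;
  by rewrite (path_inverse_ltP rate_g)// in_itv/= andbT.
Qed.

End process_measurability.

(** The measurable space [W] is arbitrary because the lemma is applied to the path space itself. *)
Lemma measurable_path_time_change (R : realType) (T : topologicalType) (del : T)
    (g : T -> R) d (W : measurableType d) (X : R -> W -> T) (t : R) :
  cozero_space R T -> rate_function del g ->
  (forall w, absorbed_path del (X ^~ w)) ->
  (forall r, 0 <= r -> forall B, borel T B -> measurable (X r @^-1` B)) ->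
  0 <= t -> forall B, borel T B ->
  measurable [set w | B (path_time_change del g (X ^~ w) t)].
Proof.
move=> coz rate_g aX mX t0 B bB.
pose tau w := path_inverse g (X ^~ w) t.
have tau0 w : (0 <= tau w)%E by exact: path_inverse_ge0.
have mlt v : 0 <= v -> measurable [set w | (tau w < v%:E)%E].
  by move=> v0; apply: (measurable_path_inverse_lt v0 aX _ rate_g t0) => r r0 _; exact: mX.
have mle v : 0 <= v -> measurable [set w | (tau w <= v%:E)%E].
  move=> v0; rewrite (_ : [set _ | _] = \bigcap_n [set w | (tau w < (v + n.+1%:R^-1)%:E)%E]).
    by apply: bigcapT_measurable => n; apply: mlt; rewrite addr_ge0.
  apply/seteqP; split => [w /= tv n _|w tv] /=.
    by apply: le_lt_trans tv _; rewrite lte_fin ltrDl invr_gt0.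
  apply/lee_addgt0Pr => e e0; have [n] := ltr_add_invr e0; rewrite add0r => ne.
  by apply: le_trans (ltW (tv n I)) _; rewrite -EFinD lee_fin lerD2l ltW.
have mfin : measurable [set w | tau w = +oo%E].
  rewrite (_ : [set _ | _] = \bigcap_n ~` [set w | (tau w <= n%:R%:E)%E]).
    by apply: bigcapT_measurable => n; apply: measurableC; exact: mle.
  apply/seteqP; split => [w /= tw n _|w tn] /=; first by rewrite tw leNgt ltry.
  apply/eqP; rewrite eq_le leey/= leNgt; apply/negP => h.
  have := tau0 w; case E : (tau w) h tn => [r| |]// _ tn r0.
  have /= := tn (Num.bound `|r|) I; apply; rewrite E lee_fin ltW//.
  exact: le_lt_trans (ler_norm _) (archi_boundP (normr_ge0 r)).
rewrite (_ : [set _ | _] =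
    [set w | tau w = +oo%E /\ B del] `|`
    \bigcup_n [set w | (tau w <= n%:R%:E)%E /\ B (X (fine (tau w)) w)]).
  apply: measurableU.
    have [Bd|Bd] := pselect (B del).
      by rewrite (_ : [set _ | _] = [set w | tau w = +oo%E])//; apply/seteqP; split => w // [].
    by rewrite (_ : [set _ | _] = set0)// -subset0 => w [].
  apply: bigcupT_measurable => n.
  by apply: (measurable_process_at _ aX) => // [r r0 _|v v0 _]; [exact: mX|exact: mle].
apply/seteqP; split => w /=; rewrite /path_time_change -/(tau w).
  have := tau0 w; case E : (tau w) => [r| |]// r0 Br; [right|by left].
  exists (Num.bound `|r|) => //=; rewrite E; split => //; rewrite lee_fin ltW//.
  exact: le_lt_trans (ler_norm _) (archi_boundP (normr_ge0 r)).
case=> [[-> //]|[n _ [/= tn]]].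
by have := tau0 w; case E : (tau w) tn => [r| |]//.
Qed.

Section sigma_algebra_closure.
Context {T : pointedType} {F : set_system T}.
Hypothesis HF : sigma_algebra setT F.

Let W := salg (point : T) HF.

Lemma salgT : F setT. Proof. exact: (@measurableT _ W). Qed.
Lemma salg0 : F set0. Proof. exact: (@measurable0 _ W). Qed.
Lemma salgC A : F A -> F (~` A). Proof. exact: (@measurableC _ W). Qed.
Lemma salgI A B : F A -> F B -> F (A `&` B). Proof. exact: (@measurableI _ W). Qed.
Lemma salgU A B : F A -> F B -> F (A `|` B). Proof. exact: (@measurableU _ W). Qed.
Lemma salg_bigcup (A : nat -> set T) : (forall n, F (A n)) -> F (\bigcup_n A n).
Proof. exact: (@bigcupT_measurable _ W). Qed.
Lemma salg_bigcap (A : nat -> set T) : (forall n, F (A n)) -> F (\bigcap_n A n).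
Proof. exact: (@bigcapT_measurable _ W). Qed.
Lemma salg_bigcup_rat (A : rat -> set T) : (forall q, F (A q)) -> F (\bigcup_q A q).
Proof. exact: (@bigcupT_measurable_rat _ W). Qed.

End sigma_algebra_closure.

Lemma ereal_rat_between (R : realType) (a : R) (b : \bar R) : (a%:E < b)%E ->
  exists q : rat, a < ratr q /\ ((ratr q)%:E < b)%E.
Proof.
case: b => [b| |]//; last first.
  have := ltr_pwDr ltr01 (lexx a) => /rat_in_itvoo[q].
  by rewrite in_itv/= => /andP[aq _] _; exists q; rewrite ltry.
by rewrite lte_fin => /rat_in_itvoo[q]; rewrite in_itv/= => /andP[aq qb]; exists q.
Qed.

(** * Stopping times of a right-continuous filtration *)

Section stopping.
Context {R : realType} {d : measure_display} {Omega : measurableType d}.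
Context {G : R -> set_system Omega}.
Hypothesis filG : filtration G.
Implicit Types (tau : Omega -> \bar R) (A : set Omega).

Lemma filtration_salg t : 0 <= t -> sigma_algebra setT (G t).
Proof. by case: filG => + _ _ => /[apply] -[]. Qed.

Lemma filtration_measurable t A : 0 <= t -> G t A -> measurable A.
Proof. by case: filG => + _ _ => /[apply] -[_]; exact. Qed.

Lemma filtration_le s t A : 0 <= s -> s <= t -> G s A -> G t A.
Proof. by case: filG => _ + _ => /[apply] /[apply]; exact. Qed.

Lemma filtration_right t A : 0 <= t -> (forall u : R, t < u -> G u A) -> G t A.
Proof. by case: filG => _ _; exact. Qed.

(** For every [u > t], the event [tau <= t] is the intersection of the events [tau < t + e n] with
    [t + e n <= u], so it lies in [G u]; right-continuity brings it down to [G t]. Strict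
    inequalities are the natural ones for inverse clocks. *)
Lemma stopped_of_lt tau A :
  (forall v : R, 0 < v -> G v (A `&` [set w | (tau w < v%:E)%E])) ->
  forall t : R, 0 <= t -> G t (A `&` [set w | (tau w <= t%:E)%E]).
Proof.
move=> h t t0; apply: filtration_right => // u tu.
have u0 := le_trans t0 (ltW tu).
pose e n := (u - t) / n.+1%:R.
have ut0 : 0 < u - t by rewrite subr_gt0.
have e0 n : 0 < e n by rewrite divr_gt0.
rewrite (_ : _ `&` _ = \bigcap_n (A `&` [set w | (tau w < (t + e n)%:E)%E])).
  apply: (salg_bigcap (filtration_salg u0)) => n.
  apply: (@filtration_le (t + e n)); [by rewrite addr_ge0// ltW| |].
    by rewrite -lerBrDl ler_pdivrMr// ler_peMr ?ler1n// ltW.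
  by apply: h; rewrite ltr_wpDl.
apply/seteqP; split => [w [Aw tw] n _|w h'] /=.
  by split => //; apply: le_lt_trans tw _; rewrite lte_fin ltrDl.
split; first by have [] := h' 0%N I.
apply/lee_addgt0Pr => r r0.
have [n] := ltr_add_invr (divr_gt0 r0 ut0); rewrite add0r ltr_pdivlMr// mulrC => nr.
have [_ /ltW/le_trans] := h' n I; apply; rewrite -EFinD lee_fin lerD2l.
exact: ltW.
Qed.

Lemma stopping_time_of_lt tau : (forall w, 0 <= tau w)%E ->
  (forall v : R, 0 < v -> G v [set w | (tau w < v%:E)%E]) -> stopping_time G tau.
Proof.
move=> tau0 h; split => // t t0.
rewrite -[X in G t X]setTI; apply: stopped_of_lt => // v v0.
by rewrite setTI; exact: h.
Qed.

Lemma stopped_lt tau A (v : R) : stopped_algebra G tau A -> 0 < v ->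
  G v (A `&` [set w | (tau w < v%:E)%E]).
Proof.
move=> [_ h] v0; have v0' := ltW v0.
have le_v n : v - v / n.+1%:R <= v by rewrite gerBl divr_ge0.
have ge0 n : 0 <= v - v / n.+1%:R.
  by rewrite subr_ge0 ler_pdivrMr// ler_peMr ?ler1n.
rewrite (_ : _ `&` _ = \bigcup_n (A `&` [set w | (tau w <= (v - v / n.+1%:R)%:E)%E])).
  apply: (salg_bigcup (filtration_salg v0')) => n.
  by apply: (filtration_le (ge0 n) (le_v n)); exact: (h _ (ge0 n)).
apply/seteqP; split => [w [Aw tw]|w [n _ [Aw tw]]]; last first.
  by split => //; apply: le_lt_trans tw _; rewrite lte_fin gtrBl divr_gt0.
have [r tr rv] : exists2 r : R, (tau w <= r%:E)%E & r < v.
  move: tw => /=; case: (tau w) => [r| |] h'.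
  - by exists r => //; rewrite -lte_fin.
  - by rewrite ltNge leey in h'.
  - by exists 0; rewrite ?leNye.
have [n] := ltr_add_invr (divr_gt0 (ltac:(by rewrite subr_gt0) : 0 < v - r) v0).
rewrite add0r ltr_pdivlMr// mulrC => nr.
exists n => //; split => //; apply: le_trans tr _.
by rewrite lee_fin lerBrDr addrC -lerBrDr ltW.
Qed.

Lemma stopped_salg tau : stopping_time G tau -> Defs.sub_sigma_algebra (stopped_algebra G tau).
Proof.
move=> [tau0 st]; split; last by move=> A [].
split.
- by split => // t t0; rewrite set0I; exact: salg0 (filtration_salg t0).
- move=> A [mA h]; rewrite setTD; split => [|t t0]; first exact: measurableC.
  have G_t := filtration_salg t0.
  rewrite (_ : _ `&` _ = [set w | (tau w <= t%:E)%E] `&`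
      ~` (A `&` [set w | (tau w <= t%:E)%E])).
    exact: (salgI G_t (st _ t0) (salgC G_t (h _ t0))).
  by apply/seteqP; split => w [/= h1 h2]; split => //; [case|move=> Aw; apply: h2].
- move=> A hA; split => [|t t0]; first by apply: bigcupT_measurable => n; case: (hA n).
  rewrite setI_bigcupl; apply: (salg_bigcup (filtration_salg t0)) => n.
  by case: (hA n) => _; exact.
Qed.

Lemma stopping_time_cst (t : R) : 0 <= t -> stopping_time G (fun=> t%:E).
Proof.
move=> t0; split => [w|s s0]; first by rewrite lee_fin.
have [ts|st] := leP t s.
  rewrite (_ : [set _ | _] = setT); first exact: salgT (filtration_salg s0).
  by apply/seteqP; split => // w _; rewrite /= lee_fin.
rewrite (_ : [set _ | _] = set0); first exact: salg0 (filtration_salg s0).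
by rewrite -subset0 => w; rewrite /= lee_fin leNgt st.
Qed.

Lemma stopped_algebra_cst (t : R) A : 0 <= t -> G t A -> stopped_algebra G (fun=> t%:E) A.
Proof.
move=> t0 GA; split => [|s s0]; first exact: filtration_measurable GA.
have [ts|st] := leP t s.
  rewrite (_ : [set _ | _] = setT) ?setIT; first exact: filtration_le GA.
  by apply/seteqP; split => // w _; rewrite /= lee_fin.
rewrite (_ : [set _ | _] = set0) ?setI0; first exact: salg0 (filtration_salg s0).
by rewrite -subset0 => w; rewrite /= lee_fin leNgt st.
Qed.

Lemma stopping_timeD tau (s : R) : stopping_time G tau -> 0 <= s ->
  stopping_time G (fun w => tau w + s%:E)%E.
Proof.
move=> [tau0 st] s0; split => [w|t t0]; first by rewrite adde_ge0.
have [st'|ts] := leP s t.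
  rewrite (_ : [set _ | _] = [set w | (tau w <= (t - s)%:E)%E]).
    apply: (@filtration_le (t - s)); rewrite ?subr_ge0 ?gerBl//.
    by apply: st; rewrite subr_ge0.
  by apply/seteqP; split => w /=; rewrite EFinB leeBrDr.
rewrite (_ : [set _ | _] = set0); first exact: salg0 (filtration_salg t0).
rewrite -subset0 => w /=; apply/negP; rewrite -ltNge.
apply: (@lt_le_trans _ _ s%:E); first by rewrite lte_fin.
by rewrite leeDr.
Qed.

Lemma le_stopped_algebra sigma tau A : stopping_time G tau ->
  (forall w, sigma w <= tau w)%E -> stopped_algebra G sigma A -> stopped_algebra G tau A.
Proof.
move=> [tau0 st] le [mA h]; split => // t t0.
rewrite (_ : _ `&` _ = (A `&` [set w | (sigma w <= t%:E)%E]) `&` [set w | (tau w <= t%:E)%E]).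
  exact: (salgI (filtration_salg t0) (h _ t0) (st _ t0)).
apply/seteqP; split => w /= [h1 h2]; last by case: h1.
by split => //; split => //; exact: le_trans h2.
Qed.

Lemma stopped_algebra_fin tau : stopping_time G tau ->
  stopped_algebra G tau [set w | (tau w < +oo)%E].
Proof.
move=> st; have [_ h] := st; split => [|t t0].
  rewrite (_ : [set _ | _] = \bigcup_n [set w | (tau w <= n%:R%:E)%E]).
    by apply: bigcupT_measurable => n; apply: (@filtration_measurable n%:R) => //; exact: h.
  have [tau0 _] := st.
  apply/seteqP; split => [w /=|w [n _ /= /le_lt_trans]]; last by apply; rewrite ltry.
  have := tau0 w; case E : (tau w) => [r| |]// r0 _.
  exists (Num.bound `|r|) => //=; rewrite E lee_fin ltW//.
  exact: le_lt_trans (ler_norm _) (archi_boundP (normr_ge0 r)).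
rewrite (_ : _ `&` _ = [set w | (tau w <= t%:E)%E]); first exact: h.
by apply/seteqP; split => [w []//|w /= tw]; split => //; apply: le_lt_trans tw _; rewrite ltry.
Qed.

End stopping.

Section strong_markov_basics.
Context {R : realType} {d : measure_display} {Omega : measurableType d}.
Context {T : topologicalType} {del : T} {G : R -> set_system Omega}.
Context {P : T -> probability Omega R} {X : R -> Omega -> T}.
Hypothesis sm : strong_markov del G P X.

Lemma strong_markov_absorbed w : absorbed_path del (X ^~ w).
Proof.
have dead (t : R) : 0 <= t -> (forall s, t < s -> X s w = del) -> X t w = del.
  move=> t0 h; apply: (sm_dead sm) => //; apply/lee_addgt0Pr => e e0.
  apply: ereal_inf_lbound; exists (t + e) => //; split; first by rewrite ltr_wpDl.
  by apply: h; rewrite ltrDl.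
split => //.
- by move=> s t s0 st; exact: (sm_trap sm).
- move=> t t0; have [tl|lt] := ltP t%:E (lifetime del X w).
    exact: (sm_right_continuous sm).
  have Xt : X t w = del by exact: (sm_dead sm).
  apply: cvg_near_cst; near=> x; rewrite Xt; apply: (sm_trap sm) Xt => //.
Unshelve. all: by end_near. Qed.

Lemma lifetime_gtP w (t : R) : 0 <= t -> (t%:E < lifetime del X w)%E <-> X t w <> del.
Proof. by move=> t0; apply: path_lifetime_gtP => //; exact: strong_markov_absorbed. Qed.

Lemma process_measurable (r : R) (B : set T) : 0 <= r -> borel T B ->
  measurable (X r @^-1` B).
Proof.
move=> r0 bB; apply: (filtration_measurable (sm_filtration sm) r0).
exact: (sm_adapted sm).
Qed.

Lemma stopped_process (tau : Omega -> \bar R) (B : set T) : cozero_space R T ->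
  stopping_time G tau -> borel T B ->
  stopped_algebra G tau [set w | (tau w < +oo)%E /\ B (X (fine (tau w)) w)].
Proof.
move=> coz st bB; have [tau0 h] := st; have fG := sm_filtration sm.
have key t : 0 <= t -> G t [set w | (tau w <= t%:E)%E /\ B (X (fine (tau w)) w)].
  move=> t0; have S := filtration_salg fG t0.
  (* Progressive measurability: [Omega] is equipped with the sigma-algebra [G t]. *)
  apply: (@measurable_process_at R T del _ (salg (point : Omega) S) X t t0
    strong_markov_absorbed _ tau coz tau0 _ B bB).
    move=> r r0 rt C bC; apply: (filtration_le fG r0 rt).
    exact: (sm_adapted sm).
  by move=> v v0 vt; apply: (filtration_le fG v0 vt); exact: h.
split => [|t t0]; last first.
  rewrite (_ : _ `&` _ = [set w | (tau w <= t%:E)%E /\ B (X (fine (tau w)) w)]).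
    exact: key.
  apply/seteqP; split => w /= [h1 h2]; first by case: h1.
  by split => //; split => //; apply: le_lt_trans h1 _; rewrite ltry.
rewrite (_ : [set _ | _] =
    \bigcup_n [set w | (tau w <= n%:R%:E)%E /\ B (X (fine (tau w)) w)]).
  by apply: bigcupT_measurable => n; apply: (filtration_measurable fG (ler0n R n)); exact: key.
apply/seteqP; split => [w /= [fin Bw]|w [n _ [/= tn Bw]]]; last first.
  by split => //; apply: le_lt_trans tn _; rewrite ltry.
have := tau0 w; case E : (tau w) fin => [r| |]// _ r0.
exists (Num.bound `|r|) => //=; rewrite E; split; last by rewrite E in Bw.
rewrite lee_fin ltW//.
exact: le_lt_trans (ler_norm _) (archi_boundP (normr_ge0 r)).
Qed.

End strong_markov_basics.

(** * Time change of the filtration *)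

Section time_changed_filtration.
Context {R : realType} {d : measure_display} {Omega : measurableType d}.
Context {T : topologicalType} {del : T} {G : R -> set_system Omega}.
Context {P : T -> probability Omega R} {X : R -> Omega -> T} {g : T -> R}.
Hypothesis sm : strong_markov del G P X.
Hypothesis rate_g : rate_function del g.

Let fG : filtration G := sm_filtration sm.
Let aX w : absorbed_path del (X ^~ w) := strong_markov_absorbed sm w.

Definition time_change (t : R) (w : Omega) : T := path_time_change del g (X ^~ w) t.

(** The time [phi(tau)] for a random time [tau], infinite where [tau] is. *)
Definition inverse_at (tau : Omega -> \bar R) (w : Omega) : \bar R :=
  if tau w is t%:E then path_inverse g (X ^~ w) t else +oo%E.
Arguments inverse_at : simpl never.

Definition changed_filtration (t : R) : set_system Omega :=
  stopped_algebra G (inverse_at (fun=> t%:E)).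

Local Notation H := changed_filtration.

Lemma inverse_at_ge0 tau w : (0 <= inverse_at tau w)%E.
Proof. by rewrite /inverse_at; case: (tau w) => [t| |]//; exact: path_inverse_ge0. Qed.

Lemma inverse_at_ltP tau w (v : R) : (0 <= tau w)%E ->
  (inverse_at tau w < v%:E)%E = (tau w < path_clock g (X ^~ w) v%:E)%E.
Proof.
rewrite /inverse_at; case: (tau w) => [t| |]//; last first.
  by move=> _; rewrite !ltNge !leey.
by rewrite lee_fin => t0; exact: (path_inverse_ltP rate_g _ (aX w) t0).
Qed.

Lemma stopping_inverse_cst (t : R) : 0 <= t ->
  stopping_time G (inverse_at (fun=> t%:E)).
Proof.
move=> t0; apply: (stopping_time_of_lt fG) => [w|v v0]; first exact: inverse_at_ge0.
have S := filtration_salg fG (ltW v0).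
apply: (@measurable_path_inverse_lt R T del _ (salg (point : Omega) S) X v (ltW v0) aX
  _ g t rate_g t0).
move=> r r0 rv B bB; apply: (filtration_le fG r0 rv).
exact: (sm_adapted sm).
Qed.

(** For right-continuity, [phi(t) < v] means [t < A_v], and a rational [q] in between satisfies
    [phi(q) < v]. So the event is a countable union over rationals [q > t], for which [A] belongs to
    [H q]. *)
Lemma changed_filtrationP : filtration H.
Proof.
split=> [t t0|s t s0 st A|t A t0 h].
- by apply: (stopped_salg fG); exact: stopping_inverse_cst.
- apply: (le_stopped_algebra fG); first exact: stopping_inverse_cst (le_trans s0 st).
  by move=> w; exact: (le_path_inverse rate_g (aX w)).
- split; first by have [] := h (t + 1) ltac:(by rewrite ltrDl).
  apply: (stopped_of_lt fG) => v v0.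
  rewrite (_ : _ `&` _ = \bigcup_(q : rat)
     if t < ratr q then A `&` [set w | (inverse_at (fun=> (ratr q)%:E) w < v%:E)%E] else set0).
    apply: (salg_bigcup_rat (filtration_salg fG (ltW v0))) => q.
    case: ifPn => [tq|_]; last exact: salg0 (filtration_salg fG (ltW v0)).
    exact: (stopped_lt fG (h _ tq)).
  apply/seteqP; split => [w [Aw /=]|w [q _]] /=.
    rewrite inverse_at_ltP ?lee_fin// => /ereal_rat_between[q [tq qv]].
    exists q => //; rewrite tq; split => //=.
    by rewrite inverse_at_ltP// lee_fin (le_trans t0)// ltW.
  case: ifPn => // tq [Aw /=]; rewrite !inverse_at_ltP ?lee_fin//; last first.
    by rewrite (le_trans t0)// ltW.
  by move=> h'; split => //; apply: lt_trans h'; rewrite lte_fin.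
Qed.

(** [phi(tau) < v] holds iff some rational [q > 0] satisfies both [tau < q] and [phi(q) < v]. The
    first event, met with [A], lies in the stopped algebra of [phi(q)], and the second then places
    it in [G v]. *)
Lemma stopped_inverse_lt tau A (v : R) : stopping_time H tau ->
  stopped_algebra H tau A -> 0 < v ->
  G v (A `&` [set w | (inverse_at tau w < v%:E)%E]).
Proof.
move=> [tau0 st] hA v0.
rewrite (_ : _ `&` _ = \bigcup_(q : rat)
   if 0 < ratr q :> R then (A `&` [set w | (tau w < (ratr q)%:E)%E]) `&`
      [set w | (inverse_at (fun=> (ratr q)%:E) w < v%:E)%E] else set0).
  apply: (salg_bigcup_rat (filtration_salg fG (ltW v0))) => q.
  case: ifPn => [q0|_]; last exact: salg0 (filtration_salg fG (ltW v0)).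
  exact: (stopped_lt fG (stopped_lt changed_filtrationP hA q0)).
apply/seteqP; split => [w [Aw /=]|w [q _]] /=.
  rewrite inverse_at_ltP//.
  have := tau0 w; case E : (tau w) => [t| |] // t0; last by rewrite ltNge leey.
  move=> /ereal_rat_between[q [tq qv]].
  have q0 : 0 < ratr q :> R by rewrite (le_lt_trans _ tq).
  exists q => //; rewrite q0; split => /=; first by rewrite E.
  by rewrite inverse_at_ltP// lee_fin ltW.
case: ifPn => // q0 [[Aw tq]] /=.
rewrite !inverse_at_ltP//; last by rewrite lee_fin ltW.
by split => //; exact: lt_trans tq _.
Qed.

Lemma stopping_inverse tau : stopping_time H tau -> stopping_time G (inverse_at tau).
Proof.
move=> st; apply: (stopping_time_of_lt fG) => [w|v v0]; first exact: inverse_at_ge0.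
rewrite -[X in G v X]setTI; apply: stopped_inverse_lt => //.
split => // t t0; rewrite setTI; exact: st.2.
Qed.

(** For the converse, [phi(tau) <= phi(t)] where [tau <= t], so the condition [phi(tau) <= u]
    follows from [tau <= t] and [phi(t) <= u] and may be added to them. *)
Lemma stopped_inverse tau A : stopping_time H tau ->
  stopped_algebra H tau A <-> stopped_algebra G (inverse_at tau) A.
Proof.
move=> st; split=> hA.
  by split; [case: hA|apply: (stopped_of_lt fG) => v v0; exact: stopped_inverse_lt].
split; first by case: hA.
move=> t t0; split.
  apply: measurableI; first by case: hA.
  exact: (filtration_measurable changed_filtrationP t0 (st.2 _ t0)).
move=> u u0.
rewrite (_ : _ `&` _ = (A `&` [set w | (inverse_at tau w <= u%:E)%E]) `&`
   ([set w | (tau w <= t%:E)%E] `&` [set w | (inverse_at (fun=> t%:E) w <= u%:E)%E])).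
  apply: (salgI (filtration_salg fG u0)); first exact: hA.2.
  by case: (st.2 _ t0) => _; exact.
apply/seteqP; split => w; last by move=> [[Aw h1] [h2 h3]].
move=> [[Aw h2] h3]; split => //; split => //=; apply: le_trans h3.
move: h2 (st.1 w); rewrite /inverse_at /=; case: (tau w) => [r| |]//.
by rewrite !lee_fin => rt r0; exact: (le_path_inverse rate_g (aX w)).
Qed.

Lemma time_change_fin tau w (t : R) : tau w = t%:E ->
  (inverse_at tau w < +oo)%E -> time_change t w = X (fine (inverse_at tau w)) w.
Proof.
rewrite /inverse_at /time_change /path_time_change => ->.
by have := @path_inverse_ge0 _ _ g (X ^~ w) t; case: (path_inverse _ _ _).
Qed.

Lemma time_change_del tau w (t : R) : tau w = t%:E ->
  inverse_at tau w = +oo%E -> time_change t w = del.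
Proof. by rewrite /inverse_at /time_change /path_time_change => -> ->. Qed.

Lemma stopped_time_change tau B : cozero_space R T -> stopping_time H tau ->
  borel T B ->
  stopped_algebra H tau [set w | (tau w < +oo)%E /\ B (time_change (fine (tau w)) w)].
Proof.
move=> coz st bB; have stG := stopping_inverse st.
have S := stopped_salg fG stG; have SH := stopped_salg changed_filtrationP st.
have finH := stopped_algebra_fin changed_filtrationP st.
have finG := stopped_algebra_fin fG stG.
rewrite (_ : [set _ | _] =
    [set w | (inverse_at tau w < +oo)%E /\ B (X (fine (inverse_at tau w)) w)] `|`
    ([set w | (tau w < +oo)%E] `&` ~` [set w | (inverse_at tau w < +oo)%E] `&` [set _ | B del])).
  apply: (salgU SH.1).
    by apply/(stopped_inverse _ st); exact: (stopped_process sm).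
  apply: (salgI SH.1).
    apply: (salgI SH.1) => //; apply: (salgC SH.1).
    exact/(stopped_inverse _ st).
  have [Bd|Bd] := pselect (B del).
    by rewrite (_ : [set _ | _] = setT); [exact: salgT SH.1|apply/seteqP; split].
  by rewrite (_ : [set _ | _] = set0); [exact: salg0 SH.1|rewrite -subset0].
apply/seteqP; split => w /=.
  move=> [tw]; have := st.1 w; case E : (tau w) tw => [t| |]// _ _ /= Bt.
  have [h|] := ltP (inverse_at tau w) +oo%E.
    by left; split => //; rewrite -(time_change_fin E).
  rewrite leye_eq => /eqP h; right; split.
    by rewrite /= ltry; split.
  by rewrite -(time_change_del E h).
move=> [[h Bw]|[[tw /negP]]].
  have [t E] : exists t, tau w = t%:E.
    by move: h (st.1 w); rewrite /inverse_at; case: (tau w) => // t _ _; exists t.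
  by rewrite E ltry; split => //=; rewrite (time_change_fin E).
rewrite -leNgt leye_eq => /eqP h Bd; split => //.
move: tw (st.1 w); case E : (tau w) => [t| |]// _ _ /=.
by rewrite (time_change_del E h).
Qed.

End time_changed_filtration.

(** * Disintegration *)

Section restricted_subprobability.
Context {d : measure_display} {W : measurableType d} {R : realType}.
Variables (P : probability W R) (A : set W) (mA : measurable A).

Let restr_le1 : (mrestr P mA setT <= 1)%E.
Proof. by rewrite /mrestr; apply: probability_le1; exact: measurableI. Qed.

HB.instance Definition _ :=
  Measure_isSubProbability.Build _ _ _ (mrestr P mA) restr_le1.

(** Restriction to an event leaves a mass of at most 1, so that the operations of the Giry monad
    apply to the part of [P] carried by the event. *)
Definition restricted_subprobability : giry W R := mrestr P mA.

End restricted_subprobability.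

Lemma integral_restricted d (W : measurableType d) (R : realType)
    (P : {measure set W -> \bar R}) (A : set W) (mA : measurable A) (h : W -> \bar R) :
  measurable_fun setT h -> (forall w, 0 <= h w)%E ->
  (\int[mrestr P mA]_w h w = \int[P]_(w in A) h w)%E.
Proof.
move=> mh h0; rewrite -(setUv A) ge0_integral_setU//.
- rewrite [X in (_ + X)%E]null_set_integral//.
  + rewrite adde0; apply: eq_measure_integral => B mB BA.
    by rewrite -[LHS]/(P (B `&` A)) (setIidl BA).
  + exact: measurableC.
  + exact: measurable_funTS.
  + by rewrite -[LHS]/(P (~` A `&` A)) setICl measure0.
- exact: measurableC.
- by rewrite setUv.
- by apply/disj_setPS; rewrite setICr.
Qed.

Lemma measurable_fun_extend d d' (W : measurableType d) (T : measurableType d')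
    (D : set W) (f : W -> T) (c : T) : measurable D -> measurable_fun D f ->
  measurable_fun setT (fun w => if w \in D then f w else c).
Proof.
move=> mD mf _ B mB; rewrite setTI.
rewrite (_ : _ @^-1` B = (D `&` f @^-1` B) `|` (~` D `&` [set _ | B c])).
  apply: measurableU; first exact: mf.
  apply: measurableI; first exact: measurableC.
  have [Bc|Bc] := pselect (B c).
    by rewrite (_ : [set _ | _] = setT)//; apply/seteqP; split.
  by rewrite (_ : [set _ | _] = set0)// -subset0.
apply/seteqP; split => w /=.
  by case: ifPn => [/set_mem|/negP/(contra_not mem_set)]; [left|right].
by move=> [[/mem_set -> //]|[Dw Bc]]; case: ifPn => // /set_mem.
Qed.

Section disintegration.
Context {R : realType} {d d2 d3 : measure_display}.
Context {W : measurableType d} {T : measurableType d2} {V : measurableType d3}.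
Variables (Q : W -> probability V R) (eta : V -> T).
Hypothesis meta : measurable_fun setT eta.

Section total.
Hypothesis mQ : forall B, measurable B ->
  measurable_fun setT (fun w => Q w (eta @^-1` B)).

Let kappa (w : W) : giry T R := giry_map meta (Q w : giry V R).

Let mkappa : measurable_fun setT kappa.
Proof. by apply: measurable_giry_codensity => // B mB; exact: mQ. Qed.

Let kappaE w (f : T -> \bar R) : measurable_fun setT f -> (forall x, 0 <= f x)%E ->
  giry_int (kappa w) f = (\int[Q w]_v f (eta v))%E.
Proof. by move=> mf f0; rewrite giry_int_map. Qed.

Lemma measurable_kernel_integral (f : T -> \bar R) :
  measurable_fun setT f -> (forall x, 0 <= f x)%E ->
  measurable_fun setT (fun w => \int[Q w]_v f (eta v))%E.
Proof.
move=> mf f0; have := measurableT_comp (measurable_giry_int mf f0) mkappa.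
by apply: eq_measurable_fun => w _ /=; exact: kappaE.
Qed.

(** The hypothesis on sets says that the law of [xi] under [P] restricted to [A] is the bind, in the
    Giry monad, of this restriction with the kernel sending [w] to the law of [eta] under [Q w].
    Integrating [f] against both expressions gives the claim. *)
Lemma disintegration (P : probability W R) (A : set W) (xi : W -> T) (f : T -> \bar R) :
  measurable A -> measurable_fun setT xi ->
  (forall B, measurable B ->
    P (A `&` xi @^-1` B) = \int[P]_(w in A) Q w (eta @^-1` B))%E ->
  measurable_fun setT f -> (forall x, 0 <= f x)%E ->
  (\int[P]_(w in A) f (xi w) = \int[P]_(w in A) \int[Q w]_v f (eta v))%E.
Proof.
move=> mA mxi PQ mf f0; pose mu := restricted_subprobability P mA.
have muE (h : W -> \bar R) : measurable_fun setT h -> (forall w, 0 <= h w)%E ->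
    giry_int mu h = (\int[P]_(w in A) h w)%E.
  exact: integral_restricted.
transitivity (giry_int (giry_map mxi mu) f).
  rewrite giry_int_map// muE//; last by move=> w; exact: f0.
  exact: measurableT_comp.
transitivity (giry_int (giry_bind mu mkappa) f).
  apply: eq_measure_integral => B mB _.
  transitivity (P (A `&` xi @^-1` B)); first by rewrite setIC.
  rewrite PQ// -muE//; last exact: mQ.
  transitivity (giry_int (giry_map mkappa mu) (giry_ev ^~ B)); last by [].
  by rewrite giry_int_map//; exact: measurable_giry_ev.
rewrite giry_int_bind// muE.
- by apply: eq_integral => w _; exact: kappaE.
- exact: measurableT_comp (measurable_giry_int mf f0) mkappa.
- by move=> w; exact: integral_ge0.
Qed.
End total.
End disintegration.

Section disintegration_on.
Context {R : realType} {d d2 d3 : measure_display}.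
Context {W : measurableType d} {T : measurableType d2} {V : measurableType d3}.
Variables (Q : W -> probability V R) (eta : V -> T).
Hypothesis meta : measurable_fun setT eta.
Variable D : set W.
Hypotheses (mD : measurable D) (mQ : forall B, measurable B ->
  measurable_fun D (fun w => Q w (eta @^-1` B))).

(** The kernel is measurable only on [D], the event that a time is finite or that a state is alive;
    a fixed law elsewhere makes it measurable everywhere. *)
Let Q' (w : W) : probability V R := if w \in D then Q w else Q point.

Let mQ' B : measurable B -> measurable_fun setT (fun w => Q' w (eta @^-1` B)).
Proof.
move=> mB; apply: (eq_measurable_fun
  (fun w => if w \in D then Q w (eta @^-1` B) else Q point (eta @^-1` B))).
  by move=> w _; rewrite /Q'; case: ifP.
by apply: measurable_fun_extend => //; exact: mQ.
Qed.

Lemma measurable_kernel_integral_on (f : T -> \bar R) :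
  measurable_fun setT f -> (forall x, 0 <= f x)%E ->
  measurable_fun D (fun w => \int[Q w]_v f (eta v))%E.
Proof.
move=> mf f0.
have := measurable_funTS (D := D) (measurable_kernel_integral meta mQ' mf f0).
by apply: eq_measurable_fun => w wD; rewrite /Q' wD.
Qed.

Lemma disintegration_on (P : probability W R) (A : set W) (xi : W -> T) (f : T -> \bar R) :
  measurable A -> A `<=` D -> measurable_fun D xi ->
  (forall B, measurable B ->
    P (A `&` xi @^-1` B) = \int[P]_(w in A) Q w (eta @^-1` B))%E ->
  measurable_fun setT f -> (forall x, 0 <= f x)%E ->
  (\int[P]_(w in A) f (xi w) = \int[P]_(w in A) \int[Q w]_v f (eta v))%E.
Proof.
move=> mA AD mxi PQ mf f0.
pose xi' (w : W) : T := if w \in D then xi w else point.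
have inD w : w \in A -> w \in D by rewrite !inE; exact: AD.
have mxi' : measurable_fun setT xi' by exact: measurable_fun_extend.
transitivity (\int[P]_(w in A) f (xi' w))%E.
  by apply: eq_integral => w wA; rewrite /xi' inD.
transitivity (\int[P]_(w in A) \int[Q' w]_v f (eta v))%E; last first.
  by apply: eq_integral => w wA; rewrite /Q' inD.
apply: (disintegration meta mQ') => // B mB.
rewrite (_ : A `&` xi' @^-1` B = A `&` xi @^-1` B); last first.
  by apply/seteqP; split => w [Aw]; rewrite /= /xi' inD ?inE.
by rewrite PQ//; apply: eq_integral => w wA; rewrite /Q' inD.
Qed.

End disintegration_on.

Lemma integral_cst_probability (R : realType) d (V : measurableType d)
    (Q : probability V R) (c : R) : (\int[Q]_v cst c%:E v = c%:E)%E.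
Proof.
transitivity (c%:E * Q setT)%E; first exact: integral_cst.
by rewrite probability_setT mule1.
Qed.

Lemma integral_vanish d (W : measurableType d) (R : realType)
    (P : {measure set W -> \bar R}) (A D : set W) (g : W -> \bar R) :
  (forall w, ~ D w -> g w = 0%E) ->
  (\int[P]_(w in A) g w = \int[P]_(w in A `&` D) g w)%E.
Proof.
move=> g0; rewrite [LHS]integral_mkcond [RHS]integral_mkcond.
apply: eq_integral => w _; rewrite !patchE in_setI.
by case: (w \in A) => //=; case: ifPn => // /negP/(contra_not mem_set)/g0.
Qed.

(** Passage from an identity between probabilities of events to the conditional expectation of a
    bounded function. Both the strong Markov property of a time change and the additivity of a MAP
    are obtained through it. *)
Lemma condexp_of_kernel (R : realType) d (W : measurableType d) d2 (T : measurableType d2)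
    d3 (V : measurableType d3) (Q : W -> probability V R) (eta : V -> T)
    (P : probability W R) (F : set_system W) (D : set W) (xi : W -> T) (f : T -> R)
    (M : R) (Uf Vf : W -> \bar R) :
  Defs.sub_sigma_algebra F -> F D ->
  measurable_fun setT eta -> measurable_fun D xi ->
  (forall B Y, measurable B -> measurable Y ->
    F (D `&` (fun w => Q w (eta @^-1` B)) @^-1` Y)) ->
  (forall L B, F L -> measurable B ->
    P ((L `&` D) `&` xi @^-1` B) = \int[P]_(w in L `&` D) Q w (eta @^-1` B))%E ->
  measurable_fun setT f -> (forall x, `|f x| <= M) ->
  (forall w, D w -> Uf w = (f (xi w))%:E) -> (forall w, ~ D w -> Uf w = 0%E) ->
  (forall w, D w -> Vf w = 'E_(Q w)[fun v => f (eta v)]%E) ->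
  (forall w, ~ D w -> Vf w = 0%E) ->
  is_condexp P F Uf Vf.
Proof.
move=> [HF Fm] FD meta mxi FQ PQ mf fM UD UDC VD VDC.
have mD := Fm _ FD.
(* Disintegration is available for nonnegative functions, and [f + M] lies between 0 and [M + M];
   the constant is subtracted again at the end. *)
pose h (x : T) : \bar R := (f x + M)%:E.
have h0 x : (0 <= h x)%E.
  by rewrite lee_fin; have := fM x; rewrite ler_norml => /andP[+ _]; rewrite -lerBlDr sub0r.
have M0 : 0 <= M by apply: le_trans (fM point).
have hM x : (h x <= (M + M)%:E)%E.
  by rewrite lee_fin lerD2r; have := fM x; rewrite ler_norml => /andP[].
have mh : measurable_fun setT h by apply/measurable_EFinP/measurable_funD.
have mQF B : measurable B ->
    measurable_fun (D : set (salg (point : W) HF)) (fun w => Q w (eta @^-1` B)).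
  by move=> mB _ Y mY; exact: FQ.
have mQ B : measurable B -> measurable_fun D (fun w => Q w (eta @^-1` B)).
  by move=> mB _ Y mY; apply: Fm; exact: FQ.
pose k w : \bar R := (\int[Q w]_v h (eta v))%E.
have mhe : measurable_fun setT (h \o eta) by exact: measurableT_comp.
(* Measurability with respect to [F] itself, as a version of the conditional expectation requires;
   [mk] is its counterpart for integration against [P]. *)
have mkF := @measurable_kernel_integral_on R _ _ _ (salg (point : W) HF) T V
  Q eta meta D FD mQF h mh h0.
have mk := measurable_kernel_integral_on meta mD mQ mh h0.
have k0 w : (0 <= k w)%E by apply: integral_ge0.
have kM w : (k w <= (M + M)%:E)%E.
  apply: (@le_trans _ _ (\int[Q w]_v cst (M + M)%:E v)%E).
    exact: ge0_le_integral.
  by rewrite integral_cst_probability.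
have Vk w : D w -> Vf w = (k w - M%:E)%E.
  move=> Dw; rewrite VD// unlock.
  transitivity (\int[Q w]_v (h (eta v) - M%:E))%E.
    by apply: eq_integral => v _; rewrite /h EFinD addeK.
  rewrite integralB//.
  - by rewrite integral_cst_probability.
  - apply: (@le_integrable _ _ _ _ _ _ _ (cst (M + M)%:E)) => //.
      move=> v _; rewrite [leLHS]gee0_abs; last exact: h0.
      exact: le_trans (hM _) (lee_abs _).
    by apply: finite_measure_integrable_cst.
  - by apply: finite_measure_integrable_cst.
have mU : measurable_fun setT Uf.
  apply: (eq_measurable_fun (fun w => if w \in D then (f (xi w))%:E else 0%E)).
    by move=> w _; case: ifPn => [/set_mem/UD //|/negP/(contra_not mem_set)/UDC].
  apply: measurable_fun_extend => //.
  by apply/measurable_EFinP; exact: measurable_comp measurableT _ mf mxi.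
have mVF : measurable_fun (setT : set (salg (point : W) HF)) Vf.
  have /= := @measurable_fun_extend _ _ (salg (point : W) HF) _ D _ 0%E FD
    (emeasurable_funB mkF (@measurable_cst _ _ _ _ _ M%:E)).
  apply: eq_measurable_fun => w _.
  by case: ifPn => [/set_mem/Vk //|/negP/(contra_not mem_set)/VDC].
have mV : measurable_fun setT Vf.
  by move=> _ Y mY; apply: Fm; exact: mVF.
have bound (g : W -> \bar R) : measurable_fun setT g ->
    (forall w, `|g w| <= M%:E)%E -> P.-integrable setT g.
  move=> mg gM; apply: (@le_integrable _ _ _ _ _ _ _ (cst M%:E)) => //.
    by move=> w _; rewrite /= ger0_norm.
  exact: finite_measure_integrable_cst.
split.
- apply: bound => // w; have [Dw|Dw] := pselect (D w).
    by rewrite UD// lee_fin.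
  by rewrite UDC// abse0 lee_fin.
- apply: bound => // w; have [Dw|Dw] := pselect (D w).
    rewrite Vk//; move: (k0 w) (kM w); case: (k w) => [r| |]//.
    by rewrite !lee_fin ler_norml => r0 rM; apply/andP; split; lra.
  by rewrite VDC// abse0 lee_fin.
- by move=> B mB; have := mVF measurableT B mB; rewrite setTI.
- move=> A FA; have mA := Fm _ FA.
  have mAD : measurable (A `&` D) by exact: measurableI.
  rewrite (integral_vanish P A UDC) (integral_vanish P A VDC).
  have hb (g : W -> \bar R) : measurable_fun (A `&` D) g ->
     (forall w, 0 <= g w)%E -> (forall w, g w <= (M + M)%:E)%E ->
     P.-integrable (A `&` D) g.
    move=> mg g0 gM; apply: (@le_integrable _ _ _ _ _ _ _ (cst (M + M)%:E)) => //.
      by move=> v _; rewrite [leLHS]gee0_abs//; exact: le_trans (gM _) (lee_abs _).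
    exact: finite_measure_integrable_cst.
  have mxiAD : measurable_fun (A `&` D) xi.
    by apply: measurable_funS mxi.
  transitivity (\int[P]_(w in A `&` D) (h (xi w) - M%:E))%E.
    by apply: eq_integral => w /set_mem[_ Dw]; rewrite UD// /h EFinD addeK.
  transitivity (\int[P]_(w in A `&` D) (k w - M%:E))%E; last first.
    by apply: eq_integral => w /set_mem[_ Dw]; rewrite Vk.
  rewrite integralB//; first last.
  + exact: finite_measure_integrable_cst.
  + apply: hb => //; exact: measurable_comp measurableT _ mh mxiAD.
  rewrite integralB//; first last.
  + exact: finite_measure_integrable_cst.
  + by apply: hb => //; apply: measurable_funS mk.
  congr (_ - _)%E; apply: (disintegration_on meta mD mQ) => //.
  by move=> B mB; exact: PQ.
Qed.

Lemma dynkin_class (Z : Type) (S H : set_system Z) : setI_closed S -> dynkin H ->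
  S `<=` H -> <<s S >> `<=` H.
Proof.
move=> SI dH SH; rewrite -setI_closed_g_dynkin_g_sigma_algebra//.
exact: smallest_sub.
Qed.

Lemma trivIset_preimage (aT rT I : Type) (D : set I) (f : aT -> rT) (F : I -> set rT) :
  trivIset D F -> trivIset D (fun i => f @^-1` F i).
Proof. by move=> tF i j Di Dj [x [Fi Fj]]; apply: tF => //; exists (f x). Qed.

Section dynkin_disintegration.
Context {R : realType} {d d' : measure_display} {W : measurableType d}.
Context {V : measurableType d'} {Z : Type}.
Variables (S : set_system Z) (Q : W -> probability V R) (eta : W -> V -> Z).
Hypotheses (SI : setI_closed S) (meta : forall w C, <<s S >> C -> measurable (eta w @^-1` C)).

Let sC C : <<s S >> C -> <<s S >> (~` C).
Proof. by rewrite -setTD; exact: sigma_algebraCD. Qed.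

Let sU (F : (set Z)^nat) : (forall n, <<s S >> (F n)) -> <<s S >> (\bigcup_n F n).
Proof. exact: sigma_algebra_bigcup. Qed.

Let sT : <<s S >> setT.
Proof. by have := sC (@sigma_algebra0 _ setT S); rewrite setC0. Qed.

Let QC C w : <<s S >> C ->
  (Q w (eta w @^-1` (~` C)) = 1 - Q w (eta w @^-1` C))%E.
Proof. by move=> sSC; rewrite preimage_setC probability_setC//; exact: meta. Qed.

Let QU F w : trivIset setT F -> (forall n, <<s S >> (F n)) ->
  (Q w (eta w @^-1` (\bigcup_n F n)) = \sum_(0 <= n <oo) Q w (eta w @^-1` F n))%E.
Proof.
move=> tF sF; rewrite preimage_bigcup measure_semi_bigcup//.
- by move=> n; exact: meta.
- exact: trivIset_preimage.
- by apply: bigcupT_measurable => n; exact: meta.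
Qed.

(** The map [eta w] depends on [w] so that a quantity known at the present time can be paired with
    the state of a fresh copy of the process. *)
Lemma measurable_dynkin_kernel (A : set W) : measurable A ->
  (forall C, S C -> measurable_fun A (fun w => Q w (eta w @^-1` C))) ->
  forall C, <<s S >> C -> measurable_fun A (fun w => Q w (eta w @^-1` C)).
Proof.
move=> mA mQ C sSC.
suff : <<s S >> `<=` [set C | <<s S >> C /\ measurable_fun A (fun w => Q w (eta w @^-1` C))].
  by move=> /(_ C sSC)[].
apply: dynkin_class => //; last first.
  by move=> D SD; split; [exact: sub_sigma_algebra|exact: mQ].
split.
- split => //; apply: (eq_measurable_fun (cst 1%E)) => // w _.
  by rewrite preimage_setT probability_setT.
- move=> D [sD mD]; split; first exact: sC.
  apply: (eq_measurable_fun (fun w => 1 - Q w (eta w @^-1` D))%E).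
    by move=> w _; rewrite QC.
  by apply: emeasurable_funB.
- move=> F tF sF; split; first by apply: sU => n; case: (sF n).
  apply: (eq_measurable_fun (fun w => \sum_(0 <= n <oo) Q w (eta w @^-1` F n))%E).
    by move=> w _; rewrite QU// => n; case: (sF n).
  by apply: ge0_emeasurable_sum => // n _; case: (sF n).
Qed.

Lemma dynkin_disintegration (P : probability W R) (A : set W) (Y : W -> Z) :
  measurable A -> (forall C, <<s S >> C -> measurable (A `&` Y @^-1` C)) ->
  (forall C, <<s S >> C -> measurable_fun A (fun w => Q w (eta w @^-1` C))) ->
  (forall C, S C -> P (A `&` Y @^-1` C) = \int[P]_(w in A) Q w (eta w @^-1` C))%E ->
  forall C, <<s S >> C -> (P (A `&` Y @^-1` C) = \int[P]_(w in A) Q w (eta w @^-1` C))%E.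
Proof.
move=> mA mY mQ PQ C sSC.
suff : <<s S >> `<=` [set C | <<s S >> C /\
    (P (A `&` Y @^-1` C) = \int[P]_(w in A) Q w (eta w @^-1` C))%E].
  by move=> /(_ C sSC)[].
have iQ D : <<s S >> D -> P.-integrable A (fun w => Q w (eta w @^-1` D)).
  move=> sD; apply: (@le_integrable _ _ _ _ _ _ _ (cst 1%E)) => //.
  - exact: mQ.
  - by move=> w _; rewrite [leLHS]gee0_abs// abse1; apply: probability_le1; exact: meta.
  - exact: finite_measure_integrable_cst.
have PA : (\int[P]_(w in A) cst 1%E w = P A)%E by rewrite integral_cst// mul1e.
apply: dynkin_class => //; last first.
  by move=> D SD; split; [exact: sub_sigma_algebra|exact: PQ].
split.
- split => //; rewrite preimage_setT setIT -PA.
  by apply: eq_integral => w _; rewrite preimage_setT probability_setT.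
- move=> D [sD PD]; split; first exact: sC.
  transitivity (\int[P]_(w in A) (cst 1 w - Q w (eta w @^-1` D)))%E; last first.
    by apply: eq_integral => w _; rewrite QC.
  rewrite integralB//; [|exact: finite_measure_integrable_cst|exact: iQ].
  rewrite PA -PD preimage_setC -setDE (_ : A `\` _ = A `\` (A `&` Y @^-1` D)); last first.
    by rewrite setDIr setDv set0U.
  rewrite measureD//; [|exact: mY|exact: le_lt_trans (probability_le1 P mA) (ltry 1)].
  by rewrite setIA setIid.
- move=> F tF sF; split; first by apply: sU => n; case: (sF n).
  transitivity (\int[P]_(w in A) \sum_(0 <= n <oo) Q w (eta w @^-1` F n))%E; last first.
    by apply: eq_integral => w _; rewrite QU// => n; case: (sF n).
  rewrite integral_nneseries//; last by move=> n; apply: mQ; case: (sF n).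
  rewrite preimage_bigcup setI_bigcupr measure_semi_bigcup//.
  - by apply: eq_eseriesr => n _; case: (sF n).
  - by move=> n; apply: mY; case: (sF n).
  - by apply: trivIset_setIl; exact: trivIset_preimage.
  - by apply: bigcupT_measurable => n; apply: mY; case: (sF n).
Qed.

End dynkin_disintegration.

(** * The Markov property on path space *)

Section cylinders.
Context {R : realType} {T : topologicalType}.

Definition cylinder (s : seq (R * set T)) : set (R -> T) :=
  [set p | forall tb, tb \in s -> tb.2 (p tb.1)].

Definition cylinders : set_system (R -> T) :=
  [set C | exists2 s, (forall tb, tb \in s -> 0 <= tb.1 /\ borel T tb.2) & C = cylinder s].

Lemma cylinders_setI : setI_closed cylinders.
Proof.
move=> _ _ [s hs ->] [r hr ->]; exists (s ++ r).
  by move=> tb; rewrite mem_cat => /orP[/hs|/hr].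
apply/seteqP; split => p /=.
  by move=> [ps pr] tb; rewrite mem_cat => /orP[/ps|/pr].
by move=> h; split => tb htb; apply: h; rewrite mem_cat htb ?orbT.
Qed.

Lemma path_events_cylinders (C : set (R -> T)) : path_events C -> <<s cylinders >> C.
Proof.
apply: smallest_sub; first exact: smallest_sigma_algebra.
move=> _ [t [B [t0 bB ->]]]; apply: sub_sigma_algebra.
exists [:: (t, B)]; first by move=> tb; rewrite inE => /eqP ->.
apply/seteqP; split => p /=.
  by move=> Bp tb; rewrite inE => /eqP ->.
by move=> /(_ (t, B)); apply; rewrite inE.
Qed.

Lemma cylinder0 : cylinder [::] = setT.
Proof. by apply/seteqP; split. Qed.

Lemma cylinder_cons (t : R) (B : set T) (s : seq (R * set T)) (p : R -> T) :
  cylinder ((t, B) :: s) p <->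
  B (p t) /\ cylinder [seq (u.1 - t, u.2) | u <- s] (fun r => p (t + r)).
Proof.
split=> [h|[Bp h] tb].
  split; first by apply: (h (t, B)); rewrite inE eqxx.
  move=> _ /mapP[u us ->] /=; rewrite addrC subrK; apply: h.
  by rewrite inE us orbT.
rewrite inE => /predU1P[-> //|tbs].
have /= := h (tb.1 - t, tb.2); rewrite subrKC; apply.
by apply/mapP; exists tb.
Qed.

(** The inductions on cylinders subtract the first time from the others, and the differences have to
    remain nonnegative. *)
Lemma cylinder_sort (s : seq (R * set T)) :
  exists r, cylinder s = cylinder r /\ size r = size s /\ (forall tb, tb \in s = (tb \in r)) /\
  forall t B r', r = (t, B) :: r' -> forall u, u \in r' -> t <= u.1.
Proof.
pose le (a b : R * set T) := a.1 <= b.1.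
have le_tot : total le by move=> a b; exact: le_total.
have le_tr : transitive le by move=> a b c; exact: le_trans.
exists (sort le s); split; last split; last split.
- by apply/seteqP; split => p h tb htb; apply: h; move: htb; rewrite mem_sort.
- exact: size_sort.
- by move=> tb; rewrite mem_sort.
- move=> t B r' E u ur; have := sort_sorted le_tot s; rewrite E /= (path_sortedE le_tr).
  by move=> /andP[/allP/(_ u ur)].
Qed.

Lemma measurable_cylinders d (W : measurableType d) (Y : R -> W -> T) :
  (forall r, 0 <= r -> forall B, borel T B -> measurable (Y r @^-1` B)) ->
  forall C, <<s cylinders >> C -> measurable [set w | C (Y ^~ w)].
Proof.
move=> mY; apply: smallest_sub.
  split=> [|A /= mA|A /= mA].
  - by rewrite (_ : [set _ | _] = set0).
  - rewrite (_ : [set _ | _] = ~` [set w | A (Y ^~ w)]); first exact: measurableC.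
    by apply/seteqP; split => w; [case|split].
  - rewrite (_ : [set _ | _] = \bigcup_n [set w | A n (Y ^~ w)]).
      exact: bigcupT_measurable.
    by apply/seteqP; split => w [n _ h]; exists n.
move=> _ [s hs ->] /=.
elim: s hs => [|[t B] s IH] hs.
  by rewrite cylinder0 (_ : [set _ | _] = setT).
rewrite (_ : [set _ | _] = (Y t @^-1` B) `&` [set w | cylinder s (Y ^~ w)]).
  apply: measurableI; last by apply: IH => tb h; apply: hs; rewrite inE h orbT.
  by have [t0 bB] := hs (t, B) ltac:(by rewrite inE eqxx); exact: mY.
apply/seteqP; split => w /=.
  by move=> h; split=> [|tb htb]; [apply: (h (t, B))|apply: h]; rewrite inE ?eqxx ?htb ?orbT.
by move=> [Bw h] tb; rewrite inE => /predU1P[->|/h].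
Qed.

End cylinders.

Section markov_path.
Context {R : realType} {d : measure_display} {Omega : measurableType d}.
Context {T : topologicalType} {del : T} {G : R -> set_system Omega}.
Context {P : T -> probability Omega R} {X : R -> Omega -> T}.
Hypotheses (sm : strong_markov del G P X) (coz : cozero_space R T).

Let fG : filtration G := sm_filtration sm.

Definition finite_time (tau : Omega -> \bar R) : set Omega := [set w | (tau w < +oo)%E].

Definition path_after (tau : Omega -> \bar R) (r : R) (w : Omega) : T :=
  if (tau w < +oo)%E then X (fine (tau w) + r) w else del.

Lemma finite_time_measurable tau : stopping_time G tau -> measurable (finite_time tau).
Proof. by move=> st; case: (stopped_algebra_fin fG st). Qed.

Lemma stopping_fin tau w : stopping_time G tau -> finite_time tau w ->
  exists2 t : R, tau w = t%:E & 0 <= t.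
Proof.
move=> [tau0 _]; rewrite /finite_time /=; have := tau0 w.
by case: (tau w) => [t| |]// t0 _; exists t.
Qed.

Lemma finite_timeD tau (s : R) : stopping_time G tau ->
  finite_time (fun w => tau w + s%:E)%E = finite_time tau.
Proof.
move=> st; apply/seteqP; split => w /=; rewrite /finite_time /=.
  by have := st.1 w; case: (tau w) => [t| |]//; rewrite ?ltry ?addye ?ltxx.
by move=> /(stopping_fin st)[t -> _]; rewrite -EFinD ltry.
Qed.

Lemma path_after_measurable tau r B : stopping_time G tau -> 0 <= r -> borel T B ->
  measurable (path_after tau r @^-1` B).
Proof.
move=> st r0 bB; have str := stopping_timeD fG st r0.
have [m1 _] := stopped_process sm coz str bB.
have mf := finite_time_measurable st.
rewrite (_ : _ @^-1` B = [set w | (tau w + r%:E < +oo)%E /\ B (X (fine (tau w + r%:E)%E) w)]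
  `|` (~` finite_time tau `&` [set _ | B del])).
  apply: measurableU => //; apply: measurableI; first exact: measurableC.
  have [Bc|Bc] := pselect (B del).
    by rewrite (_ : [set _ | _] = setT)//; apply/seteqP; split.
  by rewrite (_ : [set _ | _] = set0)// -subset0.
apply/seteqP; split => w /=; rewrite /path_after /finite_time /=.
  case: ifPn => [h|h Bd]; last by right; split => //; exact/negP.
  by have [t -> t0] := stopping_fin st h => Bw; left; rewrite /= ltry.
move=> [[h]|[/negP/negbTE -> //]].
have : finite_time tau w by rewrite -(finite_timeD r st).
by move: h => /[swap] /(stopping_fin st)[t -> t0]; rewrite /= !ltry.
Qed.

Lemma transition_measurable (s : R) B : 0 <= s -> borel T B ->
  measurable_fun (setT : set (borelType del)) (fun x => P x (X s @^-1` B)).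
Proof. by move=> s0 bB; apply/borel_fun_measurable; exact: (sm_kernel sm). Qed.

Lemma state_measurable (s : R) : 0 <= s ->
  measurable_fun setT (X s : Omega -> borelType del).
Proof. by move=> s0 _ B bB; rewrite setTI; exact: (process_measurable sm). Qed.

Lemma stopped_state_measurable tau : stopping_time G tau ->
  measurable_fun (finite_time tau) ((fun w => X (fine (tau w)) w) : Omega -> borelType del).
Proof.
move=> st _ B bB; have [m1 _] := stopped_process sm coz st bB.
by move: m1; congr measurable.
Qed.

Lemma markov_integral tau (L : set Omega) (s : R) (u : T -> R) x :
  stopping_time G tau -> stopped_algebra G tau L -> 0 <= s ->
  borel_fun u -> (forall y, 0 <= u y <= 1) ->
  (\int[P x]_(w in L `&` finite_time tau) (u (X (fine (tau w) + s) w))%:E =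
   \int[P x]_(w in L `&` finite_time tau)
     \int[P (X (fine (tau w)) w)]_v (u (X s v))%:E)%E.
Proof.
move=> st hL s0 bu u01.
have uM : exists M : R, forall y, `|u y| <= M.
  by exists 1 => y; have /andP[u0 u1] := u01 y; rewrite ger0_norm.
have [_ _ _ /(_ L hL)] := sm_markov sm st bu uM s0 x.
rewrite (@integral_vanish _ _ _ _ _ (finite_time tau)) => [|w]; last first.
  by rewrite /finite_time /=; case: (tau w) => // t; rewrite ltry.
rewrite [RHS](@integral_vanish _ _ _ _ _ (finite_time tau)) => [|w]; last first.
  by rewrite /finite_time /=; case: (tau w) => // t; rewrite ltry.
move=> E; transitivity (\int[P x]_(w in L `&` finite_time tau)
    (if tau w is t%:E then (u (X (t + s) w))%:E else 0))%E.
  by apply: eq_integral => w /set_mem[_ /(stopping_fin st)[t -> _]].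
rewrite E; apply: eq_integral => w /set_mem[_ /(stopping_fin st)[t -> _]].
by rewrite unlock.
Qed.

(** The two statements are proved together: the Markov identity for [n + 1] times integrates a
    function built from the kernel of [n] times, which must be measurable. *)
Let claim (C : set (R -> T)) : Prop :=
  measurable_fun (setT : set (borelType del)) (fun x => P x [set w | C (X ^~ w)]) /\
  forall tau (L : set Omega) x, stopping_time G tau -> stopped_algebra G tau L ->
    (P x ((L `&` finite_time tau) `&` [set w | C (path_after tau ^~ w)]) =
     \int[P x]_(w in L `&` finite_time tau)
       P (X (fine (tau w)) w) [set v | C (X ^~ v)])%E.

Let path_afterD tau (t : R) w : stopping_time G tau -> 0 <= t ->
  (fun r => path_after tau (t + r) w) =
  path_after (fun w => tau w + t%:E)%E ^~ w.
Proof.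
move=> st t0; apply/funext => r; rewrite /path_after.
have := finite_timeD t st; move/seteqP => [h1 h2].
case: ifPn => h; last first.
  by rewrite ifF//; apply/negP => /h1 h'; move: h; rewrite h'.
rewrite (_ : (_ < _)%E = true); last exact: h2.
by have [u -> u0] := stopping_fin st h; rewrite /= addrA.
Qed.

Let mcyl (s : seq (R * set T)) :
  (forall tb, tb \in s -> 0 <= tb.1 /\ borel T tb.2) ->
  measurable [set w | cylinder s (X ^~ w)].
Proof.
move=> hs; apply: measurable_cylinders; first by move=> r r0 B bB; exact: (process_measurable sm).
by apply: sub_sigma_algebra; exists s.
Qed.

Lemma markov_cylinder (n : nat) (s : seq (R * set T)) : size s = n ->
  (forall tb, tb \in s -> 0 <= tb.1 /\ borel T tb.2) -> claim (cylinder s).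
Proof.
elim: n s => [|n IH] s.
  move=> /size0nil -> _; rewrite cylinder0; split.
    by apply: (eq_measurable_fun (cst 1%E)) => // x _; rewrite probability_setT.
  move=> tau L x st [mL _].
  rewrite (_ : [set _ | _] = setT) ?setIT//.
  rewrite -[LHS]mul1e -integral_cst; last first.
    by apply: measurableI => //; exact: finite_time_measurable.
  by apply: eq_integral => w _; rewrite probability_setT.
have [r [-> [<- [sr]]]] := cylinder_sort s.
case: r sr => [|[t B] r]// sr /(_ _ _ _ erefl) tr [/= sz] hs.
have [t0 bB] := hs (t, B) ltac:(by rewrite sr inE eqxx).
set r' := [seq (u.1 - t, u.2) | u <- r].
have hr' tb : tb \in r' -> 0 <= tb.1 /\ borel T tb.2.
  move=> /mapP[u ur ->] /=; rewrite subr_ge0; split; first exact: tr.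
  by have [] := hs u ltac:(by rewrite sr inE ur orbT).
have {IH} [mr' IH] := IH r' ltac:(by rewrite size_map) hr'.
(* The probability, from [y], that [y] lies in [B] and that the remaining constraints hold, with
   times counted from [t]. *)
pose u (y : T) : R := fine (P y [set w | cylinder r' (X ^~ w)]) * \1_B y.
have uE y : ((u y)%:E = P y [set w | cylinder r' (X ^~ w)] * (\1_B y)%:E)%E.
  by rewrite /u EFinM fineK// fin_num_measure//; exact: mcyl.
have u01 y : 0 <= u y <= 1.
  rewrite -!lee_fin uE indicE; case: (y \in B); rewrite ?mule1 ?mule0 ?lexx ?lee_fin ?ler01//.
  by rewrite measure_ge0/=; apply: probability_le1; exact: mcyl.
have mu : measurable_fun (setT : set (borelType del)) u.
  by apply: measurable_funM; [exact: measurableT_comp|exact: measurable_indic].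
have bu : borel_fun u by apply/(borel_fun_measurable del).
have step tau L x : stopping_time G tau -> stopped_algebra G tau L ->
    (P x ((L `&` finite_time tau) `&` [set w | cylinder ((t, B) :: r) (path_after tau ^~ w)]) =
     \int[P x]_(w in L `&` finite_time tau) (u (X (fine (tau w) + t) w))%:E)%E.
  move=> st hL; have stD := stopping_timeD fG st t0.
  have SD := (stopped_salg fG stD).1.
  pose sig := (fun w => tau w + t%:E)%E.
  (* The constraint at the first time [t] is known at the stopping time [tau + t], where the
     induction hypothesis handles the remaining ones. *)
  pose L' := L `&` [set w | (sig w < +oo)%E /\ B (X (fine (sig w)) w)].
  have hL' : stopped_algebra G sig L'.
    apply: (salgI SD); last exact: (stopped_process sm coz stD bB).
    by apply: (le_stopped_algebra fG stD _ hL) => w; rewrite leeDl.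
  have := IH sig L' x stD hL'; rewrite /sig (finite_timeD t st) => IH'.
  transitivity (P x ((L' `&` finite_time tau) `&`
      [set w | cylinder r' (path_after sig ^~ w)])).
    congr (P x _); apply/seteqP; split => w.
      move=> [[Lw fw] /cylinder_cons]; rewrite path_afterD// => -[Bw cw].
      split=> //; split=> //; split => //; have [v vE v0] := stopping_fin st fw.
      by move: Bw; rewrite /sig /path_after /= vE /= !ltry; split.
    move=> [[[Lw [sw Bw]] fw] cw]; split=> //; apply/cylinder_cons; rewrite path_afterD//.
    split=> //; have [v vE v0] := stopping_fin st fw.
    by move: Bw; rewrite /sig /path_after /= vE /= !ltry.
  rewrite IH' [LHS]integral_mkcond [RHS]integral_mkcond; apply: eq_integral => w _.
  rewrite !patchE !in_setI.
  case: (boolP (w \in L)) => //= wL; case: (boolP (w \in finite_time tau)) => wf; last first.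
    by rewrite andbF.
  rewrite andbT uE; have [v vE v0] := stopping_fin st (set_mem wf).
  rewrite /sig /= vE /= indicE; case: ifPn.
    move=> /andP[_ /set_mem /=]; rewrite vE /= => /mem_set ->; by rewrite mule1.
  move=> /negP h; rewrite memNset ?mule0// => Bw; apply: h; apply/andP.
  by split; apply/mem_set => /=; rewrite vE //= ltry.
have evE x : (P x [set w | cylinder ((t, B) :: r) (X ^~ w)] =
    \int[P x]_w (u (X t w))%:E)%E.
  (* At the constant time 0, [step] computes the law of the path itself; inserted into the one-time
     Markov property at [tau], this closes the induction. *)
  have st0 := stopping_time_cst fG (lexx (0 : R)).
  have := step _ setT x st0 (salgT (stopped_salg fG st0).1).
  have fT : finite_time (fun=> 0%:E) = setT :> set Omega.
    by apply/seteqP; split => // w _; rewrite /finite_time /= ltry.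
  rewrite fT setIT setTI => E; transitivity (P x [set w |
      cylinder ((t, B) :: r) (path_after (fun=> 0%:E) ^~ w)]).
    congr (P x [set w | cylinder _ _]); apply/funext => w; apply/funext => v.
    by rewrite /path_after ltry /= add0r.
  by rewrite E; apply: eq_integral => w _ /=; rewrite add0r.
split.
- apply: (@eq_measurable_fun _ _ (borelType del) _ _
    (fun x => \int[P x]_w (u (X t w))%:E)%E) => [x _|]; first by rewrite evE.
  apply: (@measurable_kernel_integral R _ _ _ (borelType del) (borelType del) Omega P (X t)
    (state_measurable t0) _ (EFin \o u)).
  + by move=> D bD; exact: transition_measurable.
  + exact/measurable_EFinP.
  + by move=> y /=; rewrite lee_fin; have /andP[] := u01 y.
- move=> tau L x st hL; rewrite (step _ _ _ st hL) markov_integral//.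
  by apply: eq_integral => w _; rewrite evE.
Qed.

Let cyl_claim C : cylinders C -> claim C.
Proof. by move=> [s hs ->]; exact: markov_cylinder hs. Qed.

Let mX C : <<s cylinders >> C -> measurable ((fun v => X ^~ v) @^-1` C).
Proof. by apply: measurable_cylinders => r r0 B bB; exact: (process_measurable sm). Qed.

Lemma path_kernel_measurable C : path_events C ->
  measurable_fun (setT : set (borelType del)) (fun x => P x [set w | C (X ^~ w)]).
Proof.
move=> /path_events_cylinders.
apply: (measurable_dynkin_kernel (W := borelType del) (eta := fun _ v => X ^~ v)
  cylinders_setI (fun=> mX)) => //.
by move=> D /cyl_claim[].
Qed.

Lemma markov_path C tau (L : set Omega) x : path_events C ->
  stopping_time G tau -> stopped_algebra G tau L ->
  (P x ((L `&` finite_time tau) `&` [set w | C (path_after tau ^~ w)]) =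
   \int[P x]_(w in L `&` finite_time tau)
     P (X (fine (tau w)) w) [set v | C (X ^~ v)])%E.
Proof.
move=> pC st hL; have mL : measurable (L `&` finite_time tau).
  by apply: measurableI; [case: hL|exact: finite_time_measurable].
have pC' := path_events_cylinders pC.
apply: (dynkin_disintegration (Q := fun w => P (X (fine (tau w)) w))
  (eta := fun _ v => X ^~ v) cylinders_setI (fun=> mX) (Y := fun w => path_after tau ^~ w)) => //.
- move=> D sD; apply: measurableI => //.
  by apply: measurable_cylinders sD => r r0 B bB; exact: path_after_measurable.
- move=> D sD; apply: (measurable_funS (finite_time_measurable st)); first exact: subIsetr.
  have mD := measurable_dynkin_kernel (W := borelType del) (eta := fun _ v => X ^~ v)
    cylinders_setI (fun=> mX) measurableT (fun D cD => (cyl_claim cD).1) sD.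
  exact: measurable_comp measurableT _ mD (stopped_state_measurable st).
- by move=> D /cyl_claim[_]; exact.
Qed.

End markov_path.

(** * Time change and image of a strong Markov process *)

Lemma ae_eq_measure d (W : measurableType d) (R : realType)
    (P : {measure set W -> \bar R}) (A B : set W) : measurable A -> measurable B ->
  {ae P, forall w, A w <-> B w} -> P A = P B.
Proof.
move=> mA mB [N [mN N0 AB]].
have key (C D : set W) : measurable C -> measurable D -> C `<=` D `|` N ->
    (P C <= P D)%E.
  move=> mC mD CD; apply: (@le_trans _ _ (P (D `|` N))).
    by rewrite le_measure ?inE//; exact: measurableU.
  by apply: (le_trans (measureU2 _ mD mN)); rewrite [X in (_ + X)%E]N0 adde0.
apply/le_anti/andP; split; apply: key => // w hw.
  have [Bw|Bw] := pselect (B w); [by left|right; apply: AB => /= -[/(_ hw)]].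
  by [].
have [Aw|Aw] := pselect (A w); [by left|right; apply: AB => /= -[_ /(_ hw)]].
by [].
Qed.

(* A time-changed path is a measurable functional of the path only along
   absorbed paths, which need not form an event of the path space. *)
Definition absorbed_trace (R : realType) (T : topologicalType) (del : T)
    : set_system (R -> T) :=
  [set A | exists2 C, path_events C & forall p, absorbed_path del p -> A p <-> C p].

Lemma sigma_algebra_absorbed_trace (R : realType) (T : topologicalType) (del : T) :
  sigma_algebra setT (@absorbed_trace R T del).
Proof.
have [s0 sC sU] : sigma_algebra setT (@path_events R T) by exact: smallest_sigma_algebra.
split.
- by exists set0.
- move=> A [C pC AC]; exists (setT `\` C); first exact: sC.
  by move=> p /AC pAC; split=> -[_ h]; split => // /pAC.
- move=> A hA.
  have /choice[C hC] : forall n, exists C, path_events C /\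
      forall p, absorbed_path del p -> A n p <-> C p.
    by move=> n; have [C pC AC] := hA n; exists C.
  exists (\bigcup_n C n); first by apply: sU => n; case: (hC n).
  move=> p ap; split=> -[n _ h]; exists n => //; have [_ /(_ p ap)[]] := hC n; auto.
Qed.

Lemma absorbed_trace_map (R : realType) (T T' : topologicalType) (del : T)
    (Phi : (R -> T) -> R -> T') :
  (forall (t : R) B, 0 <= t -> borel T' B -> absorbed_trace del [set p | B (Phi p t)]) ->
  forall D, path_events D -> absorbed_trace del [set p | D (Phi p)].
Proof.
move=> PhiB; have [s0 sC sU] := @sigma_algebra_absorbed_trace R T del.
apply: smallest_sub; last by move=> _ [t [B [t0 bB ->]]]; exact: PhiB.
split=> [|A hA|A hA]; [exact: s0|exact: (sC _ hA)|exact: (sU _ hA)].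
Qed.

Section path_time_change_event.
Context {R : realType} {T : topologicalType} {del : T} {g : T -> R}.
Hypotheses (coz : cozero_space R T) (rate_g : rate_function del g).

Lemma absorbed_cst : absorbed_path (R := R) del (cst del).
Proof. by split => // t _; exact: cvg_cst. Qed.

Lemma path_time_change_event (t : R) (B : set T) : 0 <= t -> borel T B ->
  absorbed_trace del [set p | B (path_time_change del g p t)].
Proof.
move=> t0 bB; pose W := salg (cst del : R -> T) (@sigma_algebra_absorbed_trace R T del).
(* The coordinate process on path space, made dead at all times off the absorbed paths, so that each
   of its paths is absorbed. It is measurable for the trace sigma-algebra, which ignores this
   change. *)
pose X (r : R) (p : W) : T := if `[< absorbed_path del p >] then p r else del.
have XE p : absorbed_path del p -> X ^~ p = p.
  by move=> ap; apply/funext => r; rewrite /X asboolT.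
have aX (p : W) : absorbed_path del (X ^~ p).
  have [ap|ap] := pselect (absorbed_path del p); first by rewrite XE.
  rewrite (_ : X ^~ p = cst del); first exact: absorbed_cst.
  by apply/funext => r; rewrite /X asboolF.
have mX (r : R) : 0 <= r -> forall D, borel T D -> measurable (X r @^-1` D).
  move=> r0 D bD; exists [set p | D (p r)].
    by apply: sub_sigma_algebra; exists r, D.
  by move=> p ap; rewrite /= -[X r p]/((X ^~ p) r) XE.
have [C pC hC] := measurable_path_time_change coz rate_g aX mX t0 bB.
by exists C => // p ap; rewrite -hC//= XE.
Qed.

End path_time_change_event.

(** In [strong_markov] a left limit may equal [del], where maps such as [polar] need not be
    continuous; here this is excluded. *)
Definition left_limits_off (R : realType) d (Omega : measurableType d)
    (T : topologicalType) (del : T) (P : T -> probability Omega R) (X : R -> Omega -> T) :=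
  forall x, {ae P x, forall w, forall t : R, 0 < t -> (t%:E < lifetime del X w)%E ->
    exists2 l : T, l <> del & X s w @[s --> t^'-] --> l}.

Section strong_markov_time_change.
Context {R : realType} {d : measure_display} {Omega : measurableType d}.
Context {T : topologicalType} {del : T} {G : R -> set_system Omega}.
Context {P : T -> probability Omega R} {X : R -> Omega -> T} {g : T -> R}.
Hypotheses (sm : strong_markov del G P X) (coz : cozero_space R T).
Hypotheses (rate_g : rate_function del g) (llX : left_limits_off del P X).

Let fG : filtration G := sm_filtration sm.
Let aX w : absorbed_path del (X ^~ w) := strong_markov_absorbed sm w.

Local Notation H := (changed_filtration (X := X) (G := G) (g := g)).
Local Notation X' := (time_change (del := del) (X := X) (g := g)).
Local Notation inv := (inverse_at (X := X) (g := g)).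

Let fH : filtration H := changed_filtrationP sm rate_g.

Let aX' w : absorbed_path del (X' ^~ w).
Proof. exact: absorbed_time_change. Qed.

Let lifetime'P w (t : R) : 0 <= t -> (t%:E < lifetime del X' w)%E <-> X' t w <> del.
Proof. by move=> t0; exact: (path_lifetime_gtP (aX' w) t0). Qed.

Let adapted (t : R) B : 0 <= t -> borel T B -> H t (X' t @^-1` B).
Proof.
move=> t0 bB; have st := stopping_time_cst fH t0.
have [_ /(_ t t0)] := stopped_time_change sm rate_g coz st bB.
congr (H t); apply/seteqP; split => w /=; first by case=> -[].
by move=> Bw; split; [split; rewrite ?ltry|].
Qed.

Let kernel (t : R) B : 0 <= t -> borel T B ->
  measurable_fun (setT : set (borelType del)) (fun x => P x (X' t @^-1` B)).
Proof.
move=> t0 bB; have [C pC hC] := path_time_change_event coz rate_g t0 bB.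
have := path_kernel_measurable sm coz pC.
rewrite (_ : [set w | C _] = X' t @^-1` B)//.
by apply/seteqP; split => w; move/(hC _ (aX w)).
Qed.

Let del_law (s : R) B : 0 <= s -> borel T B ->
  P del (X' s @^-1` B) = (\1_B del)%:E :> \bar R.
Proof.
move=> s0 bB; have mB : measurable (X' s @^-1` B).
  exact: (filtration_measurable fH s0 (adapted s0 bB)).
transitivity (P del [set _ | B del]).
  apply: ae_eq_measure => //.
    have [Bd|Bd] := pselect (B del).
      by rewrite (_ : [set _ | _] = setT)//; apply/seteqP; split.
    by rewrite (_ : [set _ | _] = set0)// -subset0.
  have := sm_start sm del; apply: filterS => w X0 /=.
  suff -> : X' s w = del by [].
  have [trap _ _] := aX' w; apply: (trap 0) => //.
  by rewrite /= /time_change path_time_change0.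
rewrite indicE; have [Bd|Bd] := pselect (B del).
  rewrite mem_set// (_ : [set _ | _] = setT) ?probability_setT//.
  by apply/seteqP; split.
by rewrite memNset// (_ : [set _ | _] = set0) ?measure0// -subset0.
Qed.

Let shifted tau w (t v s : R) : tau w = t%:E -> 0 <= t -> 0 <= s ->
  inv tau w = v%:E -> X' (t + s) w = path_time_change del g (fun r => X (v + r) w) s.
Proof.
move=> tE t0 s0; rewrite /inverse_at tE => E.
exact: (path_time_change_shift rate_g (aX w)).
Qed.

Let inv_fin tau w : stopping_time H tau -> (inv tau w < +oo)%E ->
  exists t v : R, [/\ tau w = t%:E, 0 <= t, 0 <= v & inv tau w = v%:E].
Proof.
move=> st; have := inverse_at_ge0 (X := X) (g := g) tau w.
case E : (inv tau w) => [v| |]// v0 _.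
move: E (st.1 w); rewrite /inverse_at; case tE : (tau w) => [t| |]// E t0.
by exists t, v; split.
Qed.

(** Where [phi(tau)] is finite, this is the path version of the Markov property of [X] at
    [phi(tau)], for a path event [C] that represents the time-changed event on absorbed paths. Where
    [phi(tau)] is infinite, the time change is dead from [tau] on and both sides are explicit. *)
Let markov_sets tau (L : set Omega) (s : R) B x :
  stopping_time H tau -> stopped_algebra H tau L -> 0 <= s -> borel T B ->
  (P x ((L `&` finite_time tau) `&` [set w | B (X' (fine (tau w) + s) w)]) =
   \int[P x]_(w in L `&` finite_time tau) P (X' (fine (tau w)) w) (X' s @^-1` B))%E.
Proof.
move=> st hL s0 bB; have stG := stopping_inverse sm rate_g st.
have hLG := (stopped_inverse sm rate_g L st).1 hL.
have mL : measurable L by case: hL.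
have mf : measurable (finite_time tau) by case: (stopped_algebra_fin fH st).
have mfi : measurable (finite_time (inv tau)) by case: (stopped_algebra_fin fG stG).
pose E1 := L `&` finite_time (inv tau).
pose E2 := (L `&` finite_time tau) `\` finite_time (inv tau).
have mE1 : measurable E1 by exact: measurableI.
have mE2 : measurable E2 by apply: measurableD => //; exact: measurableI.
have EE : L `&` finite_time tau = E1 `|` E2.
  apply/seteqP; split => w.
    move=> [Lw fw]; have [h|h] := pselect (finite_time (inv tau) w); first by left.
    by right.
  move=> [[Lw fw]|[]//]; split => //.
  by have [t [v [tE _ _ _]]] := inv_fin st fw; rewrite /finite_time /= tE ltry.
have disj : E1 `&` E2 = set0 by rewrite -subset0 => w [[_ h1] [_ h2]].
have [C pC hC'] := path_time_change_event coz rate_g s0 bB.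
have hC p : absorbed_path del p -> B (path_time_change del g p s) <-> C p := hC' p.
have mev : measurable [set w | finite_time tau w /\ B (X' (fine (tau w) + s) w)].
  have sts := stopping_timeD fH st s0.
  have [m1 _] := stopped_time_change sm rate_g coz sts bB.
  have mI := measurableI _ _ mf m1.
  rewrite (_ : [set _ | _] = finite_time tau `&` [set w | (tau w + s%:E < +oo)%E /\
    B (X' (fine (tau w + s%:E)%E) w)])//.
  apply/seteqP; split => w /= [fw].
    by move=> Bw; split => //; have [t E t0] := stopping_fin st fw;
      move: Bw; rewrite E /= ltry.
  by move=> [_ Bw]; split => //; have [t E t0] := stopping_fin st fw;
      move: Bw; rewrite E.
rewrite EE (_ : (E1 `|` E2) `&` _ =
  (E1 `&` [set w | C (path_after (del := del) (X := X) (inv tau) ^~ w)]) `|`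
  (E2 `&` [set _ | B del])); last first.
  rewrite setIUl; congr (_ `|` _); apply/seteqP; split => w [Ew Bw]; split => //.
  - have [t [v [tE t0 v0 vE]]] := inv_fin st Ew.2.
    have pE : path_after (del := del) (X := X) (inv tau) ^~ w = fun r => X (v + r) w.
      by apply/funext => r; rewrite /path_after vE ltry.
    rewrite /= pE; apply/hC; first exact: (absorbed_shift v0 (aX w)).
    by rewrite -(shifted tE t0 s0 vE); move: Bw; rewrite /= tE.
  - have [t [v [tE t0 v0 vE]]] := inv_fin st Ew.2.
    have pE : path_after (del := del) (X := X) (inv tau) ^~ w = fun r => X (v + r) w.
      by apply/funext => r; rewrite /path_after vE ltry.
    move: Bw; rewrite /= pE => /hC; rewrite -(shifted tE t0 s0 vE) tE; apply.
    exact: (absorbed_shift v0 (aX w)).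
  - move: Bw; rewrite /= (_ : X' _ w = del)//.
    have [[_ fw] nf] := Ew; have [t tE t0] := stopping_fin st fw; rewrite tE /=.
    have [trap _ _] := aX' w; apply: (trap t) => //; first by rewrite lerDl.
    by apply: (time_change_del tE); apply/eqP; rewrite -leye_eq leNgt; exact/negP.
  - move: Bw; rewrite /= (_ : X' _ w = del)//.
    have [[_ fw] nf] := Ew; have [t tE t0] := stopping_fin st fw; rewrite tE /=.
    have [trap _ _] := aX' w; apply: (trap t) => //; first by rewrite lerDl.
    by apply: (time_change_del tE); apply/eqP; rewrite -leye_eq leNgt; exact/negP.
have mE1C : measurable (E1 `&` [set w | C (path_after (del := del) (X := X) (inv tau) ^~ w)]).
  apply: measurableI => //; apply: measurable_cylinders (path_events_cylinders pC).
  by move=> r r0 D bD; exact: (path_after_measurable sm coz).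
have mBd : measurable [set _ : Omega | B del].
  have [Bd|Bd] := pselect (B del).
    by rewrite (_ : [set _ | _] = setT)//; apply/seteqP; split.
  by rewrite (_ : [set _ | _] = set0)// -subset0.
rewrite measureU//; [|exact: measurableI|]; last first.
  by rewrite -subset0 => w [[h1 _] [h2 _]]; rewrite -[set0 w]/(set0 w) -disj.
rewrite ge0_integral_setU//; last 2 first.
- rewrite -EE.
  have mK := kernel s0 bB.
  have mS : measurable_fun (finite_time tau)
      ((fun w => X' (fine (tau w)) w) : Omega -> borelType del).
    move=> _ D bD; have [m1 _] := stopped_time_change sm rate_g coz st bD.
    by move: m1; congr measurable.
  apply: (measurable_funS mf); first exact: subIsetr.
  exact: measurable_comp measurableT _ mK mS.
- by apply/disj_setPS; rewrite disj.
congr (_ + _)%E.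
  apply: (eq_trans (markov_path sm coz x pC stG hLG)); apply: eq_integral => w /set_mem[_ fw].
  have [t [v [tE t0 v0 vE]]] := inv_fin st fw.
  rewrite -(time_change_fin (del := del) tE) ?vE ?ltry// tE /=; congr (P _ _).
  by apply/seteqP; split => u; move/(hC _ (aX u)).
transitivity (\int[P x]_(w in E2) (\1_B del)%:E)%E.
  rewrite integral_cst// indicE; have [Bd|Bd] := pselect (B del).
    rewrite mem_set// mul1e (_ : [set _ | _] = setT) ?setIT//.
    by apply/seteqP; split.
  by rewrite memNset// mul0e (_ : [set _ | _] = set0) ?setI0 ?measure0// -subset0.
apply: eq_integral => w /set_mem[[_ fw] nf].
have [t tE t0] := stopping_fin st fw; rewrite tE /= (_ : X' t w = del) ?del_law//.
by apply: (time_change_del tE); apply/eqP; rewrite -leye_eq leNgt; exact/negP.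
Qed.

Lemma left_limits_off_time_change : left_limits_off del P X'.
Proof.
move=> x; have := llX x; apply: filterS => w h t t0.
move=> /(lifetime'P w (ltW t0)) /(path_inverse_fin rate_g (aX w) (ltW t0))[s Is].
have [s0 Xs As] := (path_inverseP rate_g s (aX w) (ltW t0)).1 Is.
have {}s0 : 0 < s.
  move: s0; rewrite le_eqVlt => /predU1P[s0|//]; exfalso.
  by move: As; rewrite -s0 path_clock_le0// => -[t0']; move: t0; rewrite -t0' ltxx.
have [l ld Xl] := h s s0 ((lifetime_gtP sm w (ltW s0)).2 Xs).
by exists l => //; have [] := path_time_change_left_limit rate_g (aX w) t0 Is Xl.
Qed.

(** The times [phi(tau_n)] are [G]-stopping times, and before death they increase to [phi(tau)] by
    left-continuity of the inverse, so the property of [X] applies to them. *)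
Let quasi_left_continuous (tau_ : nat -> Omega -> \bar R) :
  (forall n, stopping_time H (tau_ n)) ->
  (forall n w, tau_ n w <= tau_ n.+1 w)%E ->
  let tau w := ereal_sup [set tau_ n w | n in [set: nat]] in
  forall x, {ae P x, forall w, (tau w < lifetime del X' w)%E ->
    X' (fine (tau_ n w)) w @[n --> \oo] --> X' (fine (tau w)) w}.
Proof.
move=> st mono tau x.
have stG n := stopping_inverse sm rate_g (st n).
have monoG n w : (inv (tau_ n) w <= inv (tau_ n.+1) w)%E.
  move: (mono n w) ((st n).1 w); rewrite /inverse_at.
  case: (tau_ n w) => [a| |]//; case: (tau_ n.+1 w) => [b| |]//.
  - by rewrite !lee_fin => ab a0; exact: (le_path_inverse rate_g (aX w)).
  - by move=> _ _; rewrite leey.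
have := sm_quasi_left_continuous sm stG monoG x; apply: filterS => w h taul.
have tau_le n : (tau_ n w <= tau w)%E by apply: ereal_sup_ubound; exists n.
have tau0 : (0 <= tau w)%E by apply: le_trans (tau_le 0%N); exact: (st 0%N).1.
case tE : (tau w) taul tau_le tau0 => [t| |]//; last by rewrite ltNge leey.
move=> /[swap] tau_le /[swap]; rewrite lee_fin => t0.
move=> /(lifetime'P w t0) /(path_inverse_fin rate_g (aX w) t0)[s Is].
have supE := path_inverse_sup rate_g (aX w) (fun n => (st n).1 w) tE Is.
have tau_fin n : exists2 u : R, tau_ n w = u%:E & 0 <= u <= t.
  move: (tau_le n) ((st n).1 w); case: (tau_ n w) => [u| |]//.
  by rewrite !lee_fin => ut u0; exists u => //; rewrite u0.
have invE n : inv (tau_ n) w = path_inverse g (X ^~ w) (fine (tau_ n w)).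
  by have [u uE _] := tau_fin n; rewrite /inverse_at uE.
have supE' : ereal_sup [set inv (tau_ n) w | n in [set: nat]] = s%:E.
  rewrite -supE; congr ereal_sup; apply/seteqP; split => _ [n _ <-];
    by exists n => //; rewrite invE.
have [s0 Xs _] := (path_inverseP rate_g s (aX w) t0).1 Is.
move: h; rewrite supE' => /(_ ((lifetime_gtP sm w s0).2 Xs)).
rewrite /= (_ : X' t w = X s w); last exact: path_time_change_fin.
rewrite (_ : (fun n => X' (fine (tau_ n w)) w) = (fun n => X (fine (inv (tau_ n) w)) w))//.
apply/funext => n; have [u uE /andP[u0 ut]] := tau_fin n.
rewrite -(time_change_fin (del := del) uE) ?uE//.
apply: (@le_lt_trans _ _ s%:E); last by rewrite ltry.
by rewrite -supE'; apply: ereal_sup_ubound; exists n.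
Qed.

Theorem strong_markov_time_change : strong_markov del H P X'.
Proof.
split.
- exact: fH.
- by move=> t t0 B bB; exact: adapted.
- by move=> t t0 B bB; apply/(borel_fun_measurable del); exact: kernel.
- move=> x; have := sm_start sm x; apply: filterS => w <-.
  exact: path_time_change0.
- by move=> w s t s0 st; case: (aX' w) => + _ _; exact.
- move=> w t t0 lt; apply: contrapT => /(lifetime'P w t0).
  by rewrite ltNge lt.
- by move=> w t t0 _; case: (aX' w) => _ + _; exact.
- move=> x; have := left_limits_off_time_change x; apply: filterS => w h t t0 lt.
  by have [l _] := h t t0 lt; exists l.
- exact: quasi_left_continuous.
- move=> tau st f bf [M fM] s s0 x.
  have mf : measurable (finite_time tau) by case: (stopped_algebra_fin fH st).
  apply: (@condexp_of_kernel R _ Omega _ (borelType del) _ Omega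
    (fun w => P (X' (fine (tau w)) w)) (X' s) (P x) (stopped_algebra H tau) (finite_time tau)
    (fun w => X' (fine (tau w) + s) w) f M).
  + exact: (stopped_salg fH st).
  + exact: (stopped_algebra_fin fH st).
  + move=> _ B bB; rewrite setTI.
    exact: (filtration_measurable fH s0 (adapted s0 bB)).
  + move=> _ B bB; have [m1 _] := stopped_time_change sm rate_g coz (stopping_timeD fH st s0) bB.
    have := measurableI _ _ mf m1; congr measurable.
    apply/seteqP; split => w /= [fw]; have [t E t0] := stopping_fin st fw.
      by move=> [_ Bw]; split => //; move: Bw; rewrite E.
    by move=> Bw; split => //; move: Bw; rewrite E /= ltry.
  + move=> B Y bB mY.
    have := stopped_time_change sm rate_g coz st (kernel s0 bB measurableT mY).
    by rewrite setTI.
  + by move=> L B hL bB; exact: markov_sets.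
  + exact/(borel_fun_measurable del).
  + exact: fM.
  + by move=> w /(stopping_fin st)[t -> _].
  + by move=> w; rewrite /finite_time /=; case: (tau w) => // t; rewrite ltry.
  + by move=> w /(stopping_fin st)[t -> _].
  + by move=> w; rewrite /finite_time /=; case: (tau w) => // t; rewrite ltry.
Qed.

End strong_markov_time_change.

Lemma integral_same_distribution (R : realType) d1 d2 d3 (V1 : measurableType d1)
    (V2 : measurableType d2) (T : measurableType d3) (P1 : {measure set V1 -> \bar R})
    (P2 : {measure set V2 -> \bar R}) (eta1 : V1 -> T) (eta2 : V2 -> T) (f : T -> \bar R) :
  measurable_fun setT eta1 -> measurable_fun setT eta2 -> measurable_fun setT f ->
  (forall B, measurable B -> P1 (eta1 @^-1` B) = P2 (eta2 @^-1` B)) ->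
  (\int[P1]_v f (eta1 v) = \int[P2]_v f (eta2 v))%E.
Proof.
move=> m1 m2 mf PP.
have pos (g : T -> \bar R) : measurable_fun setT g -> (forall x, 0 <= g x)%E ->
    (\int[P1]_v g (eta1 v) = \int[P2]_v g (eta2 v))%E.
  move=> mg g0.
  transitivity (\int[pushforward P1 eta1]_y g y)%E.
    by rewrite ge0_integral_pushforward.
  transitivity (\int[pushforward P2 eta2]_y g y)%E; last first.
    by rewrite ge0_integral_pushforward.
  apply: (@eq_measure_integral _ _ _ _ 
    (measure_function_pushforward__canonical__measure_function_Measure P2 m2)
    (measure_function_pushforward__canonical__measure_function_Measure P1 m1)).
  by move=> B mB _; exact: PP.
rewrite [LHS]integralE [RHS]integralE -/(f \o eta1) -/(f \o eta2).
rewrite (funepos_comp f eta1) (funepos_comp f eta2) (funeneg_comp f eta1) (funeneg_comp f eta2).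
congr (_ - _)%E.
  by apply: (pos (f ^\+)%E) => //; exact: measurable_funepos.
by apply: (pos (f ^\-)%E) => //; exact: measurable_funeneg.
Qed.

Section strong_markov_transfer.
Context {R : realType} {d : measure_display} {Omega : measurableType d}.
Context {T T' : topologicalType} {del : T} {del' : T'} {G : R -> set_system Omega}.
Context {P : T -> probability Omega R} {X : R -> Omega -> T} {h : T -> T'} {k : T' -> T}.
Hypotheses (sm : strong_markov del G P X) (llX : left_limits_off del P X).
Hypotheses (h_del : forall x, h x = del' <-> x = del)
  (h_cont : forall x, x <> del -> {for x, continuous h})
  (h_borel : forall B, borel T' B -> borel T (h @^-1` B))
  (k_borel : forall B, borel T B -> borel T' (k @^-1` B))
  (hk : cancel k h).
Hypothesis law : forall x (s : R) B, 0 <= s -> borel T' B ->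
  P x ((h \o X s) @^-1` B) = P (k (h x)) ((h \o X s) @^-1` B).

Let Y t w := h (X t w).

Let lifetimeE w : lifetime del' Y w = lifetime del X w.
Proof.
rewrite /lifetime; congr ereal_inf; apply/seteqP; split=> _ [t [t0 /h_del Xt] <-];
  by exists t.
Qed.

Lemma left_limits_off_transfer : left_limits_off del' (fun y => P (k y)) Y.
Proof.
move=> y; have := llX (k y); apply: filterS => w H t t0; rewrite lifetimeE => /(H t t0)[l ld Xl].
exists (h l); first by move/h_del.
by apply: (@cvg_comp _ _ _ (X ^~ w) h) Xl _; exact: h_cont.
Qed.

(** [law] is Dynkin's criterion for a function of a Markov process to be Markov: the law of
    [h (X s)] depends on the starting point through its image under [h], for which [k] chooses a
    representative. For polar coordinates [h] is injective and the criterion is immediate; for the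
    modulator it is translation invariance. *)
Lemma strong_markov_transfer : strong_markov del' G (fun y => P (k y)) Y.
Proof.
have fG := sm_filtration sm.
have mX (s : R) B : 0 <= s -> borel T' B -> measurable (Y s @^-1` B).
  move=> s0 bB; apply: (filtration_measurable fG s0).
  by apply: (sm_adapted sm s0 (h_borel bB)).
split => //.
- by move=> t t0 B bB; exact: (sm_adapted sm t0 (h_borel bB)).
- move=> t t0 B bB D mD.
  apply: (k_borel (B := [set x | D (P x (Y t @^-1` B))])).
  exact: (sm_kernel sm t0 (h_borel bB) mD).
- by move=> y; have := sm_start sm (k y); apply: filterS => w; rewrite /Y => ->; exact: hk.
- move=> w s t s0 st /h_del Xs; apply/h_del; exact: (sm_trap sm) Xs.
- by move=> w t t0; rewrite lifetimeE => lt; apply/h_del; exact: (sm_dead sm).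
- move=> w t t0; rewrite lifetimeE => tl.
  apply: (@cvg_comp _ _ _ (X ^~ w) h); first exact: (sm_right_continuous sm).
  by apply: h_cont; exact/(lifetime_gtP sm).
- move=> y; have := left_limits_off_transfer y; apply: filterS => w H t t0 lt.
  by have [l _] := H t t0 lt; exists l.
- move=> tau_ st mono tau y; have := sm_quasi_left_continuous sm st mono (k y).
  apply: filterS => w H; rewrite lifetimeE => /[dup] tl /H Xt.
  apply: (@cvg_comp _ _ _ (fun n => X (fine (tau_ n w)) w) h) Xt _.
  have tau0 : (0 <= tau w)%E.
    by apply: (le_trans ((st 0%N).1 w)); apply: ereal_sup_ubound; exists 0%N.
  apply: h_cont; apply/(lifetime_gtP sm); rewrite ?fine_ge0//.
  rewrite fineK// ge0_fin_numE//; apply: lt_le_trans tl _; exact: leey.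
- move=> tau st f bf fM s s0 y.
  have bfh : borel_fun (f \o h) by move=> B mB; exact: (h_borel (bf B mB)).
  have fhM : exists M : R, forall x, `|(f \o h) x| <= M.
      by case: fM => M fM; exists M => x; exact: fM.
  have := sm_markov sm st bfh fhM s0 (k y).
  rewrite [X in is_condexp _ _ _ X -> _](_ : _ =
    (fun w => if tau w is t%:E then ('E_(P (k (Y t w)))[fun v => f (Y s v)])%E else 0%E))//.
  apply/funext => w; case: (tau w) => // t; rewrite unlock.
  apply: (@integral_same_distribution _ _ _ _ _ _ (borelType del') _ _
    (Y s) (Y s) (EFin \o f)).
  + by move=> _ B bB; rewrite setTI; exact: mX.
  + by move=> _ B bB; rewrite setTI; exact: mX.
  + by apply/measurable_EFinP/(borel_fun_measurable del').
  + by move=> B bB; exact: law.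
Qed.

End strong_markov_transfer.

(** * Polar coordinates *)

Section cemetery.
Context {T : topologicalType}.

Lemma nbhs_cemetery_Some (a : T) (U : set (cemetery T)) :
  nbhs (Some a : cemetery T) U <-> nbhs a (Some @^-1` U).
Proof.
split.
  move=> nU; have [V [oV Va] VU] : exists2 V, open_nbhs (Some a : cemetery T) V & V `<=` U.
    by move: nU; rewrite nbhsE.
  by apply: (@filterS _ _ _ (Some @^-1` V)); [move=> x /VU|exact: open_nbhs_nbhs].
rewrite nbhsE => -[V [oV Va] VU]; rewrite nbhsE; exists (Some @` V); last first.
  by move=> _ [x Vx <-]; exact: VU.
split; last by exists a.
rewrite /open /= /cemetery_open /= (_ : _ @^-1` _ = V)//.
by apply/seteqP; split => [x [y Vy [<-]]//|x Vx]; exists x.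
Qed.

Lemma nbhs_cemetery_None (U : set (cemetery T)) : nbhs (None : cemetery T) U <-> U None.
Proof.
split; first exact: nbhs_singleton.
move=> Un; rewrite nbhsE; exists [set None] => [|_ ->//]; split => //.
rewrite /open /= /cemetery_open /= (_ : _ @^-1` _ = set0); first exact: open0.
by rewrite -subset0.
Qed.

Lemma continuous_cemetery (T' : topologicalType) (f : cemetery T -> T') :
  continuous (f \o Some) -> continuous f.
Proof.
move=> cf [a|] U nU /=; last by apply/nbhs_cemetery_None; exact: (nbhs_singleton nU).
by apply/nbhs_cemetery_Some; exact: (cf a U nU).
Qed.

Lemma continuous_Some : continuous (Some : T -> cemetery T).
Proof. by move=> a U /nbhs_cemetery_Some. Qed.

Lemma closed_grave : closed [set grave : cemetery T].
Proof.
rewrite -[X in closed X]setCK; apply: open_closedC.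
rewrite /open /= /cemetery_open /= (_ : _ @^-1` _ = setT); first exact: openT.
by apply/seteqP; split.
Qed.

End cemetery.

(** The function is the minimum of 1 and the distance to the complement of [U]. It is Lipschitz with
    constant 1, as an infimum of such functions. *)
Lemma cozero_space_normed (R : realType) (E : normedModType R) : cozero_space R E.
Proof.
move=> U oU.
(* The element 1 keeps the set nonempty when [U] is the whole space. *)
pose S (x : E) : set R := [set r | r = 1 \/ exists2 y, ~ U y & r = `|x - y|].
have S_ge0 x : lbound (S x) 0 by move=> r [->|[y _ ->]].
have S1 x : S x 1 by left.
have le_k x r : S x r -> inf (S x) <= r by move=> Sr; apply: ge_inf => //; exists 0.
have lip x y : inf (S x) <= inf (S y) + `|x - y|.
  rewrite -lerBlDr; apply: lb_le_inf; first by exists 1.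
  move=> r [->|[z Uz ->]]; rewrite lerBlDr.
    by apply: (le_trans (le_k _ _ (S1 x))); rewrite lerDl.
  apply: (@le_trans _ _ `|x - z|); first by apply: le_k; right; exists z.
  have -> : x - z = (x - y) + (y - z) by rewrite addrA subrK.
  by rewrite addrC; exact: ler_normD.
exists (fun x => inf (S x)).
  move=> x; apply/cvgrPdist_lt => e e0; near=> y.
  have xy : `|x - y| < e.
    near: y; apply: (@cvgr_dist_lt _ _ _ (nbhs x) _ id) => //; exact: cvg_id.
  apply: le_lt_trans xy; rewrite ler_norml; apply/andP; split.
    by rewrite lerBrDr addrC lerBlDr distrC; exact: lip.
  by rewrite lerBlDr addrC; exact: lip.
apply/seteqP; split => x /=.
  move=> Ux; have : nbhs x U by exact: open_nbhs_nbhs.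
  move=> /nbhs_ballP[e /= e0 eU].
  apply: (@lt_le_trans _ _ (Num.min 1 e)); first by rewrite lt_min ltr01.
  apply: lb_le_inf; first by exists 1.
  move=> r [->|[y Uy ->]]; first by rewrite ge_min lexx.
  rewrite ge_min leNgt orbC leNgt; apply/orP; left; apply/negP => xy; apply: Uy.
  by apply: eU; rewrite -ball_normE.
move=> k0; apply: contrapT => Ux; move: k0; rewrite ltNge => /negP; apply.
by apply: le_k; right; exists x => //; rewrite subrr normr0.
Unshelve. all: by end_near. Qed.

Section polar_coordinates.
Context {R : realType} {E : completeNormedModType R}.
Local Notation S := (unit_sphere E).
Local Notation polar := (@polar R E).
Local Notation of_polar := (@of_polar R E).

Lemma polar_neq0 (z : E) : z <> 0 ->
  exists2 th : S, polar z = Some (ln `|z|, th) & set_val th = `|z|^-1 *: z.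
Proof.
move=> /eqP z0; have zS : `|z|^-1 *: z \in S.
  by rewrite inE /unit_sphere /= normrZ normfV normr_id mulVf// normr_eq0.
exists (Sub (`|z|^-1 *: z) zS); last by rewrite set_valE SubK.
by rewrite /Defs.polar insubT.
Qed.

Lemma polar0 : polar 0 = None.
Proof.
rewrite /Defs.polar insubF//; apply/negP => /set_mem.
by rewrite /unit_sphere /= scaler0 normr0 => /esym/eqP; rewrite oner_eq0.
Qed.

Lemma norm_sphere (th : S) : `|set_val th| = 1 :> R.
Proof. by have /set_mem := valP th. Qed.

Lemma of_polarK : cancel polar of_polar.
Proof.
move=> z; have [->|/eqP/[dup] z0 /polar_neq0[th -> /= ->]] := eqVneq z 0.
  by rewrite polar0.
by rewrite lnK ?posrE ?normr_gt0 ?(introN eqP)// scalerA mulfV ?scale1r ?normr_eq0 ?(introN eqP).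
Qed.

Lemma norm_of_polar (x : R) (th : S) : `|of_polar (Some (x, th))| = expR x.
Proof. by rewrite /= normrZ norm_sphere mulr1 gtr0_norm// expR_gt0. Qed.

Lemma of_polar_del y : of_polar y = 0 <-> y = None.
Proof.
split=> [|-> //]; case: y => [[x th]|//] /eqP; rewrite -normr_eq0 norm_of_polar.
by rewrite gt_eqF// expR_gt0.
Qed.

Lemma polarK : cancel of_polar polar.
Proof.
move=> [[x th]|]; last exact: polar0.
rewrite /Defs.polar norm_of_polar expRK /= scalerA mulVf ?gt_eqF ?expR_gt0// scale1r.
by rewrite set_valE valK.
Qed.

Lemma polar_del z : polar z = None <-> z = 0.
Proof. by rewrite -of_polar_del of_polarK. Qed.

Lemma polar_continuous (z : E) : z <> 0 -> {for z, continuous polar}.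
Proof.
move=> z0 U; have [th zE thE] := polar_neq0 z0.
rewrite zE => /nbhs_cemetery_Some[[A B] [/= nA nB] AB].
move: nB; rewrite nbhsE => -[_ [[W oW <-] Wth] WB].
have nz : `|z| != 0 by rewrite normr_eq0; apply/eqP.
have lnz : ln `|y| @[y --> z] --> ln `|z|.
  apply: continuous_cvg; first by apply: continuous_ln; rewrite lt_neqAle eq_sym nz normr_ge0.
  exact: norm_continuous.
have argz : `|y|^-1 *: y @[y --> z] --> `|z|^-1 *: z.
  by apply: cvgZ; [apply: cvgV => //; exact: norm_continuous|exact: cvg_id].
have n1 : \forall y \near z, A (ln `|y|) by exact: lnz.
have n2 : \forall y \near z, W (`|y|^-1 *: y).
  by apply: argz; apply: open_nbhs_nbhs; split => //; rewrite -thE.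
have n3 : \forall y \near z, y <> 0.
  have : nbhs z (~` [set 0]).
    apply: open_nbhs_nbhs; split => //; apply: closed_openC.
    by apply: accessible_closed_set1; apply: hausdorff_accessible; exact: norm_hausdorff.
  by apply: filterS.
rewrite /= nbhs_simpl /=; near=> y.
have y0 : y <> 0 by near: y.
have [thy yE thyE] := polar_neq0 y0.
rewrite /= yE; apply: AB; split => /=; first by near: y.
by apply: WB; rewrite /= thyE; near: y.
Unshelve. all: by end_near. Qed.

Lemma of_polar_continuous : continuous of_polar.
Proof.
apply: continuous_cemetery.
rewrite (_ : of_polar \o Some = fun p => expR p.1 *: set_val p.2); last first.
  by apply/funext => -[].
move=> [x th]; apply: cvgZ.
  apply: continuous_cvg; first exact: continuous_expR.
  exact: cvg_fst.
apply: (@cvg_comp _ _ _ snd (set_val : S -> E)); first exact: cvg_snd.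
exact: initial_continuous.
Qed.

Lemma closed_zero : closed [set (0 : E)].
Proof.
by apply: accessible_closed_set1; apply: hausdorff_accessible; exact: norm_hausdorff.
Qed.

Lemma borel_polar B : borel (cemetery (R * S)) B -> borel E (polar @^-1` B).
Proof. by apply: borel_continuous_off closed_zero _ B; exact: polar_continuous. Qed.

Lemma borel_of_polar B : borel E B -> borel (cemetery (R * S)) (of_polar @^-1` B).
Proof. by apply: (borel_continuous grave); exact: of_polar_continuous. Qed.

(** The live part of [U] corresponds to an open set of nonzero vectors, whose function is composed
    with [of_polar]. Since [None] is isolated, the value there can be set to 1 or 0 as [U]
    demands. *)
Lemma cozero_space_polar : cozero_space R (cemetery (R * S)).
Proof.
move=> U oU; have oV := open_preimage_off closed_zero polar_continuous oU.
have [k ck kV] := cozero_space_normed oV.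
exists (fun y => if y is Some _ then k (of_polar y) else \1_U (None : cemetery (R * S))).
  apply: continuous_cemetery => a.
  apply: (@continuous_comp _ _ _ (fun a => of_polar (Some a)) k); last exact: ck.
  apply: (@continuous_comp (R * S)%type (cemetery (R * S)) E Some of_polar a).
    exact: continuous_Some.
  exact: of_polar_continuous.
apply/seteqP; split => -[a|] /=.
- move=> Ua; have : (polar @^-1` U `\ 0) (of_polar (Some a)).
    by split; [rewrite -(polarK (Some a)) in Ua|move=> /of_polar_del].
  by rewrite kV.
- by move=> Un; rewrite indicE mem_set.
- move=> ka; have : [set x | 0 < k x] (of_polar (Some a)) by [].
  rewrite -kV => -[Ua _]; have : U (polar (of_polar (Some a))) by [].
  by rewrite polarK.
- by rewrite indicE; case: (boolP (_ \in U)) => [/set_mem//|]; rewrite ltxx.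
Qed.

End polar_coordinates.

(** * Symmetries of the law of the path *)

Lemma cylinder_event (R : realType) (T : topologicalType) (x0 : T) (s : seq (R * set T)) :
  (forall tb, tb \in s -> 0 <= tb.1 /\ borel T tb.2) -> path_events (cylinder s).
Proof.
have S : sigma_algebra setT (@path_events R T) by exact: smallest_sigma_algebra.
pose W := salg (cst x0 : R -> T) S.
elim: s => [|[t B] s IH] hs; first by rewrite cylinder0; exact: (@measurableT _ W).
rewrite (_ : cylinder _ = [set p | B (p t)] `&` cylinder s).
  apply: (@measurableI _ W); last by apply: IH => tb h; apply: hs; rewrite inE h orbT.
  have [t0 bB] := hs (t, B) ltac:(by rewrite inE eqxx).
  by apply: sub_sigma_algebra; exists t, B.
apply/seteqP; split => p /=.
  by move=> h; split=> [|tb htb]; [apply: (h (t, B))|apply: h]; rewrite inE ?eqxx ?htb ?orbT.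
by move=> [Bp h] tb; rewrite inE => /predU1P[->|/h].
Qed.

Section symmetric_path_law.
Context {R : realType} {d : measure_display} {Omega : measurableType d}.
Context {T : topologicalType} {del : T} {G : R -> set_system Omega}.
Context {P : T -> probability Omega R} {X : R -> Omega -> T}.
Hypotheses (sm : strong_markov del G P X) (coz : cozero_space R T).

Let fG : filtration G := sm_filtration sm.

Let mX (s : R) B : 0 <= s -> borel T B -> measurable (X s @^-1` B).
Proof. by move=> s0 bB; exact: (process_measurable sm). Qed.

Let mC C : <<s cylinders >> C -> measurable [set w | C (X ^~ w)].
Proof. by apply: measurable_cylinders => r r0 B bB; exact: mX. Qed.

Lemma markov_at (t : R) (L : set Omega) (C : set (R -> T)) x : 0 <= t -> G t L ->
  path_events C ->
  (P x (L `&` [set w | C (fun r => X (t + r) w)]) =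
   \int[P x]_(w in L) P (X t w) [set v | C (X ^~ v)])%E.
Proof.
move=> t0 GL pC; have st := stopping_time_cst fG t0.
have hL : stopped_algebra G (fun=> t%:E) L by exact: (stopped_algebra_cst fG t0).
have fT : finite_time (fun=> t%:E) = setT :> set Omega.
  by apply/seteqP; split => // w _; rewrite /finite_time /= ltry.
have := markov_path sm coz x pC st hL; rewrite fT setIT => <-.
congr (P x (_ `&` _)); apply/seteqP; split => w /=;
  by rewrite (_ : path_after _ ^~ w = fun r => X (t + r) w)//;
     apply/funext => r; rewrite /path_after ltry.
Qed.

Variable m : T -> T.
Hypotheses (m_borel : forall B, borel T B -> borel T (m @^-1` B))
  (law : forall y (s : R) B, 0 <= s -> borel T B ->
     P y ((m \o X s) @^-1` B) = P (m y) (X s @^-1` B)).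

Let valid (s : seq (R * set T)) := forall tb, tb \in s -> 0 <= tb.1 /\ borel T tb.2.

Let pull (s : seq (R * set T)) := [seq (tb.1, m @^-1` tb.2) | tb <- s].

Let valid_pull s : valid s -> valid (pull s).
Proof.
by move=> hs _ /mapP[u us ->] /=; have [? ?] := hs u us; split => //; exact: m_borel.
Qed.

Let pullE s (p : R -> T) : cylinder (pull s) p <-> cylinder s (m \o p).
Proof.
split=> [h tb tbs|h _ /mapP[u us ->]]; last exact: (h u us).
by apply: (h (tb.1, m @^-1` tb.2)); apply/mapP; exists tb.
Qed.

Let back (t : R) (r : seq (R * set T)) := [seq (u.1 - t, u.2) | u <- r].

Let step s (t : R) (B : set T) (r : seq (R * set T)) (M : T -> T) x : s = (t, B) :: r ->
  path_events [set p : R -> T | cylinder (back t r) (M \o p)] ->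
  0 <= t -> borel T (M @^-1` B) ->
  (P x [set w | cylinder s (M \o X ^~ w)] =
   \int[P x]_(w in X t @^-1` (M @^-1` B))
      P (X t w) [set v | cylinder (back t r) (M \o X ^~ v)])%E.
Proof.
move=> -> pC t0 bB; rewrite -(markov_at x t0 (sm_adapted sm t0 bB) pC).
congr (P x _); apply/seteqP; split => w /=; first by move/cylinder_cons.
by move=> h; apply/cylinder_cons.
Qed.

(* Induction on the number of times, by the Markov property at the first one. *)
Let symmetric_cylinder n s y : size s = n -> valid s ->
  P y [set w | cylinder s (m \o X ^~ w)] = P (m y) [set w | cylinder s (X ^~ w)].
Proof.
elim: n s y => [|n IH] s y.
  move=> /size0nil -> _; rewrite cylinder0 (_ : [set _ | _] = setT)//.
  by rewrite !probability_setT.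
have [r0 [Es [<- [sr]]]] := cylinder_sort s; rewrite Es.
case: r0 sr {Es} => [|[t B] r]// sr /(_ _ _ _ erefl) tr [/= sz] hs.
have [t0 bB] := hs (t, B) ltac:(by rewrite sr inE eqxx).
set r' := back t r.
have hr' : valid r'.
  move=> _ /mapP[u ur ->] /=; rewrite subr_ge0; split; first exact: tr.
  by have [] := hs u ltac:(by rewrite sr inE ur orbT).
have pr' : path_events (cylinder r') by exact: (cylinder_event del).
have ppr' : path_events [set p : R -> T | cylinder r' (m \o p)].
  rewrite (_ : [set _ | _] = cylinder (pull r')).
    by apply: (cylinder_event del); exact: valid_pull.
  by apply/seteqP; split => p /pullE.
rewrite (step (M := m) y erefl ppr' t0 (m_borel bB)).
rewrite [RHS](step (M := id) (m y) erefl pr' t0 bB).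
(* The induction hypothesis moves the symmetry from the remaining path to its starting point [X t].
   Both sides are then integrals of this single function of the state at time [t], against two
   one-dimensional laws that agree. *)
pose f (z : T) : \bar R := if z \in B then P z [set v | cylinder r' (X ^~ v)] else 0%E.
have mf : measurable_fun (setT : set (borelType del)) f.
  apply: (@measurable_fun_extend _ _ (borelType del)) => //.
  by apply: measurable_funTS; exact: (path_kernel_measurable sm coz pr').
transitivity (\int[P y]_w f (m (X t w)))%E.
  rewrite integral_mkcond; apply: eq_integral => w _; rewrite patchE /f.
  rewrite (_ : (w \in X t @^-1` (m @^-1` B)) = (m (X t w) \in B)); last first.
    by apply/idP/idP => /set_mem/mem_set.
  by case: ifP => // _; apply: IH => //; rewrite size_map.
transitivity (\int[P (m y)]_w f (X t w))%E; last first.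
  rewrite [RHS]integral_mkcond; apply: eq_integral => w _; rewrite patchE /f.
  by rewrite (_ : (w \in X t @^-1` (id @^-1` B)) = (X t w \in B)).
apply: (@integral_same_distribution _ _ _ _ _ _ (borelType del) _ _ (m \o X t) (X t) f) => //.
- by move=> _ D bD; rewrite setTI; exact: (mX t0 (m_borel bD)).
- by move=> _ D bD; rewrite setTI; exact: (mX t0 bD).
- by move=> D bD; exact: law.
Qed.

Lemma symmetric_path_law y C : path_events C ->
  P y [set w | C (m \o X ^~ w)] = P (m y) [set w | C (X ^~ w)].
Proof.
move=> pC; have sC := path_events_cylinders pC.
have mmX : forall D, <<s cylinders >> D -> measurable [set w | D (m \o X ^~ w)].
  move=> D; apply: (measurable_cylinders (Y := fun r w => m (X r w))) => r r0 B bB.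
  exact: (mX r0 (m_borel bB)).
(* With a constant kernel and the sure event, the disintegration reduces to the equality of two laws
   on a generating class. *)
have := @dynkin_disintegration R _ _ Omega Omega (R -> T) cylinders (fun=> P (m y))
  (fun _ v => X ^~ v) cylinders_setI (fun=> mC) (P y) setT (fun w => m \o X ^~ w) measurableT.
have cst_int D : (\int[P y]_w P (m y) ((fun v => X ^~ v) @^-1` D) =
    P (m y) [set w | D (X ^~ w)])%E.
  have [mD|mD] := pselect (measurable ((fun v => X ^~ v) @^-1` D)).
    have E : P (m y) ((fun v => X ^~ v) @^-1` D) \is a fin_num by exact: fin_num_measure.
    by rewrite -[P (m y) _](fineK E) integral_cst_probability.
  rewrite integral_cst//.
  by have /= := probability_setT (P y) => ->; rewrite mule1.
move=> /(_ _ _ _ C sC); rewrite cst_int setTI; apply.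
- by move=> D /mmX mD; rewrite setTI.
- by move=> D sD; exact: measurable_cst.
- by move=> D [s hs ->]; rewrite setTI cst_int; exact: symmetric_cylinder hs.
Qed.

End symmetric_path_law.

(** * From a MAP to a self-similar process *)

Section translation.
Context {R : realType} {S : topologicalType}.

Definition translate (a : R) (y : cemetery (R * S)) : cemetery (R * S) :=
  if y is Some (x, th) then Some (x + a, th) else None.

Lemma translateD a b y : translate a (translate b y) = translate (b + a) y.
Proof. by case: y => [[x th]|]//=; rewrite addrA. Qed.

Lemma translate_continuous a : continuous (translate a).
Proof.
apply: continuous_cemetery.
rewrite (_ : _ \o _ = Some \o (fun p : R * S => (p.1 + a, p.2))); last first.
  by apply/funext => -[].
move=> [x th]; apply: (@continuous_comp _ _ (cemetery (R * S))); last exact: continuous_Some.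
apply: (@cvg_pair _ _ _ (nbhs (x, th)) (nbhs (x + a)) (nbhs th)); last exact: cvg_snd.
by apply: cvgD; [exact: cvg_fst|exact: cvg_cst].
Qed.

Lemma borel_translate a B : borel (cemetery (R * S)) B ->
  borel (cemetery (R * S)) (translate a @^-1` B).
Proof. by apply: (borel_continuous grave); exact: translate_continuous. Qed.

Lemma translate_continuous_l y : continuous (translate ^~ y).
Proof.
case: y => [[x th]|]; last by move=> a; exact: cvg_cst.
rewrite (_ : translate ^~ _ = Some \o (fun a : R => (x + a, th)))//.
move=> a; apply: (@continuous_comp _ _ (cemetery (R * S))); last exact: continuous_Some.
apply: (@cvg_pair _ _ _ (nbhs a) (nbhs (x + a)) (nbhs th)); last exact: cvg_cst.
by apply: cvgD; [exact: cvg_cst|exact: cvg_id].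
Qed.

End translation.

Lemma modulator_grave (R : realType) (S : topologicalType) (y : cemetery (R * S)) :
  modulator y = grave <-> y = grave.
Proof. by case: y. Qed.

Lemma lifetime_modulator (R : realType) (S : topologicalType) d (Omega : measurableType d)
    (Y : R -> Omega -> cemetery (R * S)) w :
  lifetime grave (fun t w => modulator (Y t w)) w = lifetime grave Y w.
Proof.
rewrite /lifetime; congr ereal_inf; apply/seteqP; split=> _ [t [t0 /modulator_grave Yt] <-];
  by exists t.
Qed.

Section from_MAP.
Context {R : realType} {E : completeNormedModType R} (alpha : R).
Context {d : measure_display} {Omega : measurableType d}.
Local Notation S := (unit_sphere E).
Local Notation TT := (cemetery (R * S)).
Context {G : R -> set_system Omega} {P : TT -> probability Omega R}.
Context {Y : R -> Omega -> TT}.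
Hypotheses (alpha_gt0 : 0 < alpha) (mapY : MAP G P Y).

Let sm : strong_markov grave G P Y := MAP_strong_markov mapY.
Let aY w : absorbed_path grave (Y ^~ w) := strong_markov_absorbed sm w.
Let coz : cozero_space R TT := cozero_space_polar.

Definition exp_rate (y : TT) : R := if y is Some (x, _) then expR (alpha * x) else 0.

Lemma exp_rate_continuous : continuous exp_rate.
Proof.
apply: continuous_cemetery.
rewrite (_ : _ \o _ = fun p : R * S => expR (alpha * p.1)); last by apply/funext => -[].
move=> p; apply: continuous_cvg; first exact: continuous_expR.
by apply: cvgM; [exact: cvg_cst|exact: cvg_fst].
Qed.

Lemma rate_function_exp : rate_function grave exp_rate.
Proof.
split => //.
- by move=> [[x th]|]// _; exact: expR_gt0.
- by move=> x _; exact: exp_rate_continuous.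
- by apply: (borel_funP grave); apply: (borel_continuous grave); exact: exp_rate_continuous.
Qed.

Lemma exp_clockE w : exp_clock alpha Y w = fun r => (exp_rate (Y r w))%:E.
Proof.
apply/funext => r; rewrite /exp_clock /exp_rate; case: (Y r w) => [[x th]|]//=.
by rewrite gt0_muleNy ?lte_fin.
Qed.

Let rate := rate_function_exp.
Local Notation X' := (time_change (del := grave) (X := Y) (g := exp_rate)).

Lemma ssMp_of_MAPE : ssMp_of_MAP alpha Y = fun t w => of_polar (X' t w).
Proof.
apply/funext => t; apply/funext => w; congr of_polar.
rewrite exp_clockE /time_change /path_time_change -/(path_inverse exp_rate (Y ^~ w) t).
have := @path_inverse_ge0 _ _ exp_rate (Y ^~ w) t.
case: (path_inverse _ _ _) => [s| |]//; last by move=> _; rewrite ltNge leey.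
rewrite lee_fin => s0.
rewrite /MAP_lifetime lifetime_modulator; case: ifPn => // h.
apply: esym; apply: contrapT => /(lifetime_gtP sm w s0).2; exact/negP.
Qed.

(** The cemetery is isolated here, so a left limit [grave] at [t] would place the path at [grave]
    just before [t] and trap it there. *)
Lemma left_limits_off_MAP : left_limits_off grave P Y.
Proof.
move=> x; have := sm_left_limits sm x; apply: filterS => w h t t0 tl.
have [l Yl] := h t t0 tl; exists l => // ld; move: Yl; rewrite ld => Yl.
have : \forall s \near t^'-, Y s w = grave.
  by apply: (Yl [set grave]); exact/nbhs_cemetery_None.
move=> near_grave; have [trap _ _] := aY w.
have /(lifetime_gtP sm w (ltW t0)) := tl; apply.
near (t^'-) => s.
have s0 : 0 < s by near: s; exact: nbhs_left_gt.
have st : s < t by near: s; exact: nbhs_left_lt.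
apply: (trap s t (ltW s0) (ltW st)).
by near: s.
Unshelve. all: by end_near. Qed.

Let law_start_grave s B : 0 <= s -> borel TT B -> forall a,
  P grave ((translate a \o Y s) @^-1` B) = P grave (Y s @^-1` B).
Proof.
move=> s0 bB a; apply: ae_eq_measure.
- exact: (process_measurable sm s0 (borel_translate a bB)).
- exact: (process_measurable sm s0 bB).
have := sm_start sm grave; apply: filterS => w Y0.
have [trap _ _] := aY w; have Ys := trap 0 s (lexx _) s0 Y0.
by rewrite /= Ys.
Qed.

(** Additivity at time 0, where [Y] is at [(x, th)]: the increment up to [s] is [Y s] translated by
    [- x]. *)
Let law0 (x : R) th (s : R) (B : set TT) : 0 <= s -> borel TT B -> ~ B grave ->
  P (Some (x, th)) ((translate (- x) \o Y s) @^-1` B) = P (Some (0%R, th)) (Y s @^-1` B).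
Proof.
move=> s0 bB nB.
(* The test functions of a MAP vanish at the cemetery, so they reach the indicator of [B] only when
   [B] avoids it. *)
pose f (u : R * S) : R := \1_B (Some u : TT).
have bf : borel_fun f.
  move=> D mD.
  have m1 : measurable_fun (setT : set (borelType (grave : TT))) (\1_B : TT -> R).
    exact: measurable_indic.
  have := m1 measurableT D mD; rewrite setTI => bD.
  exact: (@borel_continuous _ _ (0, th) (Some : R * S -> TT) (@continuous_Some _) _ bD).
have f0 u : 0 <= f u by rewrite /f indicE.
have f1 : exists M : R, forall u, f u <= M.
  by exists 1 => u; rewrite /f indicE; case: (_ \in _).
have := MAP_additive mapY bf f0 f1 (lexx 0) s0 x th.
(* On the sure event, the conditional identity becomes an identity between expectations. *)
have sT : G 0 setT by exact: salgT (filtration_salg (sm_filtration sm) (lexx 0)).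
set U := (fun w => _); set V := (fun w => _).
move=> [/integrableP[mU _] /integrableP[mV _] _ /(_ _ sT)].
pose zeta := lifetime grave (fun t w => modulator (Y t w)).
have zetaP w : (s%:E < zeta w)%E <-> Y s w <> grave.
  by rewrite /zeta lifetime_modulator; exact: (lifetime_gtP sm w s0).
have extE y : ext0 f y = \1_B y.
  by case: y => [u|]//=; rewrite indicE memNset.
have ifE w (y : TT) : (y = grave <-> Y s w = grave) ->
    (if (s%:E < zeta w)%E then (ext0 f y)%:E else 0%E) = (\1_B y)%:E :> \bar R.
  move=> yY; rewrite extE; case: ifPn => // /negP/(contra_not (zetaP w).2)/contrapT/yY ->.
  by rewrite indicE memNset.
have mA1 : measurable ((translate (- x) \o Y s) @^-1` B).
  exact: (process_measurable sm s0 (borel_translate _ bB)).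
have mA2 : measurable (Y s @^-1` B) by exact: (process_measurable sm s0).
have -> : (\int[P (Some (x, th))]_w U w =
    P (Some (x, th)) ((translate (- x) \o Y s) @^-1` B))%E.
  rewrite -[in RHS](setIT (_ @^-1` _)) -integral_indic//.
  apply: ae_eq_integral => //.
    by apply/measurable_EFinP; exact: measurable_indic.
  have := sm_start sm (Some (x, th)); apply: filterS => w Y0 _.
  rewrite /U add0r Y0 (_ : increment _ _ = translate (- x) (Y s w)); last first.
    by case: (Y s w) => [[]|].
  by apply: ifE; case: (Y s w) => [[]|].
have -> : (\int[P (Some (x, th))]_w V w = P (Some (0%R, th)) (Y s @^-1` B))%E.
  transitivity (\int[P (Some (x, th))]_w cst (P (Some (0%R, th)) (Y s @^-1` B)) w)%E.
    apply: ae_eq_integral => //.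
    have := sm_start sm (Some (x, th)); apply: filterS => w Y0 _.
    rewrite /V Y0 /= unlock.
    rewrite -[in RHS](setIT (_ @^-1` _)) -integral_indic//.
    apply: eq_integral => v _; rewrite -(ifE v (Y s v))//.
    by rewrite -/(zeta v); case: ifP.
  have E1 : P (Some (0%R, th)) (Y s @^-1` B) \is a fin_num by exact: fin_num_measure.
  by rewrite -(fineK E1) integral_cst_probability.
by [].
Qed.

(** Both laws are referred to the start [(0, th)] by [law0]; a set that contains the cemetery is
    replaced by its complement. *)
Let law_translate y (s a : R) B : 0 <= s -> borel TT B ->
  P y ((translate a \o Y s) @^-1` B) = P (translate a y) (Y s @^-1` B).
Proof.
case: y => [[x th]|]; last by move=> s0 bB; exact: law_start_grave.
wlog nB : B / ~ B grave => [key s0 bB|s0 bB].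
  have [Bg|/key] := pselect (B grave); last exact.
  have bC : borel TT (~` B).
    by have [_ + _] := @sigma_algebra_borel TT => /(_ _ bB); rewrite setTD.
  have : P (Some (x, th)) (~` ((translate a \o Y s) @^-1` B)) =
      P (translate a (Some (x, th))) (~` (Y s @^-1` B)).
    exact: (key (~` B) (fun h => h Bg) s0 bC).
  rewrite probability_setC; first rewrite probability_setC.
  - move=> h.
    have E1 : P (Some (x, th)) ((translate a \o Y s) @^-1` B) \is a fin_num.
      by apply: fin_num_measure; exact: (process_measurable sm s0 (borel_translate a bB)).
    have E2 : P (translate a (Some (x, th))) (Y s @^-1` B) \is a fin_num.
      by apply: fin_num_measure; exact: (process_measurable sm s0 bB).
    move: h; rewrite -(fineK E1) -(fineK E2) -!EFinB => -[/addrI/oppr_inj ->].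
    by [].
  - exact: (process_measurable sm s0 bB).
  - exact: (process_measurable sm s0 (borel_translate a bB)).
have nBa b : ~ (translate b @^-1` B) (grave : TT) by [].
rewrite [RHS](_ : _ = P (Some (0%R, th)) (Y s @^-1` (translate (x + a) @^-1` B))).
  rewrite -(law0 x th s0 (borel_translate _ bB) (nBa _)).
  congr (P _ _); apply/seteqP; split => w /=; by rewrite translateD addKr.
rewrite -(law0 (x + a) th s0 (borel_translate _ bB) (nBa _)) /=.
by congr (P _ _); apply/seteqP; split => w /=; rewrite translateD addNr;
  case: (Y s w) => [[u v]|]//=; rewrite addr0.
Qed.

Lemma MAP_path_translate y (a : R) C : path_events C ->
  P y [set w | C (translate a \o Y ^~ w)] = P (translate a y) [set w | C (Y ^~ w)].
Proof.
apply: (symmetric_path_law sm coz (@borel_translate _ _ a)).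
by move=> {}y s B s0 bB; exact: law_translate.
Qed.

Lemma exp_rate_translate a y : exp_rate (translate a y) = expR (alpha * a) * exp_rate y.
Proof.
by case: y => [[x th]|] /=; rewrite ?mulr0// mulrDr expRD mulrC.
Qed.

Lemma path_inverse_translate (p : R -> TT) (a t : R) : absorbed_path grave p ->
  path_inverse exp_rate (translate a \o p) t =
  path_inverse exp_rate p (expR (- (alpha * a)) * t).
Proof.
move=> ap; rewrite /path_inverse /clock_inverse; congr ereal_inf.
have clockE s : clock (fun r => (exp_rate ((translate a \o p) r))%:E) s =
    ((expR (alpha * a))%:E * path_clock exp_rate p s)%E.
  transitivity (\int[lebesgue_measure]_(r in [set r : R | (0 <= r)%R /\ (r%:E < s)%E])
      ((expR (alpha * a))%:E * (exp_rate (p (Num.max 0%R r)))%:E))%E.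
    apply: eq_integral => r; rewrite inE => -[r0 _].
    by rewrite max_r//= exp_rate_translate.
  rewrite ge0_integralZl//.
  - by rewrite -(@path_clockE _ _ exp_rate).
  - exact: measurable_before.
  - apply/measurable_EFinP; apply: measurable_funTS; exact: (measurable_rate rate).
  - by move=> r _; rewrite lee_fin; case: (p _) => [[]|]//= *; exact: expR_ge0.
have lt_scale (A : \bar R) : (t%:E < (expR (alpha * a))%:E * A)%E =
    ((expR (- (alpha * a)) * t)%:E < A)%E.
  have e0 := expR_gt0 (alpha * a).
  rewrite expRN; case: A => [r| |].
  - by rewrite -EFinM !lte_fin ltr_pdivrMl.
  - by rewrite gt0_muley ?lte_fin// !ltry.
  - by rewrite gt0_muleNy ?lte_fin// !ltNge !leNye.
by apply/seteqP; split => _ [s [s0 h] <-]; exists s => //; split => //; move: h;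
  rewrite clockE lt_scale.
Qed.

Lemma ssMp_of_MAP_ssMp : ssMp alpha (changed_filtration (X := Y) (G := G) (g := exp_rate))
  (fun z => P (polar z)) (ssMp_of_MAP alpha Y).
Proof.
have smX := strong_markov_time_change sm coz rate left_limits_off_MAP.
have llX := left_limits_off_time_change sm rate left_limits_off_MAP.
rewrite ssMp_of_MAPE; split.
  apply: (@strong_markov_transfer _ _ _ _ _ grave 0 _ P X' of_polar polar smX llX).
  - exact: of_polar_del.
  - by move=> x _; exact: of_polar_continuous.
  - exact: borel_of_polar.
  - exact: borel_polar.
  - exact: of_polarK.
  - by move=> x s B s0 bB; rewrite polarK.
move=> c c0 x D pD.
(* The event on the self-similar path is pulled back to an event on the path of [Y], to which the
   translation symmetry applies. *)
have [C pC hC] : absorbed_trace (grave : TT)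
    [set p | D (fun t => of_polar (path_time_change grave exp_rate p t))].
  apply: (@absorbed_trace_map _ _ _ grave
    (fun p t => of_polar (path_time_change grave exp_rate p t))) pD => t B t0 bB.
  exact: (path_time_change_event coz rate t0 (borel_of_polar bB)).
have ->: polar (c *: x) = translate (ln c) (polar x).
  have [->|/eqP x0] := eqVneq x 0; first by rewrite scaler0 polar0.
  rewrite -{1}(of_polarK x); case: (polar x) => [[u th]|] /=; last first.
    by rewrite scaler0 polar0.
  rewrite scalerA -{1}(lnK c0) -expRD addrC.
  by rewrite -[_ *: _]/(of_polar (Some (u + ln c, th))) polarK.
have -> : [set w | D ((fun t w => of_polar (X' t w)) ^~ w)] = [set w | C (Y ^~ w)].
  by apply/seteqP; split => w; move/(hC _ (aY w)).
rewrite -MAP_path_translate//; congr (P _ _); apply/seteqP.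
have aT w : absorbed_path grave (translate (ln c) \o Y ^~ w).
  have [trap rc dead] := aY w; split => [s t s0 st|t t0|t t0 h].
  - by move=> /= h; rewrite (trap s t)//; move: h; case: (Y s w) => [[]|].
  - by apply: (@cvg_comp _ _ _ (Y ^~ w) (translate (ln c)));
      [exact: rc|exact: translate_continuous].
  - rewrite /= (dead t)// => s ts; have := h s ts; rewrite /=.
    by case: (Y s w) => [[]|].
(* Translating the path by [ln c] multiplies the clock by [c^alpha], hence divides the time argument
   of its inverse by [c^alpha], and it multiplies the vector by [c]. *)
have pathE w : (fun t => c *: of_polar (X' (c `^ (- alpha) * t) w)) =
    (fun t => of_polar (path_time_change grave exp_rate (translate (ln c) \o Y ^~ w) t)).
  apply/funext => t; rewrite /time_change /path_time_change.
  rewrite path_inverse_translate// (_ : c `^ (- alpha) = expR (- (alpha * ln c))); last first.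
    by rewrite /powR gt_eqF// mulNr.
  case: (path_inverse _ _ _) => [s| |]//; rewrite ?scaler0//=.
  case: (Y s w) => [[u th]|] /=; rewrite ?scaler0// scalerA expRD lnK ?posrE//.
  by rewrite mulrC.
split=> w /=.
  by rewrite pathE => h; apply/hC.
by rewrite pathE => /hC; exact.
Qed.

Lemma lifetime_ssMp_of_MAP w :
  lifetime 0 (ssMp_of_MAP alpha Y) w = ssMp_of_MAP_lifetime alpha Y w.
Proof.
rewrite /ssMp_of_MAP_lifetime /MAP_lifetime lifetime_modulator exp_clockE ssMp_of_MAPE.
rewrite -[RHS](path_lifetime_time_change rate (aY w)).
rewrite /path_lifetime /lifetime; congr ereal_inf.
by apply/seteqP; split => _ [t [t0 /of_polar_del Xt] <-]; exists t.
Qed.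

End from_MAP.

(** * From a self-similar process to a MAP *)

Section from_ssMp.
Context {R : realType} {E : completeNormedModType R} (alpha : R).
Context {d : measure_display} {Omega : measurableType d}.
Local Notation S := (unit_sphere E).
Local Notation TT := (cemetery (R * S)).
Context {G : R -> set_system Omega} {P : E -> probability Omega R}.
Context {Z : R -> Omega -> E}.
Hypothesis ssZ : ssMp alpha G P Z.

Let sm : strong_markov 0 G P Z := ssMp_strong_markov ssZ.
Let fG : filtration G := sm_filtration sm.
Let aZ w : absorbed_path 0 (Z ^~ w) := strong_markov_absorbed sm w.
Let coz : cozero_space R E := @cozero_space_normed R E.

(** The clock of the theorem has an infinite rate at 0. The value 0 makes this a rate function, and
    the two clocks agree up to the lifetime. *)
Definition norm_rate (z : E) : R := if z == 0 then 0 else `|z| `^ (- alpha).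

Let norm_rateE (z : E) : z <> 0 -> norm_rate z = expR (- alpha * ln `|z|).
Proof. by move=> /eqP z0; rewrite /norm_rate (negbTE z0) /powR normr_eq0 (negbTE z0). Qed.

Let near_neq0 (z : E) : z <> 0 -> \forall y \near z, y <> 0.
Proof.
move=> z0; have : nbhs z (~` [set 0]).
  by exact: (open_nbhs_nbhs (conj (closed_openC closed_zero) z0)).
by apply: filterS.
Qed.

Let norm_rate_continuous (z : E) : z <> 0 -> {for z, continuous norm_rate}.
Proof.
move=> z0; have nz : `|z| != 0 by rewrite normr_eq0; apply/eqP.
rewrite /prop_for /continuous_at norm_rateE//.
have : expR (- alpha * ln `|y|) @[y --> z] --> expR (- alpha * ln `|z|).
  apply: continuous_cvg; first exact: continuous_expR.
  apply: cvgM; first exact: cvg_cst.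
  apply: continuous_cvg; first by apply: continuous_ln; rewrite lt_neqAle eq_sym nz normr_ge0.
  exact: norm_continuous.
apply: cvg_trans; apply: near_eq_cvg.
have := near_neq0 z0; apply: filterS => y y0; by rewrite norm_rateE.
Qed.

Lemma rate_function_norm : rate_function 0 norm_rate.
Proof.
split.
- by rewrite /norm_rate eqxx.
- by move=> z /norm_rateE ->; exact: expR_gt0.
- exact: norm_rate_continuous.
- by apply: (borel_funP 0); exact: (borel_continuous_off closed_zero norm_rate_continuous).
Qed.

Let rate := rate_function_norm.
Local Notation X' := (time_change (del := 0) (X := Z) (g := norm_rate)).

Let hit (n : nat) (w : Omega) : \bar R :=
  ereal_inf [set t%:E | t in [set t : R | 0 <= t /\ `|Z t w| < n.+1%:R^-1]].

Let hit_ge0 n w : (0 <= hit n w)%E.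
Proof. by apply: le_ereal_inf_tmp => _ [t [t0 _] <-]; rewrite lee_fin. Qed.

Let norm_rc w (t : R) : 0 <= t -> `|Z s w| @[s --> t^'+] --> `|Z t w|.
Proof. by move=> t0; apply: cvg_norm; have [_ rc _] := aZ w; exact: rc. Qed.

(** The balls are open: by right-continuity, a visit before [v] persists to a rational time before
    [v]. *)
Let hit_stopping n : stopping_time G (hit n).
Proof.
apply: (stopping_time_of_lt fG) => [w|v v0]; first exact: hit_ge0.
have -> : [set w | (hit n w < v%:E)%E] = \bigcup_(q : rat)
    if (0 <= ratr q :> R) && (ratr q < v) then Z (ratr q) @^-1` [set z : E | `|z| < n.+1%:R^-1]
    else set0.
  apply/seteqP; split => w /=.
    move=> /ereal_inf_lt[_ [t [t0 Zt] <-]]; rewrite lte_fin => tv.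
    have : \forall s \near t^'+, `|Z s w| < n.+1%:R^-1 by exact: (cvgr_lt _ (norm_rc t0) _ Zt).
    move=> -[e /= e0 he].
    have /rat_in_itvoo[q] : t < Num.min v (t + e) by rewrite lt_min tv ltrDl.
    rewrite in_itv /= => /andP[tq]; rewrite lt_min => /andP[qv qe].
    exists q => //; rewrite qv (le_trans t0 (ltW tq)) /=.
    by apply: he => //=; rewrite distrC gtr0_norm ?subr_gt0// ltrBlDl.
  move=> [q _]; case: ifPn => // /andP[q0 qv] /= Zq.
  apply: (@le_lt_trans _ _ (ratr q)%:E); last by rewrite lte_fin.
  by apply: ereal_inf_lbound; exists (ratr q).
apply: (salg_bigcup_rat (filtration_salg fG (ltW v0))) => q.
  case: ifPn => [/andP[q0 qv]|_]; last exact: salg0 (filtration_salg fG (ltW v0)).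
  apply: (filtration_le fG q0 (ltW qv)); apply: (sm_adapted sm q0).
  apply: sub_sigma_algebra.
  rewrite (_ : [set _ | _] = Num.norm @^-1` `]-oo, n.+1%:R^-1[%classic); last first.
    by apply/seteqP; split => z /=; rewrite in_itv.
  by apply: open_comp; [move=> z _; exact: norm_continuous|exact: interval_open].
Qed.

Let hit_mono n w : (hit n w <= hit n.+1 w)%E.
Proof.
apply: ereal_inf_le_tmp => _ [t [t0 Zt] <-]; exists t => //; split => //.
by apply: lt_trans Zt _; rewrite ltf_pV2 ?posrE// ltr_nat.
Qed.

(** At the entrance time itself, right-continuity only places the path in the closed ball. *)
Let hit_norm n w (u : R) : hit n w = u%:E -> `|Z u w| <= n.+1%:R^-1.
Proof.
move=> hu; have u0 : 0 <= u by rewrite -lee_fin -hu hit_ge0.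
rewrite leNgt; apply/negP => Zu.
have : \forall s \near u^'+, n.+1%:R^-1 < `|Z s w| by exact: (cvgr_gt _ (norm_rc u0) _ Zu).
move=> -[e /= e0 he].
have : (hit n w < (u + e)%:E)%E by rewrite hu lte_fin ltrDl.
move=> /ereal_inf_lt[_ [t [t0 Zt] <-]]; rewrite lte_fin => tue.
have ut : u <= t by rewrite -lee_fin -hu; apply: ereal_inf_lbound; exists t.
move: ut; rewrite le_eqVlt => /predU1P[ut|ut].
  by move: Zt; rewrite -ut ltNge (ltW Zu).
have := he t _ ut; rewrite /= distrC gtr0_norm ?subr_gt0// ltrBlDl => /(_ tue).
by rewrite ltNge (ltW Zt).
Qed.

(* Quasi-left-continuity at the hitting times of the balls of radius 1/(n+1)
   keeps the path away from 0 before its lifetime. *)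
Lemma left_limits_off_ssMp : left_limits_off 0 P Z.
Proof.
move=> x; have := sm_left_limits sm x.
have := sm_quasi_left_continuous sm hit_stopping hit_mono x.
apply: filterS2 => w qlc ll t t0 tK.
have [l Zl] := ll t t0 tK; exists l => // l0.
(* Otherwise all entrance times are at most [t], and so is their supremum [tau], which then precedes
   the lifetime. Quasi-left-continuity makes the path at these times converge to the nonzero vector
   at [tau], while its norm is at most [1/(n+1)]. *)
have [n tn] : exists n, (t%:E < hit n w)%E.
  apply: contrapT => /forallNP nh.
  set tau := ereal_sup _ in qlc.
  have hle n : (hit n w <= t%:E)%E by rewrite leNgt; exact/negP.
  have taut : (tau <= t%:E)%E by apply: ge_ereal_sup => _ [n _ <-].
  have tau0 : (0 <= tau)%E.
    by apply: (le_trans (hit_ge0 0 w)); apply: ereal_sup_ubound; exists 0%N.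
  have tauK := le_lt_trans taut tK; have := qlc tauK.
  case tE : tau tau0 taut tauK => [r| |]// r0 rt rK Zr.
  have r0' : 0 <= r by rewrite -lee_fin.
  have Zr0 := (lifetime_gtP sm w r0').1 rK.
  have c0 : 0 < `|Z r w| / 2 by rewrite divr_gt0// normr_gt0; apply/eqP.
  have n1 : \forall n \near \oo, `|Z r w| / 2 < `|Z (fine (hit n w)) w|.
    have Zr' : `|Z (fine (hit n w)) w| @[n --> \oo] --> `|Z r w| by exact: cvg_norm Zr.
    apply: (cvgr_gt _ Zr').
    by rewrite ltr_pdivrMr// ltr_pMr ?normr_gt0 ?ltr1n//; apply/eqP.
  have n2 : \forall n \near \oo, n.+1%:R^-1 < `|Z r w| / 2.
    by have := near_infty_natSinv_lt (PosNum c0).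
  near \oo => n.
  have : `|Z r w| / 2 < `|Z (fine (hit n w)) w| by near: n.
  apply/negP; rewrite -leNgt; apply: (@le_trans _ _ n.+1%:R^-1); last first.
    by apply: ltW; near: n.
  apply: hit_norm; rewrite fineK// ge0_fin_numE//.
  exact: le_lt_trans (hle n) (ltry t).
(* A left limit 0 at [t] brings the path into the ball of radius [1/(n+1)] before [t], against
   [t < hit n w]. *)
have : \forall s \near t^'-, `|Z s w| < n.+1%:R^-1.
  have Zl' : `|Z s w| @[s --> t^'-] --> `|l| by exact: cvg_norm Zl.
  apply: (cvgr_lt _ Zl').
  by rewrite l0 normr0 invr_gt0.
move=> nl; near (t^'-) => s.
have s0 : 0 < s by near: s; exact: nbhs_left_gt.
have st : s < t by near: s; exact: nbhs_left_lt.
have Zs : `|Z s w| < n.+1%:R^-1 by near: s.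
move: tn; rewrite ltNge => /negP; apply.
apply: (@le_trans _ _ s%:E); last by rewrite lee_fin ltW.
by apply: ereal_inf_lbound; exists s => //; split => //; exact: ltW.
Unshelve. all: by end_near. Qed.

Let clock_before w (v : \bar R) : (v <= lifetime 0%R Z w)%E ->
  clock (norm_clock alpha Z w) v = path_clock norm_rate (Z ^~ w) v.
Proof.
move=> vK; apply: eq_integral => r; rewrite inE => -[r0 rv].
rewrite /norm_clock /norm_powN /norm_rate.
have /(lifetime_gtP sm w r0)/eqP/negbTE -> // := lt_le_trans rv vK.
Qed.

(** Processes are indexed by all of [R] and are compared as functions; at negative times both
    inverses take the value 0. *)
Let clock_inverse_lt0 (g : R -> \bar R) (t : R) : (forall r, 0 <= g r)%E -> t < 0 ->
  clock_inverse g t = 0%E.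
Proof.
move=> g0 t0; apply/le_anti/andP; split; last first.
  by apply: le_ereal_inf_tmp => _ [s [/ltW s0 _] <-]; rewrite lee_fin.
apply/lee_addgt0Pr => e e0; rewrite add0e; apply: ereal_inf_lbound; exists e => //.
split=> //; apply: (@lt_le_trans _ _ 0%E); first by rewrite lte_fin.
exact: integral_ge0.
Qed.

(** If the inverses differed, the smaller one would lie before the lifetime, and so would some time,
    still below the larger one, at which its clock exceeds [t]. The clocks agree there, so the
    larger inverse would be at most that time. *)
Let clock_inverse_before w (t : R) : 0 <= t ->
  (t%:E < clock (norm_clock alpha Z w) (lifetime 0%R Z w))%E ->
  clock_inverse (norm_clock alpha Z w) t = path_inverse norm_rate (Z ^~ w) t.
Proof.
move=> t0; rewrite clock_before// -(path_inverse_ltP rate)// => IK.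
apply/le_anti/andP; split; rewrite leNgt; apply/negP => lt.
  have : (path_inverse norm_rate (Z ^~ w) t <
      mine (clock_inverse (norm_clock alpha Z w) t) (lifetime 0%R Z w))%E.
    by rewrite lt_min lt IK.
  move=> /ereal_inf_lt[_ [v [v0 tv] <-]]; rewrite lt_min => /andP[+ vK].
  rewrite ltNge => /negP; apply; apply: ereal_inf_lbound; exists v => //; split => //.
  by rewrite clock_before// ltW.
move: lt => /ereal_inf_lt[_ [v [v0 tv] <-]] vI.
move: (vI); rewrite ltNge => /negP; apply; apply: ereal_inf_lbound; exists v => //; split => //.
by rewrite -[X in (_ < X)%E]clock_before//; apply: ltW; exact: lt_trans IK.
Qed.

Lemma MAP_of_ssMpE : MAP_of_ssMp alpha Z = fun t w => polar (X' t w).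
Proof.
apply/funext => t; apply/funext => w; rewrite /MAP_of_ssMp /MAP_of_ssMp_lifetime.
have nc0 r : (0 <= norm_clock alpha Z w r)%E.
  by rewrite /norm_clock /norm_powN; case: ifP => // _; rewrite lee_fin powR_ge0.
have nr0 r : (0 <= (norm_rate (Z r w))%:E)%E.
  by rewrite lee_fin /norm_rate; case: ifP => // _; exact: powR_ge0.
have [t0|t0] := ltP t 0.
  rewrite ifT; last first.
    by apply: (@lt_le_trans _ _ 0%E); [rewrite lte_fin|exact: integral_ge0].
  rewrite clock_inverse_lt0//; congr polar; apply: esym; apply: path_time_change_fin.
  exact: clock_inverse_lt0.
case: ifPn => tK.
  rewrite clock_inverse_before//; congr polar; apply: esym.
  move: tK; rewrite clock_before// -(path_inverse_ltP rate)// => IK.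
  have := @path_inverse_ge0 _ _ norm_rate (Z ^~ w) t.
  case IE : (path_inverse _ _ _) IK => [s| |]//; last by rewrite ltNge leey.
  by move=> _ _; exact: path_time_change_fin.
rewrite (_ : X' t w = 0) ?polar0//; apply: contrapT => /(path_inverse_fin rate (aZ w) t0)[s Is].
have [s0 Zs As] := (path_inverseP rate s (aZ w) t0).1 Is.
move: tK; rewrite clock_before// -(path_inverse_ltP rate)// Is => /negP; apply.
exact/(lifetime_gtP sm w s0).
Qed.

Lemma lifetime_MAP_of_ssMp w :
  MAP_lifetime (MAP_of_ssMp alpha Z) w = MAP_of_ssMp_lifetime alpha Z w.
Proof.
rewrite /MAP_lifetime lifetime_modulator /MAP_of_ssMp_lifetime clock_before// MAP_of_ssMpE.
rewrite -[RHS](path_lifetime_time_change rate (aZ w)).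
rewrite /path_lifetime /lifetime; congr ereal_inf.
by apply/seteqP; split => _ [t [t0 /polar_del Xt] <-]; exists t.
Qed.

Local Notation H := (changed_filtration (X := Z) (G := G) (g := norm_rate)).
Local Notation Y := (MAP_of_ssMp alpha Z).

Let smX : strong_markov 0 H P X' := strong_markov_time_change sm coz rate left_limits_off_ssMp.
Let llX : left_limits_off 0 P X' := left_limits_off_time_change sm rate left_limits_off_ssMp.

Lemma strong_markov_MAP_of_ssMp : strong_markov grave H (fun y => P (of_polar y)) Y.
Proof.
rewrite MAP_of_ssMpE.
apply: (@strong_markov_transfer _ _ _ _ _ 0 (grave : TT) _ P X' polar of_polar smX llX).
- exact: polar_del.
- exact: polar_continuous.
- exact: borel_polar.
- exact: borel_of_polar.
- exact: polarK.
- by move=> x s B s0 bB; rewrite of_polarK.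
Qed.

Lemma left_limits_off_MAP_of_ssMp : left_limits_off grave (fun y => P (of_polar y)) Y.
Proof.
rewrite MAP_of_ssMpE.
apply: (@left_limits_off_transfer _ _ _ _ _ 0 (grave : TT) P X' polar of_polar llX).
- exact: polar_del.
- exact: polar_continuous.
Qed.

Let scale_path (c : R) (p : R -> E) (r : R) : E := c *: p (c `^ (- alpha) * r).

Let absorbed_scale (c : R) p : 0 < c -> absorbed_path 0 p -> absorbed_path 0 (scale_path c p).
Proof.
move=> c0 [trap rc dead]; have a0 : 0 < c `^ (- alpha) by exact: powR_gt0.
have a0' := ltW a0; have cn : c != 0 by rewrite gt_eqF.
have s0P (z : E) : c *: z = 0 <-> z = 0.
  by split=> [h|->]; [apply: (scalerI cn); rewrite h scaler0|rewrite scaler0].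
split=> [s t s0 st /s0P ps|t t0|t t0 h].
- by apply/s0P; apply: trap ps; [exact: mulr_ge0|rewrite ler_pM2l].
- apply: cvgZl_tmp.
  have at0 : 0 <= c `^ (- alpha) * t by exact: mulr_ge0.
  move=> U /(rc _ at0); rewrite /= !nbhs_simpl/= => -[e e0 he].
  exists (e / c `^ (- alpha)) => /=; first exact: divr_gt0.
  move=> x /= xt tx; apply: he => /=; last by rewrite ltr_pM2l.
  by rewrite -mulrBr normrM gtr0_norm// mulrC -ltr_pdivlMr.
- apply/s0P; apply: dead; first exact: mulr_ge0.
  move=> s ts; apply/s0P; have := h (s / c `^ (- alpha)).
  rewrite /scale_path mulrCA divff ?gt_eqF// mulr1; apply.
  by rewrite ltr_pdivlMr// mulrC.
Qed.

(** The factor [c^(-alpha)] by which scaling multiplies the rate is exactly the Jacobian of the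
    substitution [r |-> c^(-alpha) r]. *)
Let path_clock_scale (c s : R) p : 0 < c -> absorbed_path 0 p ->
  path_clock norm_rate (scale_path c p) s%:E =
  path_clock norm_rate p (c `^ (- alpha) * s)%:E.
Proof.
move=> c0 ap; have a0 : 0 < c `^ (- alpha) by exact: powR_gt0.
have rate_scale (z : E) : norm_rate (c *: z) = c `^ (- alpha) * norm_rate z.
  rewrite /norm_rate scaler_eq0 gt_eqF//=; case: ifP => _; first by rewrite mulr0.
  by rewrite normrZ gtr0_norm// powRM// ltW.
have rate0 x : (0 <= (norm_rate x)%:E)%E.
  by rewrite lee_fin /norm_rate; case: ifP => // _; exact: powR_ge0.
rewrite [RHS](@path_clockE _ _ norm_rate).
rewrite (@lebesgue_affine _ (c `^ (- alpha)) 0)//; first last.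
- by apply/measurable_EFinP; exact: (measurable_rate rate).
- exact: measurable_before.
have -> : [set r : R | [set r : R | 0 <= r /\ (r%:E < (c `^ (- alpha) * s)%:E)%E]
      (c `^ (- alpha) * r + 0)] = [set r : R | 0 <= r /\ (r%:E < s%:E)%E].
  by apply/seteqP; split => r /=; rewrite addr0 !lte_fin pmulr_rge0// ltr_pM2l.
pose q r := norm_rate (p (Num.max 0 (c `^ (- alpha) * r + 0))).
have mq : measurable_fun (setT : set (measurableTypeR R)) q.
  have := measurable_rate rate ap => mr.
  have ma : measurable_fun setT
      (fun r : measurableTypeR R => c `^ (- alpha) * r + 0 : measurableTypeR R).
    by apply: measurable_funD => //; apply: measurable_funM.
  exact: (measurableT_comp mr ma).
rewrite -ge0_integralZl//; first last.
- by rewrite lee_fin ltW.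
- by apply: measurable_funTS; apply/measurable_EFinP; exact: mq.
- exact: (measurable_before s%:E).
apply: eq_integral => r; rewrite inE => -[r0 _].
by rewrite /scale_path rate_scale addr0 max_r// mulr_ge0// ltW.
Qed.

(** The rescaling of time cancels in the time change, so only the factor [c] remains and scaling
    becomes a translation of the ordinate at unchanged times. *)
Let time_change_scale (c t : R) p : 0 < c -> absorbed_path 0 p -> 0 <= t ->
  path_time_change 0 norm_rate (scale_path c p) t = c *: path_time_change 0 norm_rate p t.
Proof.
move=> c0 ap t0; have ap' := absorbed_scale c0 ap.
have a0 : 0 < c `^ (- alpha) by exact: powR_gt0.
have cn : c != 0 by rewrite gt_eqF.
rewrite {2}/path_time_change; have := @path_inverse_ge0 _ _ norm_rate p t.
case IE : (path_inverse norm_rate p t) => [v| |]// _.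
  have [v0 pv Av] := (path_inverseP rate v ap t0).1 IE.
  have aK : c `^ (- alpha) * (v / c `^ (- alpha)) = v by rewrite mulrCA divff ?mulr1// gt_eqF.
  rewrite (@path_time_change_fin _ _ _ _ _ _ (v / c `^ (- alpha))); first by rewrite /scale_path aK.
  apply/(path_inverseP rate) => //; split.
  - by rewrite divr_ge0// ltW.
  - by rewrite /scale_path aK => h; apply: pv; apply: (scalerI cn); rewrite h scaler0.
  - by rewrite path_clock_scale// aK.
rewrite scaler0; apply: contrapT => /(path_inverse_fin rate ap' t0)[v vE].
have [v0 pv Av] := (path_inverseP rate v ap' t0).1 vE.
suff : path_inverse norm_rate p t = (c `^ (- alpha) * v)%:E by rewrite IE.
apply/(path_inverseP rate) => //; split.
- by rewrite mulr_ge0// ltW.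
- by move=> h; apply: pv; rewrite /scale_path h scaler0.
- by rewrite -path_clock_scale.
Qed.

(** Self-similarity with [c = e^a]. It is used for a path event of [Z], because the state of the
    time change at time [s] reads a whole portion of the path. *)
Lemma law_translate_MAP_of_ssMp y (s a : R) B : 0 <= s -> borel TT B ->
  P (of_polar y) ((translate a \o Y s) @^-1` B) =
  P (of_polar (translate a y)) (Y s @^-1` B).
Proof.
move=> s0 bB; have ea := expR_gt0 a.
have polarZ (z : E) : polar (expR a *: z) = translate a (polar z).
  rewrite -{1}(of_polarK z); case: (polar z) => [[u th]|] /=; last first.
    by rewrite scaler0 polar0.
  rewrite scalerA -expRD addrC.
  by rewrite -[_ *: _]/(of_polar (Some (u + a, th))) polarK.
have -> : of_polar (translate a y) = expR a *: of_polar y.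
  by rewrite -{1}(polarK y) -polarZ of_polarK.
have [C pC hC'] := path_time_change_event coz rate s0 (borel_polar bB).
have hC p : absorbed_path 0 p -> B (polar (path_time_change 0 norm_rate p s)) <-> C p := hC' p.
rewrite MAP_of_ssMpE.
have -> : (fun w => polar (X' s w)) @^-1` B = [set w | C (Z ^~ w)].
  by apply/seteqP; split => w; move/(hC _ (aZ w)).
rewrite -(ssMp_scaling ssZ ea (of_polar y) pC); congr (P _ _).
apply/seteqP; split => w /= h.
  apply/hC; first exact: (absorbed_scale ea (aZ w)).
  by rewrite (time_change_scale ea (aZ w) s0) polarZ.
by rewrite -polarZ -(time_change_scale ea (aZ w) s0); apply/hC => //; exact: absorbed_scale.
Qed.

End from_ssMp.

(** * From translation invariance to additivity *)

Lemma borel_image_Some (T : topologicalType) (A : set T) : borel T A ->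
  borel (cemetery T) (Some @` A).
Proof.
have [s0 sC sU] := @sigma_algebra_borel (cemetery T).
pose W := salg (grave : cemetery T) (@sigma_algebra_borel (cemetery T)).
have bg : borel (cemetery T) [set grave].
  rewrite -(setCK [set grave]); apply: (@measurableC _ W); apply: sub_sigma_algebra.
  exact: (closed_openC closed_grave).
suff h : borel T `<=` [set A | borel (cemetery T) (Some @` A)] by move=> /h.
apply: smallest_sub; last first.
  move=> U oU /=; apply: sub_sigma_algebra.
  rewrite /open /= /cemetery_open /= (_ : _ @^-1` _ = U)//.
  by apply/seteqP; split => [x [y Uy [<-]]//|x Ux]; exists x.
split => [|B bB|B bB] /=.
- by rewrite image_set0.
- rewrite (_ : _ @` _ = ~` (Some @` B) `&` ~` [set grave]).
    apply: (@measurableI _ W); apply: (@measurableC _ W); [exact: bB|exact: bg].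
  apply/seteqP; split => [_ [x [_ nB] <-]|[x|] [h k]].
  - by split => // -[y By [xy]]; apply: nB; rewrite -xy.
  - by exists x => //; split => // Bx; apply: h; exists x.
  - by case: k.
- rewrite (_ : _ @` _ = \bigcup_n (Some @` B n)); first exact: sU.
  apply/seteqP; split => [_ [x [n _ Bx] <-]|_ [n _ [x Bx <-]]]; first by exists n => //; exists x.
  by exists x => //; exists n.
Qed.

Lemma borel_fun_ext0 (R : realType) (T : topologicalType) (f : T -> R) :
  borel_fun f -> borel_fun (ext0 f : cemetery T -> R).
Proof.
move=> bf B mB.
have [s0 sC sU] := @sigma_algebra_borel (cemetery T).
pose W := salg (grave : cemetery T) (@sigma_algebra_borel (cemetery T)).
have bg : @measurable _ W [set grave].
  rewrite -[X in measurable X]setCK; apply: measurableC; apply: sub_sigma_algebra.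
  exact: (closed_openC closed_grave).
rewrite (_ : _ @^-1` _ = Some @` (f @^-1` B) `|` ([set grave] `&` [set _ | B 0])).
  apply: (@measurableU _ W); first exact: (borel_image_Some (bf _ mB)).
  apply: measurableI => //; have [Bc|Bc] := pselect (B 0).
    by rewrite (_ : [set _ | _] = setT)//; apply/seteqP; split.
  by rewrite (_ : [set _ | _] = set0)// -subset0.
apply/seteqP; split => [[x|] /= Bf|_ [[x Bf <-]|[-> //]]//].
- by left; exists x.
- by right.
Qed.

Section MAP_of_translation.
Context {R : realType} {S : topologicalType}.
Local Notation TT := (cemetery (R * S)).
Context {d : measure_display} {Omega : measurableType d}.
Context {G : R -> set_system Omega} {P : TT -> probability Omega R}.
Context {Y : R -> Omega -> TT}.
Hypotheses (sm : strong_markov grave G P Y) (coz : cozero_space R TT).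
Hypotheses (llY : left_limits_off grave P Y)
  (law : forall y (s a : R) B, 0 <= s -> borel TT B ->
    P y ((translate a \o Y s) @^-1` B) = P (translate a y) (Y s @^-1` B)).

Let fG : filtration G := sm_filtration sm.

Let modulator_continuous : continuous (@modulator R S).
Proof.
apply: continuous_cemetery => p.
apply: (@continuous_comp _ _ (cemetery S) (snd : R * S -> S) Some p); first exact: cvg_snd.
exact: continuous_Some.
Qed.

Let state_continuous (x : R) : continuous (state x : cemetery S -> TT).
Proof.
apply: continuous_cemetery => th.
apply: (@continuous_comp _ _ TT (fun th : S => (x, th)) Some th); last exact: continuous_Some.
by apply: (@cvg_pair _ _ _ (nbhs th) (nbhs x) (nbhs th)); [exact: cvg_cst|exact: cvg_id].
Qed.

Lemma strong_markov_modulator (x : R) :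
  strong_markov grave G (fun th => P (state x th)) (fun t w => modulator (Y t w)).
Proof.
apply: (@strong_markov_transfer _ _ _ _ (cemetery S) grave grave _ P Y _ (state x) sm llY).
- exact: modulator_grave.
- by move=> y _; exact: modulator_continuous.
- by apply: (borel_continuous grave); exact: modulator_continuous.
- by apply: (borel_continuous grave); exact: state_continuous.
- by case.
- move=> y s B s0 bB; have bM : borel TT (@modulator R S @^-1` B).
    by apply: (borel_continuous grave) bB; exact: modulator_continuous.
  have modK a (z : TT) : modulator (translate a z) = modulator z by case: z => [[]|].
  (* Two starting points with the same modulator differ by a translation, which the modulator does
     not see. *)
  have stE : exists a, state x (modulator y) = translate a y.
    by case: y => [[u th]|]; [exists (x - u); rewrite /= addrC subrK|exists 0].
  have [a ->] := stE; rewrite -(law y a s0 bM); congr (P y _).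
  by apply/seteqP; split => w /=; rewrite modK.
Qed.

Let abscissa (y : TT) : R := if y is Some (x, _) then x else 0.

Let base (y : TT) : TT := state 0 (modulator y).

Let abscissa_continuous : continuous abscissa.
Proof.
apply: continuous_cemetery.
rewrite (_ : _ \o _ = fst); last by apply/funext => -[].
by move=> p; exact: cvg_fst.
Qed.

Let baseE y : translate (- abscissa y) y = base y.
Proof. by case: y => [[x th]|] //=; rewrite subrr. Qed.

Let base_continuous : continuous base.
Proof.
by move=> y; apply: (@continuous_comp _ _ TT (@modulator R S) (state 0));
  [exact: modulator_continuous|exact: state_continuous].
Qed.

Local Notation bTT := (borelType (grave : TT)).

(** Measurability for the product sigma-algebra, not the Borel sets of a product topology: composed
    with a cozero function [k], the map is continuous in the first variable and Borel in the
    second. *)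
Let measurable_translate :
  measurable_fun setT ((fun p => translate (- p.1) p.2) : measurableTypeR R * bTT -> bTT).
Proof.
move=> _ B bB; rewrite setTI.
apply: (@borel_preimage TT _ (measurableTypeR R * bTT)%type
  (fun p => translate (- p.1) p.2 : TT)) bB => U /coz[k ck ->].
have mk : measurable_fun setT (fun p : measurableTypeR R * bTT => k (translate (- p.1) p.2)).
  apply: (@measurable_right_continuous R _ bTT (fun r y => k (translate (- r) y))) => [r|r y].
    apply/(borel_fun_measurable grave); apply: (borel_funP grave).
    apply: (borel_continuous grave) => y.
    by apply: (@continuous_comp _ _ _ (translate (- r)) k); [exact: translate_continuous|exact: ck].
  suff ch : {for r, continuous (fun x => k (translate (- x) y))}.
    exact: (cvg_at_right_filter ch).
  apply: (@continuous_comp _ _ _ (fun x => translate (- x) y) k); last exact: ck.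
  apply: (@continuous_comp _ _ _ (fun x : R => - x) (translate ^~ y)).
    exact: opp_continuous.
  exact: translate_continuous_l.
have := mk measurableT `]0, +oo[%classic (measurable_itv _).
by rewrite setTI; congr measurable; apply/seteqP; split => p /=; rewrite in_itv/= andbT.
Qed.

(** While [Y t] is alive, the increment is [Y (t + s)] translated by minus the abscissa of [Y t], an
    amount known at time [t]. Given [G t], the state [Y (t + s)] is distributed as [Y s] started
    from [Y t]; with the amount frozen, translation invariance moves this start to ordinate 0. *)
Lemma MAP_of_translation : MAP G P Y.
Proof.
split => //; first exact: strong_markov_modulator.
move=> Xi zeta f bf f0 [M fM] t s t0 s0 y th.
have ts0 : 0 <= t + s by exact: addr_ge0.
pose D := [set w | Y t w <> grave].
have GD : G t D.
  apply: (sm_adapted sm t0 (B := ~` [set grave])); apply: sub_sigma_algebra.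
  exact: (closed_openC closed_grave).
pose xi w := increment (Y t w) (Y (t + s) w).
pose Q w := P (base (Y t w)).
have mY (r : R) : 0 <= r -> measurable_fun setT (Y r : Omega -> bTT).
  by move=> r0 _ B bB; rewrite setTI; exact: (process_measurable sm r0 bB).
have ma : measurable_fun setT (fun w => abscissa (Y t w) : measurableTypeR R).
  move=> _ A mA; rewrite setTI; apply: (process_measurable sm t0 (B := abscissa @^-1` A)).
  by apply: (borel_funP grave) mA; apply: (borel_continuous grave); exact: abscissa_continuous.
have xiE w : D w -> xi w = translate (- abscissa (Y t w)) (Y (t + s) w).
  by rewrite /D /xi /=; case: (Y t w) => [[u v]|]//= _; case: (Y (t + s) w) => [[]|].
have FQ B A : borel TT B -> measurable A ->
    G t (D `&` (fun w => Q w (Y s @^-1` B)) @^-1` A).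
  move=> bB mA; apply: (salgI (filtration_salg fG t0) GD).
  apply: (sm_adapted sm t0 (B := base @^-1` [set y | A (P y (Y s @^-1` B))])).
  apply: (borel_continuous grave base_continuous).
  exact: (sm_kernel sm s0 bB mA).
have mxi : measurable_fun D (xi : Omega -> bTT).
  apply: (@eq_measurable_fun _ _ Omega bTT _
    (fun w => translate (- abscissa (Y t w)) (Y (t + s) w))).
    by move=> w /set_mem/xiE.
  apply: measurable_funTS.
  exact: (measurableT_comp measurable_translate (measurable_fun_pair ma (mY _ ts0))).
apply: (@condexp_of_kernel R _ Omega _ bTT _ Omega Q (Y s) (P (Some (y, th))) (G t) D xi
  (ext0 f) M) => //.
- by case: fG => + _ _; exact.
- exact: mY.
- move=> L B GL bB; pose A := L `&` D.
  have GA : G t A by exact: (salgI (filtration_salg fG t0)).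
  have mA : measurable A by exact: (filtration_measurable fG t0 GA).
  (* The translation that rebases the path depends on [Y t], so the pair
     (abscissa (Y t), Y (t + s)) is disintegrated, first on rectangles. *)
  pose rect : set_system (measurableTypeR R * bTT) :=
    [set C | exists A1 B1,
      [/\ measurable (A1 : set (measurableTypeR R)), borel TT B1 & C = A1 `*` B1]].
  have rectI : setI_closed rect.
    move=> _ _ [A1 [B1 [mA1 bB1 ->]]] [A2 [B2 [mA2 bB2 ->]]].
    exists (A1 `&` A2), (B1 `&` B2); split; first exact: measurableI.
      exact: (@measurableI _ bTT).
    by rewrite setXI.
  have rectP C : <<s rect >> C -> measurable C.
    suff : <<s rect >> `<=` measurable by exact.
    apply: smallest_sub; first exact: sigma_algebra_measurable.
    by move=> _ [A1 [B1 [mA1 bB1 ->]]]; exact: measurableX.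
  have rectM C : measurable C -> <<s rect >> C.
    rewrite measurable_prod_measurableType.
    apply: (@sub_sigma_algebra2 _ setT rect) => _ [A1 mA1 [B1 mB1 <-]].
    by exists A1, B1.
  pose eta w v := (abscissa (Y t w), Y s v) : measurableTypeR R * bTT.
  pose Yt w := (abscissa (Y t w), Y (t + s) w) : measurableTypeR R * bTT.
  have meta w : measurable_fun setT (eta w).
    exact: (measurable_fun_pair (@measurable_cst _ _ Omega (measurableTypeR R) setT _) (mY _ s0)).
  have mYt : measurable_fun setT Yt by exact: (measurable_fun_pair ma (mY _ ts0)).
  have etaE w A1 B1 : (P (Y t w) (eta w @^-1` (A1 `*` B1)) =
      if w \in (abscissa \o Y t) @^-1` A1 then P (Y t w) (Y s @^-1` B1) else 0)%E.
    case: ifPn => [/set_mem|/negP] h.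
      by congr (P (Y t w) _); apply/seteqP; split => v /=; [case|split].
    rewrite (_ : _ @^-1` _ = set0) ?measure0// -subset0 => v [/= + _].
    by move=> h'; apply: h; exact: mem_set.
  have mA1 A1 : measurable A1 -> G t ((abscissa \o Y t) @^-1` A1).
    move=> mA1; apply: (sm_adapted sm t0 (B := abscissa @^-1` A1)).
    by apply: (borel_funP grave) mA1; apply: (borel_continuous grave); exact: abscissa_continuous.
  have mQ C : rect C -> measurable_fun A (fun w => P (Y t w) (eta w @^-1` C)).
    move=> [A1 [B1 [mA1' bB1 ->]]]; apply: measurable_funTS.
    apply: (eq_measurable_fun (fun w => if w \in (abscissa \o Y t) @^-1` A1
      then P (Y t w) (Y s @^-1` B1) else 0%E)); first by move=> w _; rewrite etaE.
    apply: measurable_fun_extend; first exact: (filtration_measurable fG t0 (mA1 _ mA1')).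
    apply: measurable_funTS.
    have mk := (borel_fun_measurable (grave : TT) _).1 (sm_kernel sm s0 bB1).
    exact: (measurable_comp (@measurableT _ bTT) _ mk (mY _ t0)).
  pose C := (fun p : measurableTypeR R * bTT => translate (- p.1) p.2 : bTT) @^-1` B.
  have mC : measurable C by rewrite -[C]setTI; exact: measurable_translate.
  have metaC w C' : <<s rect >> C' -> measurable (eta w @^-1` C').
    by move=> /rectP mC'; rewrite -[X in measurable X]setTI; exact: meta.
  transitivity (P (Some (y, th)) (A `&` Yt @^-1` C)).
    by congr (P _ _); apply/seteqP; split => w [[Lw Dw] Bw]; split => //; move: Bw;
      rewrite /= xiE.
  rewrite (@dynkin_disintegration _ _ _ _ _ _ rect (fun w => P (Y t w)) eta rectI metaC
    _ A Yt mA _ _ _ C (rectM _ mC)).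
  (* For fixed [w] the translation is deterministic, and the symmetry carries the start [Y t w] to
     [base (Y t w)]. *)
  - apply: eq_integral => w /set_mem[_ Dw]; rewrite /Q -baseE -law//.
  - move=> C' /rectP mC'; apply: measurableI => //.
    by rewrite -[X in measurable X]setTI; exact: mYt.
  - exact: (measurable_dynkin_kernel (Q := fun w => P (Y t w)) rectI metaC mA mQ).
  - move=> _ [A1 [B1 [mA1' bB1 ->]]].
    have pB : path_events [set p : R -> TT | B1 (p s)].
      by apply: sub_sigma_algebra; exists s, B1.
    have GA1 := salgI (filtration_salg fG t0) GA (mA1 _ mA1').
    transitivity (\int[P (Some (y, th))]_(w in A `&` (abscissa \o Y t) @^-1` A1)
        P (Y t w) (Y s @^-1` B1))%E.
      rewrite -(markov_at sm coz (Some (y, th)) t0 GA1 pB); congr (P _ _).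
      by apply/seteqP; split => w /=; [case=> ? []|case=> -[]].
    rewrite integral_mkcondr; apply: eq_integral => w _.
    by rewrite patchE etaE.
- by apply/(borel_fun_measurable grave); exact: borel_fun_ext0.
- by move=> [u|]; [rewrite /= ger0_norm|rewrite /= normr0; exact: le_trans (f0 (y, th)) (fM _)].
(* From the lifetime on, the increment is [None], where [ext0 f] takes the value 0, in accordance
   with the indicator. *)
- move=> w Dw; rewrite /zeta lifetime_modulator; case: ifPn => // /negP.
  move=> /(contra_not (lifetime_gtP sm w ts0).2)/contrapT; rewrite /xi => ->.
  by case: (Y t w) => [[]|].
- move=> w /contrapT Dw; rewrite Dw; case: ifP => //.
- move=> w; rewrite /D /Xi /Q /=; case: (Y t w) => [[u v]|]//= _.
  congr expectation; apply/funext => v'; rewrite /zeta lifetime_modulator; case: ifPn => // /negP.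
  by move=> /(contra_not (lifetime_gtP sm v' s0).2)/contrapT ->.
- by move=> w /contrapT; rewrite /Xi => ->.
Qed.

End MAP_of_translation.

Theorem theorem1p1 (R : realType) (E : completeNormedModType R)
    (E_locally_compact : locally_compact [set: E]) (E_separable : separable E)
    (alpha : R) (alpha_gt0 : 0 < alpha) :
  (forall (d : measure_display) (Omega : measurableType d)
      (G : R -> set_system Omega)
      (P : cemetery (R * unit_sphere E) -> probability Omega R)
      (Y : R -> Omega -> cemetery (R * unit_sphere E)),
    MAP G P Y ->
    (exists H : R -> set_system Omega,
       ssMp alpha H (fun z => P (polar z)) (ssMp_of_MAP alpha Y)) /\
    (forall w, lifetime 0 (ssMp_of_MAP alpha Y) w =
               ssMp_of_MAP_lifetime alpha Y w))
  /\
  (forall (d : measure_display) (Omega : measurableType d)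
      (G : R -> set_system Omega) (P : E -> probability Omega R)
      (Z : R -> Omega -> E),
    ssMp alpha G P Z ->
    (exists H : R -> set_system Omega,
       MAP H (fun y => P (of_polar y)) (MAP_of_ssMp alpha Z)) /\
    (forall w, MAP_lifetime (MAP_of_ssMp alpha Z) w =
               MAP_of_ssMp_lifetime alpha Z w)).
Proof.
split=> d Omega G P.
  move=> Y mapY; split; last exact: (lifetime_ssMp_of_MAP alpha_gt0 mapY).
  by eexists; exact: (ssMp_of_MAP_ssMp alpha_gt0 mapY).
move=> Z ssZ; split; last first.
  exact: (lifetime_MAP_of_ssMp ssZ).
eexists; apply: (MAP_of_translation (strong_markov_MAP_of_ssMp ssZ) cozero_space_polar).
- exact: (left_limits_off_MAP_of_ssMp ssZ).
- by move=> y s a B; exact: (law_translate_MAP_of_ssMp ssZ).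
Qed.
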